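(* Let $P$ be an $n$-dimensional lattice polytope in $\mathbb{R}^n$ such that $h^*_P$ has degree $d$ and leading coefficient $h^*_d=k$. Then, with $N=(d^2+19d-4)/2$, \[\operatorname{Vol}(P)\le N^N\cdot(N!)^{N+1}\cdot k^N\cdot\min\Big(\big(7(k+1)\big)^{N^2\cdot 2^{N+1}},\ (8N)^{N^2}\,15^{N^2\cdot 2^{2N+1}}\Big).\]
   Context: For an $n$-dimensional lattice polytope $P\subset\mathbb{R}^n$, write $\sum_{m\ge0}|mP\cap\mathbb{Z}^n|t^m = h^*_P(t)/(1-t)^{n+1}$ with $h^*_P(t)=h^*_0+\dots+h^*_dt^d$ a polynomial of degree $d$, $h^*_d\ne0$. $\operatorname{Vol}(P)$ is the normalized volume, $n!$ times the Euclidean volume. *)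

(* Defs.v *)
From HB Require Import structures.
From mathcomp Require Import all_boot all_order all_algebra.
From mathcomp Require Import all_classical all_reals.
From mathcomp Require Import ereal numfun measure lebesgue_measure lebesgue_integral.
From mathcomp Require Import finmap.
Local Open Scope fset_scope.
Set Implicit Arguments. Unset Strict Implicit. Unset Printing Implicit Defensive.
Import Order.TTheory GRing.Theory Num.Theory.
Local Open Scope classical_set_scope.
Local Open Scope ring_scope.

Section LatticePolytopes.
Variable R : realType.

Definition lattice_point (n : nat) (x : 'rV[R]_n) : Prop :=
  forall i : 'I_n, x ord0 i \is a Num.int.

Definition conv (n : nat) (V : seq 'rV[R]_n) : set 'rV[R]_n :=
  [set x | exists lam : 'I_(size V) -> R,
      (forall i, 0 <= lam i) /\ \sum_(i < size V) lam i = 1 /\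
      x = \sum_(i < size V) lam i *: V`_i].

Definition full_dim (n : nat) (V : seq 'rV[R]_n) : Prop :=
  (0 < size V)%N /\ \rank (\matrix_(i < size V) (V`_i - V`_0)) = n.

Definition dilate (n : nat) (m : nat) (P : set 'rV[R]_n) : set 'rV[R]_n :=
  [set m%:R *: y | y in P].

(* Ehrhart function: |mP ∩ Z^n| (a finite set for a polytope P) *)
Definition ehrhart (n : nat) (P : set 'rV[R]_n) (m : nat) : nat :=
  #|` fset_set (dilate m P `&` [set x | lattice_point x]) |.

(* i-th coefficient of h^*_P(t) = (1 - t)^(n+1) * \sum_m |mP ∩ Z^n| t^m *)
Definition hstar (n : nat) (P : set 'rV[R]_n) (i : nat) : int :=
  \sum_(j < i.+1) (-1) ^+ j * ('C(n.+1, j))%:Z * (ehrhart P (i - j))%:Z.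

Fixpoint iter_integral (n : nat) : ('rV[R]_n -> \bar R) -> \bar R :=
  match n return ('rV[R]_n -> \bar R) -> \bar R with
  | 0 => fun f => f 0
  | n'.+1 => fun f =>
      (\int[lebesgue_measure]_(t in [set: R])
          iter_integral (fun x : 'rV[R]_n' =>
                           f (row_mx (const_mx t : 'rV[R]_1) x)))%E
  end.

Definition euclid_vol (n : nat) (S : set 'rV[R]_n) : \bar R :=
  iter_integral (fun x => ((\1_S x : R))%:E).

Definition normalized_vol (n : nat) (S : set 'rV[R]_n) : \bar R :=
  ((n`!)%:R%:E * euclid_vol S)%E.

End LatticePolytopes.

(* Main.v *)
(** Let C be the cone over P x {1} in dimension D = n + 1.  A generic triangulation
    of C into half-open simplicial cones gives
    - h*_i is the number of half-open box points at height i, so Vol P <= sum h*_i;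
    - dually, the interior lattice points of C have height at least c = D - d, and
      between 1 and k of them have height c.

    Let b be a simplex of maximal volume on the generators of C, so that all
    generators have coordinates in [-1, 1] with respect to b.  A set J of coordinates
    is enlarged as long as some lattice point is not integral outside J, or some
    generator is not a single b_j or zero outside J.  Each enlargement yields
    a lattice point whose sum with the b_j, j not in J, is interior and whose
    height grows by at most 3/4 of the growth of J.  Comparing with the height bound
    D - d gives |J| <= 4 d.  Hence P is a Cayley polytope: outside J the
    generators split into blocks, one for each j.

    Fixing the block masses of an interior point at height c gives a slice of
    dimension at most |J|, whose points are convex combinations of lattice points.
    Pigeonhole (Dirichlet) moves the interior point so that all its barycentric
    coordinates with respect to at most 2 (|J| + 1) lattice points, including
    a maximal-volume basis of the slice, are at least
    beta = (12 (|J| + 1)) ^ - 2 ^ (2 |J| + 1).  Adding to it the difference of two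
    lattice points lying in a common cell of side beta gives another interior point
    at height c, so such a cell holds at most k lattice points.  This bounds the
    number of blocks with two distinct generators; the other blocks do not
    contribute to box points.  It also bounds the number of box points with
    given height and block masses, hence the sum of the h*_i. *)

Require Import Defs.
From HB Require Import structures.
From mathcomp Require Import all_boot all_order all_algebra.
From mathcomp Require Import all_classical all_reals.
From mathcomp Require Import ereal numfun measure lebesgue_measure lebesgue_integral.
From mathcomp Require Import finmap measurable_realfun ring lra zify.
Set Implicit Arguments. Unset Strict Implicit. Unset Printing Implicit Defensive.
Import Order.TTheory GRing.Theory Num.Theory.
Local Open Scope ring_scope.

(** * Cones of nonnegative combinations *)

(** Every point of the cone must be charged to exactly one simplicial cone, so shared faces have to
    be distributed. A generic interior direction [q] does this: a point goes to the cell entered by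
    a small move along [q], and an interior point can equally be assigned by a small move along
    [-q]. Complementing coordinates exchanges the two conventions, which is how heights of interior
    points see the degree of [h*]. The constant 3/4 has two sources. Rounding [z] and [-z] together
    saves one unit at each non-integral coordinate, and half of the possible ones can be made
    non-integral at once. Afterwards, a generator with p positive and m negative coordinates outside
    J costs min(p, m + 1), which is at most 3(p + m)/4 as soon as m > 0 or p > 1. The double
    exponent in beta arises because each coordinate reached without a gap squares the previous
    bound. The final estimate has 14 where the theorem has 7(k + 1) or 15. It lies below both
    entries of the minimum because k is at least 1. *)

Lemma exists_pos_small (R : realFieldType) (I : finType) (l m : I -> R) :
  (forall i, 0 < l i) -> exists2 e : R, 0 < e & forall i, e * `|m i| <= l i.
Proof.
move=> l0; set S := \sum_i `|m i| / l i.
have S0 : 0 <= S by apply: sumr_ge0 => i _; rewrite divr_ge0 // ltW.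
exists (1 + S)^-1; first by rewrite invr_gt0; lra.
move=> i; rewrite mulrC ler_pdivrMr; last lra.
have : `|m i| / l i <= S.
  rewrite /S (bigD1 i) //= lerDl; apply: sumr_ge0 => j _.
  by rewrite divr_ge0 // ltW.
rewrite ler_pdivrMr // => h; apply: le_trans h _.
by have := l0 i; lra.
Qed.

Section Cone.
Variables (R : realFieldType) (D : nat) (I : finType) (a : I -> 'rV[R]_D).
Implicit Types (x y w : 'rV[R]_D) (l : I -> R).

Definition comb l : 'rV[R]_D := \sum_i l i *: a i.
Definition cone x : Prop := exists2 l, (forall i, 0 <= l i) & x = comb l.
Definition icone x : Prop := exists2 l, (forall i, 0 < l i) & x = comb l.
Definition spans : Prop := forall x, exists l, x = comb l.
(** For [y] in the cone, the absorbed [w] form the cone of feasible directions at [y]. Interiority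
    is proved by absorbing enough directions. *)
Definition absorbs y w : Prop := exists2 e : R, 0 < e & cone (y + e *: w).

Lemma combD l m : comb l + comb m = comb (fun i => l i + m i).
Proof. by rewrite /comb -big_split; apply: eq_bigr => i _; rewrite scalerDl. Qed.

Lemma combZ c l : c *: comb l = comb (fun i => c * l i).
Proof. by rewrite /comb scaler_sumr; apply: eq_bigr => i _; rewrite scalerA. Qed.

Lemma combN l : - comb l = comb (fun i => - l i).
Proof. by rewrite /comb -sumrN; apply: eq_bigr => i _; rewrite scaleNr. Qed.

Lemma comb_delta i : comb (fun j => (j == i)%:R) = a i.
Proof.
rewrite /comb (bigD1 i) //= eqxx scale1r big1 ?addr0 // => j /negPf ->.
by rewrite scale0r.
Qed.

Lemma coneD x y : cone x -> cone y -> cone (x + y).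
Proof.
case=> l l0 -> [m m0 ->]; rewrite combD; exists (fun i => l i + m i) => // i.
exact: addr_ge0.
Qed.

Lemma coneZ c x : 0 <= c -> cone x -> cone (c *: x).
Proof.
move=> c0 [l l0 ->]; rewrite combZ; exists (fun i => c * l i) => // i.
exact: mulr_ge0.
Qed.

Lemma cone_gen i : cone (a i).
Proof. by rewrite -(comb_delta i); exists (fun j => (j == i)%:R) => // j. Qed.

Lemma cone0 : cone 0.
Proof.
exists (fun=> 0) => //; rewrite /comb big1 // => i _.
by rewrite scale0r.
Qed.

Lemma cone_sum (J : Type) (r : seq J) (P : pred J) (F : J -> 'rV[R]_D) :
  (forall j, P j -> cone (F j)) -> cone (\sum_(j <- r | P j) F j).
Proof. by move=> h; apply: (big_ind cone) => //; [exact: cone0 | exact: coneD]. Qed.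

Lemma icone_cone x : icone x -> cone x.
Proof. by case=> l l0 ->; exists l => // i; apply: ltW. Qed.

Lemma iconeD x y : icone x -> cone y -> icone (x + y).
Proof.
case=> l l0 -> [m m0 ->]; rewrite combD; exists (fun i => l i + m i) => // i.
exact: ltr_wpDr.
Qed.

Lemma iconeZ c x : 0 < c -> icone x -> icone (c *: x).
Proof.
move=> c0 [l l0 ->]; rewrite combZ; exists (fun i => c * l i) => // i.
exact: mulr_gt0.
Qed.

Lemma icone_sum_gen : icone (\sum_i a i).
Proof.
exists (fun=> 1) => // ; rewrite /comb; apply: eq_bigr => i _.
by rewrite scale1r.
Qed.

Lemma absorbs_cone y w : cone y -> cone w -> absorbs y w.
Proof. by move=> hy hw; exists 1 => //; rewrite scale1r; apply: coneD. Qed.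

Lemma absorbsD y w w' : absorbs y w -> absorbs y w' -> absorbs y (w + w').
Proof.
case=> e e0 h [e' e'0 h'].
have s0 : 0 < e + e' by apply: addr_gt0.
(* The convex combination of [y + e w] and [y + e' w'] with weights e'/(e + e') and e/(e + e') gives
   both directions the same coefficient. *)
exists (e * e' / (e + e')); first by rewrite divr_gt0 ?mulr_gt0.
have := coneD (coneZ (ltW (divr_gt0 e'0 s0)) h) (coneZ (ltW (divr_gt0 e0 s0)) h').
congr cone; apply/rowP => i; rewrite !mxE; field; lra.
Qed.

Lemma absorbsZ y w c : cone y -> 0 <= c -> absorbs y w -> absorbs y (c *: w).
Proof.
move=> hy; rewrite le_eqVlt => /predU1P[<- _|c0 [e e0 h]].
  by rewrite scale0r; apply: absorbs_cone => //; apply: cone0.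
exists (e / c); first by rewrite divr_gt0.
by rewrite scalerA divfK // gt_eqF.
Qed.

Lemma absorbs_sum y (J : Type) (r : seq J) (P : pred J) (F : J -> 'rV[R]_D) :
  cone y -> (forall j, P j -> absorbs y (F j)) ->
  absorbs y (\sum_(j <- r | P j) F j).
Proof.
move=> hy h; apply: (big_ind (absorbs y)) => //; last exact: absorbsD.
by apply: absorbs_cone => //; apply: cone0.
Qed.

Lemma absorbsDr y z w : cone z -> absorbs y w -> absorbs (y + z) w.
Proof. by move=> hz [e e0 h]; exists e => //; rewrite addrAC; apply: coneD. Qed.

(** Write [y] as e times the sum of all generators, which is interior, plus the cone point supplied
    by absorption. *)
Lemma absorbs_gen_icone y : absorbs y (- \sum_i a i) -> icone y.
Proof.
case=> e e0 h; have := iconeD (iconeZ e0 icone_sum_gen) h.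
by congr icone; rewrite addrCA scalerN subrr addr0.
Qed.

Lemma icone_absorbs y w : spans -> icone y -> absorbs y w.
Proof.
move=> /(_ w)[m ->] [l l0 ->].
have [e e0 he] := exists_pos_small m l0.
exists e => //; rewrite combZ combD; exists (fun i => l i + e * m i) => // i.
have := he i; rewrite -{1}(gtr0_norm e0) -normrM.
have := ler_norm (- (e * m i)); rewrite normrN; lra.
Qed.

End Cone.

(** * Bases and coordinates *)

Section Bases.
Variables (R : realFieldType) (D : nat) (I : finType) (a : I -> 'rV[R]_D).
Implicit Types (x y p : 'rV[R]_D) (l m : I -> R) (S T : {set I}).

Definition subm S : 'M[R]_(#|S|, D) := \matrix_(j < #|S|) a (enum_val j).
Definition basis S := (#|S| == D) && row_full (subm S).
(** Indexed by all of [I] and zero off [S], so that coordinates in different bases are functions of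
    the same type and can be passed to [comb]. *)
Definition coord S x i : R :=
  \sum_j (x *m pinvmx (subm S)) 0 j * (enum_val j == i)%:R.

Lemma comb_subm S l : (forall i, i \notin S -> l i = 0) ->
  comb a l = (\row_j l (enum_val j)) *m subm S.
Proof.
move=> hl; rewrite mulmx_sum_row /comb (bigID (mem S)) /= addrC big1 ?add0r.
  rewrite (big_enum_val (A := mem S) (fun i => l i *: a i)).
  by apply: eq_bigr => j _; rewrite mxE rowK.
by move=> i /hl ->; rewrite scale0r.
Qed.

Lemma coord_notin S x i : i \notin S -> coord S x i = 0.
Proof.
move=> iS; apply: big1 => j _; case: eqP => [ji|_]; last by rewrite mulr0.
by case/negP: iS; rewrite -ji enum_valP.
Qed.

Lemma coord_enum S x j : coord S x (enum_val j) = (x *m pinvmx (subm S)) 0 j.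
Proof.
rewrite /coord (bigD1 j) //= eqxx mulr1 big1 ?addr0 // => k kj.
by rewrite (inj_eq enum_val_inj) (negPf kj) mulr0.
Qed.

Lemma coord_comb_full S x : row_full (subm S) -> comb a (coord S x) = x.
Proof.
move=> fS; rewrite (@comb_subm S) => [|i]; last exact: coord_notin.
suff -> : \row_j coord S x (enum_val j) = x *m pinvmx (subm S).
  by rewrite mulmxKpV // submx_full.
by apply/rowP => j; rewrite mxE coord_enum.
Qed.

Lemma basis_card S : basis S -> #|S| = D.
Proof. by case/andP => /eqP. Qed.

Lemma comb_coord S x : basis S -> comb a (coord S x) = x.
Proof. by case/andP => _; apply: coord_comb_full. Qed.

Lemma coordK S l : basis S -> (forall i, i \notin S -> l i = 0) ->
  forall i, coord S (comb a l) i = l i.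
Proof.
move=> bS hl i; have [iS|iS] := boolP (i \in S); last first.
  by rewrite coord_notin // hl.
have /andP[/eqP cS fS] := bS.
have free : row_free (subm S) by rewrite /row_free (eqP fS) cS.
rewrite -(enum_rankK_in iS iS) coord_enum (comb_subm hl) .
by rewrite mulmxKp // mxE.
Qed.

Lemma coord_eq S l x : basis S -> (forall i, i \notin S -> l i = 0) ->
  x = comb a l -> forall i, coord S x i = l i.
Proof. by move=> bS hl -> i; apply: coordK. Qed.

Lemma coordD S x y i : coord S (x + y) i = coord S x i + coord S y i.
Proof.
by rewrite /coord mulmxDl -big_split; apply: eq_bigr => j _; rewrite mxE mulrDl.
Qed.

Lemma coordZ S c x i : coord S (c *: x) i = c * coord S x i.
Proof.
rewrite /coord -scalemxAl mulr_sumr; apply: eq_bigr => j _.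
by rewrite mxE mulrA.
Qed.

Lemma coordN S x i : coord S (- x) i = - coord S x i.
Proof. by rewrite -scaleN1r coordZ mulN1r. Qed.

Lemma coordB S x y i : coord S (x - y) i = coord S x i - coord S y i.
Proof. by rewrite coordD coordN. Qed.

Lemma coord_sum S (J : Type) (r : seq J) (P : pred J) (F : J -> 'rV[R]_D) i :
  coord S (\sum_(j <- r | P j) F j) i = \sum_(j <- r | P j) coord S (F j) i.
Proof.
elim/big_rec2: _ => [|j y z _ <-]; last by rewrite coordD.
by rewrite -(scale0r 0) coordZ mul0r.
Qed.

Lemma coord_gen S j : basis S -> j \in S ->
  forall i, coord S (a j) i = (i == j)%:R.
Proof.
move=> bS jS; apply: coord_eq => //; last by rewrite comb_delta.
by move=> i; case: eqP => // ->; rewrite jS.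
Qed.

Lemma spansP S : reflect
  (forall x, exists2 l, (forall i, i \notin S -> l i = 0) & x = comb a l)
  (row_full (subm S)).
Proof.
apply: (iffP idP) => [fS x|h].
  exists (coord S x) => [i|]; first exact: coord_notin.
  by rewrite coord_comb_full.
rewrite -sub1mx; apply/row_subP => k.
have [l hl ->] := h (row k 1%:M).
by rewrite (comb_subm hl) submxMl.
Qed.

(** A kernel vector of the generator matrix, negated if necessary; the positive entry starts the
    ratio test of [caratheodory_basis]. *)
Lemma exists_dep S : (D < #|S|)%N ->
  exists m, [/\ forall i, i \notin S -> m i = 0, comb a m = 0
             & exists2 i, i \in S & 0 < m i].
Proof.
move=> DS.
have kn0 : kermx (subm S) != 0.
  rewrite -mxrank_eq0 mxrank_ker subn_eq0 -ltnNge.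
  exact: leq_ltn_trans (rank_leq_col _) DS.
have [k hk] : exists k, row k (kermx (subm S)) != 0.
  apply/existsP; apply: contraNT kn0; rewrite negb_exists => /forallP h.
  by apply/eqP/row_matrixP => k; rewrite row0; apply/eqP; rewrite -[_ == _]negbK.
set c := row k _ in hk.
have c0 : c *m subm S = 0 by rewrite -row_mul mulmx_ker row0.
pose m i := \sum_j c 0 j * (enum_val j == i :> I)%:R.
have me j : m (enum_val j) = c 0 j.
  rewrite /m (bigD1 j) //= eqxx mulr1 big1 ?addr0 // => j' kj.
  by rewrite (inj_eq enum_val_inj) (negPf kj) mulr0.
have mS i : i \notin S -> m i = 0.
  move=> iS; apply: big1 => j _; case: eqP => [ji|_]; last by rewrite mulr0.
  by case/negP: iS; rewrite -ji enum_valP.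
have cm : comb a m = 0.
  rewrite (comb_subm mS) -[RHS]c0; congr (_ *m _).
  by apply/rowP => j; rewrite mxE me.
have [j cj] : exists j, c 0 j != 0.
  apply/existsP; apply: contraNT hk; rewrite negb_exists => /forallP h.
  by apply/eqP/rowP => j; rewrite [RHS]mxE; apply/eqP; rewrite -[_ == _]negbK.
case: (ltgtP (c 0 j) 0) cj => // cj _; last first.
  by exists m; split=> //; exists (enum_val j); rewrite ?me // enum_valP.
exists (fun i => - m i); split.
- by move=> i /mS ->; rewrite oppr0.
- by rewrite -combN cm oppr0.
- by exists (enum_val j); rewrite ?enum_valP // me oppr_gt0.
Qed.

(** Starting from all generators, remove one index at a time along a linear dependency, the ratio
    test keeping the coefficients nonnegative. The remaining set always spans, so the process ends
    at a full basis and not merely at an independent set. *)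
Lemma caratheodory_basis p : spans a -> cone a p ->
  exists2 S, basis S & forall i, 0 <= coord S p i.
Proof.
move=> sp [l l0 pl].
have fT : row_full (subm [set: I]).
  apply/spansP => x; have [m ->] := sp x; exists m => // i.
  by rewrite inE.
have lT i : i \notin [set: I] -> l i = 0 by rewrite inE.
have [N hN] := ubnP #|[set: I]|.
elim: N [set: I] hN l l0 pl fT lT => // N IH S SN l l0 pl fS lS.
have DS : (D <= #|S|)%N.
  by rewrite -[X in (X <= _)%N](eqP fS); apply: rank_leq_row.
move: DS; rewrite leq_eqVlt => /orP[DS|DS].
  have bS : basis S by rewrite /basis eq_sym DS.
  by exists S => // i; rewrite (coord_eq bS lS pl).
have [m [mS m0 [i1 i1S mi1]]] := exists_dep DS.
have [i0 /andP[i0S mi0] imin] :=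
  arg_minP (fun i => l i / m i) (P := fun i => (i \in S) && (0 < m i)) (i0 := i1)
    ltac:(by apply/andP).
(* Subtracting this multiple of the dependency kills the entry at [i0] without changing the
   combination. It is applied to [l], and to arbitrary coefficients to see that [S :\ i0] still
   spans. *)
pose sub k i : R := k i - k i0 / m i0 * m i.
have subE k : comb a (sub k) = comb a k.
  have -> : comb a (sub k) = comb a k - (k i0 / m i0) *: comb a m.
    by rewrite combZ combN combD.
  by rewrite m0 scaler0 subr0.
have subS k i : (forall i, i \notin S -> k i = 0) -> i \notin S :\ i0 -> sub k i = 0.
  move=> kS; rewrite !inE negb_and negbK => /predU1P[->|iS].
    by rewrite /sub divfK ?subrr // gt_eqF.
  by rewrite /sub (kS i) // (mS i) // mulr0 subr0.
apply: (IH (S :\ i0) _ (sub l)).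
- by rewrite (cardsD1 i0) i0S in SN.
- move=> i; rewrite /sub subr_ge0.
  case: (ltrP 0 (m i)) => mi; last first.
    by apply: le_trans (l0 i); rewrite mulr_ge0_le0 // divr_ge0 // ltW.
  rewrite -ler_pdivlMr //; apply: imin; rewrite mi andbT.
  by apply: contraLR mi => /mS ->; rewrite ltxx.
- by rewrite subE.
- apply/spansP => x; have /spansP/(_ x)[k kS ->] := fS.
  exists (sub k); last by rewrite subE.
  by move=> i; apply: subS.
- by move=> i; apply: subS.
Qed.

Lemma basis_swap S i v : basis S -> i \in S -> coord S (a v) i != 0 ->
  v \notin S -> basis (v |: (S :\ i)).
Proof.
move=> bS iS ci vS; apply/andP; split.
  rewrite cardsU1 !inE (negPf vS) andbF /= add1n.
  by rewrite -(basis_card bS) (cardsD1 i S) iS.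
apply/spansP => x.
set d := coord S (a v) in ci *.
exists (fun k => coord S x k - coord S x i / d i * d k
                 + coord S x i / d i * (k == v)%:R).
  move=> k; rewrite !inE negb_or negb_and negbK => /andP[kv].
  rewrite (negPf kv) mulr0 addr0 => /predU1P[->|kS].
    by rewrite divfK // subrr.
  by rewrite /d !(coord_notin _ kS) mulr0 subr0.
set c := _ / _.
have -> : comb a (fun k => coord S x k - c * d k + c * (k == v)%:R) =
  comb a (coord S x) - c *: comb a d + c *: comb a (fun k => (k == v)%:R).
  by rewrite !combZ combN !combD.
by rewrite /d !comb_coord // comb_delta subrK.
Qed.

End Bases.

(** * Generic triangulations *)

Lemma exists_pos_nonroot (R : realFieldType) (p : {poly R}) :
  p != 0 -> exists2 t, 0 < t & p.[t] != 0.
Proof.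
move=> p0; pose rs := [seq i.+1%:R : R | i <- iota 0 (size p)].
have urs : uniq rs.
  by rewrite map_inj_uniq ?iota_uniq // => i j /eqP; rewrite eqr_nat => /eqP[].
have : ~~ all (root p) rs.
  by apply/negP => /(max_poly_roots p0)/(_ urs); rewrite size_map size_iota ltnn.
by case/allPn => _ /mapP[i _ ->] h; exists i.+1%:R; rewrite ?ltr0n.
Qed.

(** Take powers of one parameter t as weights: each condition becomes a nonzero polynomial in t, and
    the product of these polynomials has a positive non-root. *)
Lemma generic_weights (R : realFieldType) (I F : finType) (Q : pred F)
    (c : F -> I -> R) :
  (forall f, Q f -> exists k, c f k != 0) ->
  exists2 w : I -> R, (forall i, 0 < w i)
    & forall f, Q f -> \sum_k c f k * w k != 0.
Proof.
move=> hc.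
pose P f : {poly R} := \sum_k c f k *: 'X^(enum_rank k).
have coefP f k : (P f)`_(enum_rank k) = c f k.
  rewrite coef_sum (bigD1 k) //= coefZ coefXn eqxx mulr1 big1 ?addr0 // => j jk.
  rewrite coefZ coefXn (inj_eq val_inj) (inj_eq enum_rank_inj) eq_sym.
  by rewrite (negPf jk) mulr0.
have [|t t0] := @exists_pos_nonroot _ (\prod_(f | Q f) P f).
  apply/prodf_neq0 => f /hc[k]; apply: contraNneq => Pf.
  by rewrite -coefP Pf coef0.
rewrite horner_prod => /prodf_neq0 ht.
exists (fun k => t ^+ enum_rank k) => [i|f /ht]; first exact: exprn_gt0.
rewrite horner_sum; congr (_ != 0); apply: eq_bigr => k _.
by rewrite hornerZ hornerXn.
Qed.

Lemma fin_small (R : realFieldType) (F : finType) (P : F -> R -> Prop) :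
  (forall f, exists2 e0, 0 < e0 & forall e, 0 < e <= e0 -> P f e) ->
  exists2 e0, 0 < e0 & forall e, 0 < e <= e0 -> forall f, P f e.
Proof.
move=> h; suff [e0 p0 he] : exists2 e0, 0 < e0 &
    forall e, 0 < e <= e0 -> forall f, f \in enum F -> P f e.
  by exists e0 => // e ee f; apply: he; rewrite ?mem_enum.
elim: (enum F) => [|f s [e1 e10 IH]]; first by exists 1.
have [e2 e20 hf] := h f.
exists (Num.min e1 e2); first by rewrite lt_min e10.
move=> e /andP[e0]; rewrite le_min => /andP[ee1 ee2] g.
rewrite inE => /predU1P[->|gs]; first by apply: hf; rewrite e0.
by apply: IH; rewrite ?e0.
Qed.

Lemma small_sign (R : realFieldType) (c b : R) : exists2 e0 : R, 0 < e0 &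
  forall e, 0 < e <= e0 -> (b != 0 -> c + e * b != 0) /\
   (b != 0 -> (0 < c + e * b) = (0 < c) || (c == 0) && (0 < b)).
Proof.
have B0 : 0 < 2 * (`|b| + 1) by have := normr_ge0 b; lra.
case: (ltgtP 0 c) => c0.
- exists (c / (2 * (`|b| + 1))); first by rewrite divr_gt0.
  move=> e /andP[e0]; rewrite ler_pdivlMr // => he.
  have hb : `|e * b| < c.
    rewrite normrM (gtr0_norm e0).
    have : 0 <= e * `|b| by rewrite mulr_ge0 // ltW.
    nra.
  have := ler_norm (- (e * b)); rewrite normrN => hb'.
  have {hb hb'} h : 0 < c + e * b by lra.
  by rewrite (gt_eqF h) h.
- exists (- c / (2 * (`|b| + 1))); first by rewrite divr_gt0 ?oppr_gt0.
  move=> e /andP[e0]; rewrite ler_pdivlMr // => he.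
  have hb : `|e * b| < - c.
    rewrite normrM (gtr0_norm e0).
    have : 0 <= e * `|b| by rewrite mulr_ge0 // ltW.
    nra.
  have := ler_norm (e * b) => hb'.
  have {hb hb'} h : c + e * b < 0 by lra.
  by rewrite (lt_eqF h) ?(lt_eqF c0) (ltNge 0 (_ + _)) (ltW h).
- exists 1 => // e /andP[e0 _]; rewrite -c0 add0r ?eqxx ?ltxx /=.
  by split => b0; [rewrite mulf_neq0 // gt_eqF|rewrite pmulr_rgt0].
Qed.

Definition ht (R : realFieldType) n (x : 'rV[R]_n.+1) : R := x ord0 ord0.

Section Height.
Variables (R : realFieldType) (n : nat).
Implicit Types x y : 'rV[R]_n.+1.

Lemma htD x y : ht (x + y) = ht x + ht y. Proof. by rewrite /ht mxE. Qed.
Lemma htZ c x : ht (c *: x) = c * ht x. Proof. by rewrite /ht mxE. Qed.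
Lemma htN x : ht (- x) = - ht x. Proof. by rewrite /ht mxE. Qed.
Lemma htB x y : ht (x - y) = ht x - ht y. Proof. by rewrite htD htN. Qed.
Lemma ht_sum (J : Type) (r : seq J) (P : pred J) (F : J -> 'rV[R]_n.+1) :
  ht (\sum_(j <- r | P j) F j) = \sum_(j <- r | P j) ht (F j).
Proof. by rewrite /ht summxE. Qed.
End Height.

Section Triangulation.
Variables (R : realFieldType) (n : nat) (I : finType) (a : I -> 'rV[R]_n.+1).
Hypothesis (ht_gen : forall i, ht (a i) = 1) (sp : spans a).
Local Notation D := n.+1.
Local Notation vec := 'rV[R]_D.
Implicit Types (x y z p : vec) (S T : {set I}).

Lemma ht_comb l : ht (comb a l) = \sum_i l i.
Proof. by rewrite ht_sum; apply: eq_bigr => i _; rewrite htZ ht_gen mulr1. Qed.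

Lemma ht_coord S x : basis a S -> ht x = \sum_(i in S) coord a S x i.
Proof.
move=> bS; rewrite -{1}(comb_coord x bS) ht_comb (bigID (mem S)) /=.
by rewrite [X in _ + X]big1 ?addr0 // => i /coord_notin.
Qed.

Lemma coord_comb S l i : coord a S (comb a l) i = \sum_k l k * coord a S (a k) i.
Proof. by rewrite coord_sum; apply: eq_bigr => k _; rewrite coordZ. Qed.

Lemma exists_generic_q : exists2 q, icone a q &
  forall S i, basis a S -> i \in S -> coord a S q i != 0.
Proof.
have [|w w0 hw] := @generic_weights R I ({set I} * I)%type
  (fun f => basis a f.1 && (f.2 \in f.1)) (fun f k => coord a f.1 (a k) f.2).
  case=> S i /= /andP[bS iS]; exists i.
  by rewrite coord_gen // eqxx oner_eq0.
exists (comb a w); first by exists w.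
move=> S i bS iS; have := hw (S, i); rewrite /= bS iS => /(_ isT).
congr (_ != 0); rewrite coord_comb; apply: eq_bigr => k _.
by rewrite mulrC.
Qed.

(** The reduced cost of the simplex method, for representing a point as a nonnegative combination of
    generators at minimal total weight [w]. *)
Definition redcost (w : I -> R) S v := w v - \sum_i coord a S (a v) i * w i.

Lemma exists_generic_w : exists w,
  forall S v, basis a S -> v \notin S -> redcost w S v != 0.
Proof.
have [|w w0 hw] := @generic_weights R I ({set I} * I)%type
  (fun f => basis a f.1 && (f.2 \notin f.1))
  (fun f k => (k == f.2)%:R - coord a f.1 (a f.2) k).
  case=> S i /= /andP[bS iS]; exists i.
  by rewrite coord_notin // eqxx subr0 oner_eq0.
exists w => S v bS vS; have := hw (S, v); rewrite /= bS vS => /(_ isT).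
congr (_ != 0); rewrite /redcost.
under eq_bigr do rewrite mulrBl.
rewrite sumrB (bigD1 v) //= eqxx mul1r big1 ?addr0 // => i /negPf ->.
by rewrite mul0r.
Qed.

Variables (w : I -> R) (q : vec).
Hypothesis hw : forall S v, basis a S -> v \notin S -> redcost w S v != 0.
Hypothesis hq : forall S i, basis a S -> i \in S -> coord a S q i != 0.
Hypothesis qi : icone a q.

(** The regular triangulation given by lifting heights [w]: a basis is a cell when every other
    generator is lifted strictly above the hyperplane through its own lifted generators. *)
Definition triang : {set {set I}} :=
  [set S | basis a S && [forall v, (v \notin S) ==> (0 < redcost w S v)]].

Lemma triang_basis S : S \in triang -> basis a S.
Proof. by rewrite inE => /andP[]. Qed.

Lemma triang_red S v : S \in triang -> v \notin S -> 0 < redcost w S v.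
Proof. by rewrite inE => /andP[_ /forallP/(_ v)/implyP]. Qed.

Definition generic p := forall S i, basis a S -> i \in S -> coord a S p i != 0.
Definition cost S p := \sum_i coord a S p i * w i.

Lemma cost_comb S l : cost S (comb a l) = \sum_k l k * cost S (a k).
Proof.
rewrite /cost; under eq_bigr do rewrite coord_comb mulr_suml.
rewrite exchange_big; apply: eq_bigr => k _; rewrite mulr_sumr.
by apply: eq_bigr => i _; rewrite mulrA.
Qed.

Lemma cost_gen S i : basis a S -> i \in S -> cost S (a i) = w i.
Proof.
move=> bS iS; rewrite /cost (bigD1 i) //= coord_gen // eqxx mul1r big1 ?addr0 //.
by move=> j ji; rewrite coord_gen // (negPf ji) mul0r.
Qed.

(* Weak LP duality; it is strict as soon as p uses a vertex outside S. *)
Lemma cost_lt S T p : S \in triang -> basis a T ->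
  (forall i, i \in T -> 0 < coord a T p i) -> ~~ (T \subset S) ->
  cost S p < cost T p.
Proof.
move=> tS bT pT /subsetPn[v vT vS]; have bS := triang_basis tS.
have coord_ge0 i : 0 <= coord a T p i.
  by have [/pT/ltW//|/coord_notin ->] := boolP (i \in T).
rewrite -{1}(comb_coord p bT) cost_comb {2}/cost -subr_gt0 -sumrB.
rewrite (bigD1 v) //= ltr_wpDr //.
  apply: sumr_ge0 => i _; rewrite -mulrBr mulr_ge0 //.
  have [iS|iS] := boolP (i \in S); first by rewrite cost_gen // subrr.
  by rewrite ltW // triang_red.
by rewrite -mulrBr mulr_gt0 ?pT // triang_red.
Qed.

(** Two distinct bases have equal size, so neither contains the other, and [cost_lt] used both ways
    gives contradictory strict inequalities. *)
Lemma triang_uniq S T p : S \in triang -> T \in triang ->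
  (forall i, i \in S -> 0 < coord a S p i) ->
  (forall i, i \in T -> 0 < coord a T p i) -> S = T.
Proof.
move=> tS tT pS pT; have bS := triang_basis tS; have bT := triang_basis tT.
apply/eqP; rewrite eqEcard (basis_card bS) (basis_card bT) leqnn andbT.
apply/negPn/negP => ST.
have TS : ~~ (T \subset S).
  apply: contra ST => TS; suff -> : S = T by [].
  by apply/esym/eqP; rewrite eqEcard TS (basis_card bS) (basis_card bT) /=.
have := cost_lt tS bT pT TS; have := cost_lt tT bS pS ST; lra.
Qed.

(** Choose a feasible basis of minimal cost. Genericity makes its coordinates strictly positive, so
    a pivot at a negative reduced cost would have positive step length and strictly lower the
    cost. *)
Lemma triang_exists p : generic p -> cone a p ->
  exists2 S, S \in triang & forall i, i \in S -> 0 < coord a S p i.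
Proof.
move=> gp cp; have [S0 bS0 pS0] := caratheodory_basis sp cp.
pose feas S := basis a S && [forall i, 0 <= coord a S p i].
have fS0 : feas S0 by rewrite /feas bS0; apply/forallP.
have [S /andP[bS /forallP pS] Smin] := arg_minP (fun S => cost S p) fS0.
have ppos i : i \in S -> 0 < coord a S p i.
  by move=> iS; rewrite lt_def pS gp.
exists S => //; rewrite inE bS /=; apply/forallP => v; apply/implyP => vS.
rewrite lt_def hw //= leNgt; apply/negP => red.
(* v enters the basis: the ratio test picks the vertex i that leaves. *)
set d := coord a S (a v).
have [i1 i1S di1] : exists2 i1, i1 \in S & 0 < d i1.
  have := ht_gen v; rewrite (ht_coord _ bS) => h1.
  apply/exists_inP; apply: contraT; rewrite negb_exists_in => /forall_inP hd.
  have : \sum_(i in S) d i <= 0.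
    by apply: sumr_le0 => i /hd; rewrite -leNgt.
  by rewrite h1 ler10.
have [i /andP[iS di] imin] :=
  arg_minP (fun i => coord a S p i / d i)
    (P := fun i => (i \in S) && (0 < d i)) (i0 := i1) ltac:(by apply/andP).
set th := coord a S p i / d i in imin.
have th0 : 0 < th by rewrite divr_gt0 ?ppos.
pose S' := v |: (S :\ i).
have bS' : basis a S' by apply: basis_swap => //; rewrite gt_eqF.
pose l k := coord a S p k - th * d k + th * (k == v)%:R.
have pl : p = comb a l.
  have -> : comb a l = comb a (coord a S p) - th *: comb a d
              + th *: comb a (fun k => (k == v)%:R).
    by rewrite !combZ combN !combD.
  by rewrite /d !comb_coord // comb_delta subrK.
have lS' k : k \notin S' -> l k = 0.
  rewrite !inE negb_or negb_and negbK => /andP[kv].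
  rewrite /l (negPf kv) mulr0 addr0 => /predU1P[->|kS].
    by rewrite divfK ?subrr // gt_eqF.
  by rewrite /d !(coord_notin _ _ kS) mulr0 subr0.
have cS' : coord a S' p =1 l := coord_eq bS' lS' pl.
have : feas S'.
  rewrite /feas bS'; apply/forallP => k; rewrite cS' /l.
  apply: addr_ge0; last by rewrite mulr_ge0 ?ler0n // ltW.
  rewrite subr_ge0; case: (ltrP 0 (d k)) => dk.
    rewrite -ler_pdivlMr //; apply: imin; rewrite dk andbT.
    by apply: contraLR dk => /coord_notin h; rewrite /d h ltxx.
  by apply: le_trans (pS k); rewrite mulr_ge0_le0 // ltW.
move=> /Smin; apply/negP; rewrite -ltNge.
have -> : cost S' p = cost S p + th * redcost w S v.
  have -> : cost S' p = cost S p - th * (\sum_k d k * w k)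
              + th * (\sum_k (k == v)%:R * w k).
    rewrite /cost !mulr_sumr -sumrB -big_split; apply: eq_bigr => k _.
    by rewrite cS' /l /=; ring.
  have -> : \sum_k (k == v)%:R * w k = w v.
    rewrite (bigD1 v) //= eqxx mul1r big1 ?addr0 // => k /negPf ->.
    by rewrite mul0r.
  by rewrite /redcost -/d; ring.
by rewrite gtrDl pmulr_rlt0.
Qed.

(* lexpos s S z: the points z + e s q lie in the cone of S for all small e > 0. *)
Definition lexpos (s : R) S z := [forall (i | i \in S),
  (0 < coord a S z i) ||
  (coord a S z i == 0) && (0 < s * coord a S q i)].

(** One threshold [e0] serves all the finitely many pairs (basis, index). It reduces questions on
    [lexpos] to a generic point, where [triang_uniq] and [triang_exists] apply. *)
Lemma lexpos_small s z : s != 0 -> exists2 e0 : R, 0 < e0 &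
  forall e, 0 < e <= e0 -> generic (z + e *: (s *: q)) /\
    (forall S, basis a S -> lexpos s S z <->
       forall i, i \in S -> 0 < coord a S (z + e *: (s *: q)) i).
Proof.
move=> s0.
pose P (f : {set I} * I) e := basis a f.1 -> f.2 \in f.1 ->
  coord a f.1 (z + e *: (s *: q)) f.2 != 0 /\
  (0 < coord a f.1 (z + e *: (s *: q)) f.2) = (0 < coord a f.1 z f.2) ||
  (coord a f.1 z f.2 == 0) && (0 < s * coord a f.1 q f.2).
have [|e0 e00 he] := @fin_small R _ P.
  case=> S i; rewrite /P /=.
  have [e0 e00 he] := small_sign (coord a S z i) (s * coord a S q i).
  exists e0 => // e /he[h1 h2] bS iS; rewrite coordD !coordZ.
  by split; [apply: h1|apply: h2]; rewrite mulf_neq0 ?hq.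
exists e0 => // e /he h; split=> [S i bS iS|S bS].
  by have [] := h (S, i) bS iS.
split=> [/forall_inP lS i iS|lS].
  by have [_ /= ->] := h (S, i) bS iS; apply: lS.
by apply/forall_inP => i iS; have [_ /= <-] := h (S, i) bS iS; apply: lS.
Qed.

Lemma lexpos_uniq s S T z : s != 0 -> S \in triang -> T \in triang ->
  lexpos s S z -> lexpos s T z -> S = T.
Proof.
move=> s0 tS tT lS lT; have [e e0 /(_ e)[]] := lexpos_small z s0.
  by rewrite e0 lexx.
move=> g h; apply: (@triang_uniq _ _ (z + e *: (s *: q))) => //.
  by apply/h => //; apply: triang_basis.
by apply/h => //; apply: triang_basis.
Qed.

(** The absorption hypothesis keeps the perturbed point in the cone. It holds for s = 1 at every
    cone point and for s = -1 at every interior point, giving two half-open decompositions. *)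
Lemma lexpos_exists s z : s != 0 -> absorbs a z (s *: q) -> cone a z ->
  exists2 S, S \in triang & lexpos s S z.
Proof.
move=> s0 [e1 e10 h1] cz; have [e e0 he] := lexpos_small z s0.
have [|g h] := he (Num.min e e1); first by rewrite lt_min e0 e10 ge_min lexx.
set m := Num.min e e1 in g h.
have [m0 me1] : 0 < m /\ m <= e1 by rewrite lt_min e0 e10 ge_min lexx orbT.
have [] := triang_exists g.
  have mm : 0 <= m / e1 by rewrite divr_ge0 ?ltW.
  have mm1 : 0 <= 1 - m / e1 by rewrite subr_ge0 ler_pdivrMr // mul1r.
  have := coneD (coneZ mm h1) (coneZ mm1 cz); congr cone.
  by apply/rowP => i; rewrite !mxE; field; lra.
by move=> S tS pS; exists S => //; apply/h => //; apply: triang_basis.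
Qed.

Lemma lexpos_cone z : cone a z -> exists2 S, S \in triang & lexpos 1 S z.
Proof.
move=> cz; apply: (lexpos_exists (oner_neq0 _) _ cz).
by rewrite scale1r; apply: absorbs_cone => //; apply: icone_cone.
Qed.

Lemma lexpos_icone z : icone a z -> exists2 S, S \in triang & lexpos (-1) S z.
Proof.
move=> iz; apply: lexpos_exists; first by rewrite oppr_eq0 oner_neq0.
  exact: icone_absorbs.
exact: icone_cone.
Qed.

Lemma coord_ge0_cone S z : basis a S -> (forall i, i \in S -> 0 <= coord a S z i) ->
  cone a z.
Proof.
move=> bS h; rewrite -(comb_coord z bS); exists (coord a S z) => // i.
by have [/h|/coord_notin ->] := boolP (i \in S).
Qed.

Lemma lexpos_ge0 s S z i : lexpos s S z -> 0 <= coord a S z i.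
Proof.
have [iS /forall_inP/(_ _ iS)|/coord_notin -> //] := boolP (i \in S).
by case/orP => [/ltW //|/andP[/eqP ->]].
Qed.

Lemma cone_lexpos s S z : basis a S -> lexpos s S z -> cone a z.
Proof. by move=> bS lS; apply: (coord_ge0_cone bS) => i _; apply: lexpos_ge0 lS. Qed.

Lemma icone_lexpos S z : basis a S -> lexpos (-1) S z -> icone a z.
Proof.
move=> bS lS; have [|e e0 /(_ e)[]] := @lexpos_small (-1) z.
- by rewrite oppr_eq0 oner_neq0.
- by rewrite e0 lexx.
move=> _ /(_ S bS)[/(_ lS) h _].
have : cone a (z + e *: (-1 *: q)) by apply: (coord_ge0_cone bS) => i /h/ltW.
move/(iconeD (iconeZ e0 qi)); congr icone.
by rewrite scaleN1r scalerN addrC subrK.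
Qed.

End Triangulation.

(** * Counting finite sets *)

(** The count used by [ehrhart]. Since [fset_set] maps an infinite set to the empty one, finiteness
    has to be carried along in what follows. *)
Definition cnt (T : choiceType) (X : set T) : nat := #|` fset_set X|.

Section Counting.
Local Open Scope classical_set_scope.
Variables T U : choiceType.
Implicit Types (X Y : set T).

Lemma cnt0 : cnt (set0 : set T) = 0%N.
Proof. by rewrite /cnt fset_set0 cardfs0. Qed.

Lemma cnt_sub X Y : finite_set Y -> X `<=` Y -> (cnt X <= cnt Y)%N.
Proof.
move=> fY XY; apply: fsubset_leq_card; rewrite -fset_set_sub //.
exact: sub_finite_set XY fY.
Qed.

Lemma cntU X Y : finite_set X -> finite_set Y -> X `&` Y `<=` set0 ->
  cnt (X `|` Y) = (cnt X + cnt Y)%N.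
Proof.
move=> fX fY XY; rewrite /cnt fset_setU // cardfsU -fset_setI //.
have -> : X `&` Y = set0 by apply/seteqP; split.
by rewrite fset_set0 cardfs0 subn0.
Qed.

Lemma cnt_gt0 X x : finite_set X -> X x -> (0 < cnt X)%N.
Proof.
move=> fX Xx; rewrite cardfs_gt0; apply/fset0Pn; exists x.
by rewrite in_fset_set // mem_set.
Qed.

Lemma cnt_eq0 X x : finite_set X -> cnt X = 0%N -> ~ X x.
Proof. by move=> fX X0 /(cnt_gt0 fX); rewrite X0. Qed.

Lemma cnt_neq0 X : (cnt X != 0)%N -> exists x, X x.
Proof.
move=> h; apply: contrapT => /forallNP hX.
by move/eqP: h; rewrite (_ : X = set0) ?cnt0 //; apply/seteqP; split=> x // /hX.
Qed.

Lemma cnt_image (f : T -> U) X : finite_set X ->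
  (forall x y, X x -> X y -> f x = f y -> x = y) -> cnt (f @` X) = cnt X.
Proof.
move=> fX fi; rewrite /cnt fset_set_image // card_in_imfset //= => x y.
by rewrite !in_fset_set // => /set_mem Xx /set_mem Xy; apply: fi.
Qed.

Lemma cnt_inj (f : T -> U) X (Y : set U) : finite_set X -> finite_set Y ->
  (forall x, X x -> Y (f x)) ->
  (forall x y, X x -> X y -> f x = f y -> x = y) -> (cnt X <= cnt Y)%N.
Proof.
move=> fX fY fXY fi; rewrite -(cnt_image fX fi); apply: fsubset_leq_card.
rewrite -fset_set_sub //; last exact: finite_image.
by move=> _ [x Xx <-]; apply: fXY.
Qed.

Lemma cnt_big_seq (F : eqType) (s : seq F) (X : F -> set T) : uniq s ->
  (forall f, finite_set (X f)) ->
  (forall f g x, f \in s -> g \in s -> X f x -> X g x -> f = g) ->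
  cnt [set x | exists2 f, f \in s & X f x] = (\sum_(f <- s) cnt (X f))%N.
Proof.
move=> us fX; elim: s us => [_ _|f s IH /andP[fs us] h].
  rewrite big_nil (_ : [set x | _] = set0) ?cnt0 //.
  by apply/seteqP; split=> // x [].
rewrite big_cons -IH //; last first.
  by move=> g1 g2 x g1s g2s; apply: h; rewrite inE ?g1s ?g2s orbT.
rewrite -cntU //.
- congr cnt; apply/seteqP; split=> x /=.
    case=> g; rewrite inE => /predU1P[->|gs] Xg; first by left.
    by right; exists g.
  case=> [Xf|[g gs Xg]]; first by exists f => //; rewrite mem_head.
  by exists g => //; rewrite inE gs orbT.
- rewrite (_ : [set x | _] = \bigcup_(g in [set` s]) X g); last first.
    by apply/seteqP; split=> x [g]; exists g.
  by apply: bigcup_finite => //; apply: finite_seq.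
- move=> x [Xf [g gs Xg]]; move/negP: fs; apply.
  by rewrite (h f g x) ?mem_head // inE gs orbT.
Qed.

Lemma cnt_big (F : finType) (Q : pred F) (X : F -> set T) :
  (forall f, finite_set (X f)) ->
  (forall f g x, Q f -> Q g -> X f x -> X g x -> f = g) ->
  cnt [set x | exists2 f, Q f & X f x] = (\sum_(f | Q f) cnt (X f))%N.
Proof.
move=> fX h; have memQ f : (f \in [seq f <- index_enum F | Q f]) = Q f.
  by rewrite mem_filter mem_index_enum andbT.
rewrite -big_filter -cnt_big_seq ?filter_uniq ?index_enum_uniq //.
  by congr cnt; apply/seteqP; split=> x [f fQ Xf]; exists f; rewrite ?memQ // -memQ.
by move=> f g x; rewrite !memQ; apply: h.
Qed.

Lemma cnt_big_le (F : finType) (Q : pred F) (X : F -> set T) (Y : set T) :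
  (forall f, Q f -> finite_set (X f)) ->
  (forall y, Y y -> exists2 f, Q f & X f y) ->
  (cnt Y <= \sum_(f | Q f) cnt (X f))%N.
Proof.
move=> fX h.
have memQ f : (f \in [seq f <- index_enum F | Q f]) = Q f.
  by rewrite mem_filter mem_index_enum andbT.
rewrite -big_filter; move: [seq f <- _ | _] memQ => s memQ.
have {h} : forall y, Y y -> exists2 f, f \in s & X f y.
  by move=> y /h[f Qf Xf]; exists f; rewrite ?memQ.
have {fX} : forall f, f \in s -> finite_set (X f) by move=> f; rewrite memQ => /fX.
elim: s {memQ} Y => [|f s IH] Y fX h.
  rewrite big_nil (_ : Y = set0) ?cnt0 //.
  by apply/seteqP; split=> // y /h[].
rewrite big_cons.
have fs : finite_set Y.
  apply: (@sub_finite_set _ _ (\bigcup_(g in [set` f :: s]) X g)).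
    by move=> y /h[g gs Xg]; exists g.
  by apply: bigcup_finite => //; apply: finite_seq.
have fXf : finite_set (X f) by apply: fX; rewrite mem_head.
have -> : cnt Y = (cnt (Y `&` X f) + cnt (Y `\` X f))%N.
  rewrite -cntU ?setUIDK //.
  - exact: finite_setIl.
  - exact: finite_setD.
  - by move=> y [[_ Xy] [_]].
rewrite leq_add //; first by apply: cnt_sub => // y [].
apply: IH => [g gs|y [/h[g]]]; first by apply: fX; rewrite inE gs orbT.
by rewrite inE => /predU1P[-> //|gs Xg _]; exists g.
Qed.

Lemma cnt_fibre (F : finType) (key : T -> F) X k : finite_set X ->
  (forall x, X x -> (cnt [set y | X y /\ key y = key x] <= k)%N) ->
  (cnt X <= #|F| * k)%N.
Proof.
move=> fX h; have fXf f : finite_set [set y | X y /\ key y = f].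
  by apply: sub_finite_set fX => y [].
apply: (leq_trans (@cnt_big_le F predT (fun f => [set y | X y /\ key y = f]) X _ _)).
- by [].
- by move=> y Xy; exists (key y).
rewrite -sum_nat_const leq_sum // => f _.
have [->|/cnt_neq0[x [Xx xf]]] := eqVneq (cnt [set y | X y /\ key y = f]) 0%N => //.
by rewrite -xf h.
Qed.

End Counting.

(** * Lattice points in the cone and finite differences *)

Section Lattice.
Local Open Scope classical_set_scope.
Variables (R : realType) (n : nat).
Implicit Types x y : 'rV[R]_n.

Lemma latD x y : lattice_point x -> lattice_point y -> lattice_point (x + y).
Proof. by move=> hx hy i; rewrite mxE rpredD. Qed.

Lemma latN x : lattice_point x -> lattice_point (- x).
Proof. by move=> hx i; rewrite mxE rpredN. Qed.

Lemma latB x y : lattice_point x -> lattice_point y -> lattice_point (x - y).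
Proof. by move=> hx hy; apply: latD => //; apply: latN. Qed.

Lemma latZ c x : c \is a Num.int -> lattice_point x -> lattice_point (c *: x).
Proof. by move=> hc hx i; rewrite mxE rpredM. Qed.

Lemma lat_sum (J : Type) (r : seq J) (P : pred J) (F : J -> 'rV[R]_n) :
  (forall j, P j -> lattice_point (F j)) ->
  lattice_point (\sum_(j <- r | P j) F j).
Proof.
move=> h; apply: (big_ind (@lattice_point R n)) => //; last exact: latD.
by move=> i; rewrite mxE.
Qed.

Lemma finite_lattice_bounded (M : R) :
  finite_set [set x : 'rV[R]_n | lattice_point x /\ forall i, `|x ord0 i| <= M].
Proof.
pose N := Num.bound M.
pose f (g : {ffun 'I_n -> 'I_(N + N).+1}) : 'rV[R]_n :=
  \row_i ((g i : nat)%:R - N%:R).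
apply: (@sub_finite_set _ _ (f @` setT)); last first.
  exact: finite_image finite_finset.
move=> x [lx Mx].
have hx i : exists m : 'I_(N + N).+1, x ord0 i = m%:R - N%:R.
  have [m xm] := intrP (lx i).
  have mN : `|x ord0 i| < N%:R.
    apply: le_lt_trans (Mx i) _; apply: archi_boundP.
    by apply: le_trans (Mx i).
  have {mN} : `|m| < N%:Z by rewrite -(ltr_int R) intr_norm -xm.
  rewrite ltr_norml => /andP[m1 m2].
  have mm : (absz (m + N%:Z)%R < (N + N).+1)%N by lia.
  exists (Ordinal mm) => /=; rewrite xm.
  rewrite -[(absz _)%:R]/((Posz (absz (m + N%:Z)%R))%:~R : R) gez0_abs; last by lia.
  by rewrite rmorphD /= addrK.
have [g hg] := choice hx.
by exists [ffun i => g i] => //; apply/rowP => i; rewrite mxE ffunE -hg.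
Qed.

End Lattice.

Section Dlt.
Local Open Scope classical_set_scope.
Implicit Type F : int -> int.

(** The k-th backward difference, that is, the coefficients of the series of [F] times (1 - t)^k
    when [F] vanishes at negative arguments. Integer arguments spare the recurrence [dltS] a
    boundary case. *)
Definition dlt k F (m : int) : int :=
  \sum_(j < k.+1) (-1) ^+ j * 'C(k, j)%:Z * F (m - j%:Z).

Lemma dlt0 F m : dlt 0 F m = F m.
Proof. by rewrite /dlt big_ord1 expr0 bin0 !mul1r subr0. Qed.

Lemma dltS k F m : dlt k.+1 F m = dlt k F m - dlt k F (m - 1).
Proof.
rewrite /dlt big_ord_recl /= !expr0 !bin0 !mul1r.
rewrite [\sum_(j < k.+1) _ in RHS]big_ord_recl /= expr0 bin0 !mul1r -addrA.
congr (_ + _).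
have -> : \sum_(i < k) (-1) ^+ bump 0 i * 'C(k, bump 0 i)%:Z * F (m - (bump 0 i)%:Z) =
   \sum_(i < k.+1) (-1) ^+ i.+1 * 'C(k, i.+1)%:Z * F (m - i.+1%:Z).
  by rewrite [RHS]big_ord_recr /= bin_small // mulr0 mul0r addr0.
rewrite -sumrB; apply: eq_bigr => i _; rewrite /bump /= add1n binS PoszD.
rewrite (_ : m - 1 - i%:Z = m - i.+1%:Z); last by lia.
rewrite exprS; ring.
Qed.

Lemma dlt_sum (J : finType) (P : pred J) k (F : J -> int -> int) m :
  dlt k (fun m => \sum_(j | P j) F j m) m = \sum_(j | P j) dlt k (F j) m.
Proof.
rewrite /dlt exchange_big; apply: eq_bigr => i _ /=.
by rewrite mulr_sumr.
Qed.

Lemma eq_dlt k F G m : F =1 G -> dlt k F m = dlt k G m.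
Proof. by move=> FG; apply: eq_bigr => i _; rewrite FG. Qed.

End Dlt.

(** * Half-open decomposition of the Ehrhart series *)

Section Slices.
Local Open Scope classical_set_scope.
Variables (R : realType) (n : nat) (I : finType) (a : I -> 'rV[R]_n.+1).
Hypothesis (ht_gen : forall i, ht (a i) = 1) (sp : spans a).
Hypothesis lat_gen : forall i, lattice_point (a i).
Local Notation D := n.+1.
Local Notation vec := 'rV[R]_D.
Implicit Types (x y z p : vec) (S T : {set I}) (m : int).

Definition slice m : set vec :=
  [set z | [/\ lattice_point z, cone a z & ht z = m%:~R]].

Lemma finite_slice m : finite_set (slice m).
Proof.
apply: sub_finite_set (finite_lattice_bounded n.+1
  (`|m%:~R| * \sum_i \sum_j `|a i ord0 j|)) => z [lz [l l0 zl] hz].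
split=> // j; rewrite zl summxE.
apply: le_trans (ler_norm_sum _ _ _) _; rewrite mulr_sumr; apply: ler_sum => i _.
rewrite mxE normrM; apply: ler_pM => //; last first.
  by rewrite (bigD1 j) //= lerDl sumr_ge0.
rewrite -hz zl (ht_comb ht_gen) (bigD1 i) //= ger0_norm //.
by apply: le_trans (ler_norm _); rewrite lerDl sumr_ge0.
Qed.

Lemma ht_ge0 z : cone a z -> 0 <= ht z.
Proof. by case=> l l0 ->; rewrite (ht_comb ht_gen) sumr_ge0. Qed.

Lemma ht_int z : lattice_point z -> ht z \is a Num.int.
Proof. exact. Qed.

Definition ehr m : int := (cnt (slice m))%:Z.

Lemma ehr_neg m : m < 0 -> ehr m = 0.
Proof.
move=> m0; rewrite /ehr (_ : slice m = set0) ?cnt0 //.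
apply/seteqP; split=> // z [_ /ht_ge0 + hz]; rewrite hz ler0z.
by rewrite leNgt m0.
Qed.

Variables (w : I -> R) (q : vec).
Hypothesis hw : forall S v, basis a S -> v \notin S -> redcost a w S v != 0.
Hypothesis hq : forall S i, basis a S -> i \in S -> coord a S q i != 0.
Hypothesis qi : icone a q.
Local Notation T := (triang a w).

(** Together with [lexpos] for s = 1 this confines the coordinate to [0, 1) where [q] is positive
    and to (0, 1] where it is negative: a fundamental domain in either case. *)
Definition below S i z : bool :=
  if 0 < coord a S q i then coord a S z i < 1 else coord a S z i <= 1.

(** Interpolates between the half-open cone ([s] empty) and the half-open box ([s] listing [S]), one
    coordinate being cut at a time. *)
Definition region S (s : seq I) m : set vec := [set z |
  [/\ lattice_point z, ht z = m%:~R, lexpos a q 1 S z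
    & forall i, i \in s -> below S i z]].

Lemma finite_region S s m : basis a S -> finite_set (region S s m).
Proof.
move=> bS; apply: sub_finite_set (finite_slice m) => z [lz hz pz _]; split=> //.
exact: cone_lexpos pz.
Qed.

(** Points with [below S i] form the first term. The others, translated by [- a i], are exactly the
    points of the uncut region one level lower. *)
Lemma region_step S i s m : basis a S -> i \in S -> i \notin s ->
  {subset s <= S} ->
  cnt (region S s m) = (cnt (region S (i :: s) m) + cnt (region S s (m - 1)))%N.
Proof.
move=> bS iS its sS.
have cai k : coord a S (a i) k = (k == i)%:R by apply: coord_gen.
have si k : k \in s -> (k == i) = false by case: eqP its => // -> /negPf ->.
rewrite -(@cnt_image _ _ (fun z => a i + z) (region S s (m - 1))); last 2 first.
- exact: finite_region.
- by move=> x y _ _ /addrI.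
rewrite -cntU; last 3 first.
- exact: finite_region.
- by apply: finite_image; apply: finite_region.
- move=> y [[_ _ _ bi] [z [_ _ pz _] zy]]; move: bi; rewrite -zy.
  move=> /(_ i (mem_head _ _)); move/forall_inP/(_ i iS): pz.
  rewrite /below coordD cai eqxx mul1r mulr1n {y zy}.
  case: (ltrP 0 (coord a S q i)) => q0 /orP[h|/andP[/eqP -> ?]] h'; exfalso; lra.
congr cnt; apply/seteqP; split=> z.
- case=> lz hz pz bz.
  have [biz|biz] := boolP (below S i z).
    by left; split=> // k; rewrite inE => /predU1P[->|/bz].
  right; exists (z - a i); last by rewrite addrC subrK.
  split.
  + exact: latB.
  + by rewrite htB ht_gen hz rmorphB.
  + apply/forall_inP => k kS; rewrite coordB cai.
    case: eqP => [->|_]; last by rewrite subr0; move/forall_inP: pz; apply.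
    move: biz; rewrite /below mul1r; case: ltrP => q0; rewrite -?leNgt -?ltNge => h.
      by rewrite andbT subr_gt0 subr_eq0 orbC eq_sym -le_eqVlt.
    by rewrite subr_gt0 h.
  + by move=> k ks; have := bz k ks; rewrite /below coordB cai si // subr0.
- case=> [[lz hz pz bz]|[y [ly hy py by_] <-]].
    by split=> // k ks; apply: bz; rewrite inE ks orbT.
  split.
  + exact: latD.
  + by rewrite htD ht_gen hy rmorphB /= addrC subrK.
  + apply/forall_inP => k kS; rewrite coordD cai.
    move/forall_inP/(_ k kS): py; case: (k =P i) => [->|_]; last by rewrite add0r.
    by case/orP => [h|/andP[/eqP -> _]]; [rewrite ltr_wpDl|rewrite addr0 ltr01].
  + by move=> k ks; have := by_ k ks; rewrite /below coordD cai si // add0r.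
Qed.

Lemma region_dlt S s m : basis a S -> uniq s -> {subset s <= S} ->
  (cnt (region S s m))%:Z = dlt (size s) (fun m => (cnt (region S [::] m))%:Z) m.
Proof.
move=> bS; elim: s m => [|i s IH] m us sS; first by rewrite dlt0.
case/andP: us => its us.
have sS' : {subset s <= S} by move=> k ks; apply: sS; rewrite inE ks orbT.
rewrite dltS -!IH // (region_step m bS (sS i (mem_head _ _)) its sS').
by rewrite PoszD addrK.
Qed.

Lemma ehr_triang m : ehr m = \sum_(S in T) (cnt (region S [::] m))%:Z.
Proof.
rewrite /ehr -(big_morph Posz PoszD (erefl _)); congr Posz.
pose X S := if S \in T then region S [::] m else set0.
have -> : (\sum_(S in T) cnt (region S [::] m) = \sum_(S in T) cnt (X S))%N.
  by apply: eq_bigr => S ST; rewrite /X ST.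
rewrite -cnt_big.
- congr cnt; apply/seteqP; split=> z.
    case=> lz cz hz; have [S ST pz] := lexpos_cone ht_gen sp hw hq qi cz.
    by exists S => //; rewrite /X ST; split.
  case=> S ST; rewrite /X ST => -[lz hz pz _]; split=> //.
  exact: cone_lexpos (triang_basis ST) pz.
- move=> S; rewrite /X; case: ifP => [ST|_]; last exact: finite_set0.
  by apply: finite_region; apply: triang_basis ST.
- move=> S S' z ST ST'; rewrite /X ST ST' => -[_ _ pz _] [_ _ pz' _].
  by apply: (lexpos_uniq hq _ ST ST' pz pz'); apply: oner_neq0.
Qed.

Definition box S m : set vec := region S (enum S) m.

(** Cutting all D coordinates of each half-open cone takes D differences, so [h*] counts box points
    by height. This yields nonnegativity, and emptiness of the boxes wherever [h*] vanishes. *)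
Lemma dlt_ehr m : dlt D ehr m = \sum_(S in T) (cnt (box S m))%:Z.
Proof.
rewrite (eq_dlt _ _ ehr_triang) dlt_sum; apply: eq_bigr => S ST.
have bS := triang_basis ST.
have szS : size (enum S) = D by rewrite -cardE (basis_card bS).
rewrite /box region_dlt ?enum_uniq ?szS // => i.
by rewrite mem_enum.
Qed.

Lemma boxP S m z : box S m z <-> [/\ lattice_point z, ht z = m%:~R,
  lexpos a q 1 S z & forall i, i \in S -> below S i z].
Proof.
split=> -[lz hz pz h]; split=> // i.
  by move=> iS; apply: h; rewrite mem_enum.
by rewrite mem_enum; apply: h.
Qed.

Lemma finite_box S m : basis a S -> finite_set (box S m).
Proof. exact: finite_region. Qed.

Lemma dlt_ehr_eq0 m : dlt D ehr m = 0 -> forall S z, S \in T -> ~ box S m z.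
Proof.
rewrite dlt_ehr -(big_morph Posz PoszD (erefl _)) => -[/eqP].
rewrite sum_nat_eq0 => /forall_inP h S z ST.
by apply: cnt_eq0; [apply: finite_box (triang_basis ST)|apply/eqP/h].
Qed.

End Slices.

(** * Half-open boxes and interior points *)

Section Reciprocity.
Local Open Scope classical_set_scope.
Variables (R : realType) (n : nat) (I : finType) (a : I -> 'rV[R]_n.+1).
Hypothesis (ht_gen : forall i, ht (a i) = 1) (sp : spans a).
Hypothesis lat_gen : forall i, lattice_point (a i).
Local Notation D := n.+1.
Local Notation vec := 'rV[R]_D.
Implicit Types (x y z p : vec) (S T : {set I}) (m : int).

Definition interior_points m : set vec :=
  [set z | [/\ lattice_point z, icone a z & ht z = m%:~R]].

Lemma finite_interior m : finite_set (interior_points m).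
Proof.
apply: sub_finite_set (finite_slice ht_gen m) => z [lz iz hz].
by split=> //; apply: icone_cone.
Qed.

Definition box_points (q : vec) (d : nat) : set vec :=
  [set z | [/\ lattice_point z, ht z <= d%:R &
     exists S, [/\ basis a S, forall i, 0 <= coord a S z i &
                   forall i, i \in S -> below a q S i z]]].

Lemma finite_cone_below (d : nat) :
  finite_set [set z | [/\ lattice_point z, cone a z & ht z <= d%:R]].
Proof.
apply: (@sub_finite_set _ _ (\bigcup_(i in `I_d.+1) slice a i%:Z)); last first.
  by apply: bigcup_finite => [|i _]; [exact: finite_II|exact: finite_slice].
move=> z [lz cz hz]; have [m hm] := intrP (ht_int lz).
have := ht_ge0 ht_gen cz; rewrite hm ler0z => m0.
move: hz; rewrite hm -[d%:R]/((d%:Z)%:~R) ler_int => hmd.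
exists `|m|%N; first by rewrite /=; lia.
by split=> //; rewrite gez0_abs.
Qed.

Lemma box_points_cone q d z : box_points q d z -> cone a z.
Proof.
by case=> _ _ [S [bS h _]]; rewrite -(comb_coord z bS); exists (coord a S z).
Qed.

Lemma finite_box_points q d : finite_set (box_points q d).
Proof.
apply: sub_finite_set (finite_cone_below d) => z bz.
by split; [case: bz|exact: box_points_cone bz|case: bz].
Qed.

Section Fixed.
Local Open Scope classical_set_scope.
Variables (w : I -> R) (q : vec).
Hypothesis hw : forall S v, basis a S -> v \notin S -> redcost a w S v != 0.
Hypothesis hq : forall S i, basis a S -> i \in S -> coord a S q i != 0.
Hypothesis qi : icone a q.
Local Notation T := (triang a w).
Local Notation box := (box a q).

(** The unique integer whose difference with the coordinate lies in the half-open unit interval of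
    [below]: [0, 1) needs the ceiling, (0, 1] the floor plus 1. *)
Definition round_above S i z : int :=
  if 0 < coord a S q i then Num.ceil (coord a S z i)
  else Num.floor (coord a S z i) + 1.

Lemma lat_coord_comb S (l : I -> int) :
  lattice_point (\sum_(i in S) (l i)%:~R *: a i).
Proof. by apply: lat_sum => i _; apply: latZ => //; apply: rpred_int. Qed.

Lemma coord_partial S (l : I -> R) : basis a S -> forall i, i \in S ->
  coord a S (\sum_(j in S) l j *: a j) i = l i.
Proof.
move=> bS i iS; rewrite coord_sum (bigD1 i) //= coordZ coord_gen // eqxx mulr1.
rewrite big1 ?addr0 // => j /andP[jS ji].
by rewrite coordZ coord_gen // eq_sym (negPf ji) mulr0.
Qed.

Lemma ht_partial S (l : I -> R) :
  ht (\sum_(j in S) l j *: a j) = \sum_(j in S) l j.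
Proof. by rewrite ht_sum; apply: eq_bigr => j _; rewrite htZ ht_gen mulr1. Qed.

(* Complementing coordinates exchanges interior points and half-open boxes. *)
Lemma icone_box z : lattice_point z -> icone a z ->
  exists S (kp : I -> int) (h : nat), let b := \sum_(i in S) (kp i)%:~R *: a i - z in
  [/\ S \in T, forall i, i \in S -> 1 <= kp i, box S h b
    & \sum_(i in S) (kp i)%:~R = h%:R + ht z].
Proof.
move=> lz iz; have [S ST pz] := lexpos_icone ht_gen sp hw hq iz.
have bS := triang_basis ST.
pose kp i := round_above S i z; set b := \sum_(i in S) (kp i)%:~R *: a i - z.
have lb : lattice_point b by apply: latB => //; apply: lat_coord_comb.
have cb i : i \in S -> coord a S b i = (kp i)%:~R - coord a S z i.
  by move=> iS; rewrite /b coordB (coord_partial (fun i => (kp i)%:~R)).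
have posb : lexpos a q 1 S b.
  apply/forall_inP => i iS; rewrite cb // /kp /round_above mul1r.
  case: (ltrP 0 (coord a S q i)) => q0.
    by rewrite andbT subr_gt0 subr_eq0 orbC eq_sym -le_eqVlt ceil_ge.
  by rewrite subr_gt0 floorD1_gt.
have hb0 := ht_ge0 ht_gen (cone_lexpos bS posb).
have [h hh] := intrP (ht_int lb).
have h0 : 0 <= h by rewrite -(ler0z R) -hh.
exists S, kp, `|h|%N; split=> //.
- move=> i iS; rewrite /kp /round_above; move/forall_inP/(_ i iS): pz.
  case: (ltrP 0 (coord a S q i)) => q0.
    rewrite mulN1r oppr_gt0 (lt_gtF q0) andbF orbF => c0.
    by rewrite -gtz0_ge1 -(ltr0z R) (lt_le_trans c0) // ceil_ge.
  move=> hc; rewrite lerDr floor_ge0.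
  by case/orP: hc => [/ltW //|/andP[/eqP -> _]].
- apply/boxP; split=> //; first by rewrite gez0_abs.
  move=> i iS; rewrite /below cb // /kp /round_above.
  case: (ltrP 0 (coord a S q i)) => q0.
    by have := ceil_itv (coord a S z i); rewrite rmorphB /=; lra.
  by have := floor_itv (coord a S z i); rewrite rmorphD /=; lra.
- have := hh; rewrite /b htB (ht_partial S (fun i => (kp i)%:~R)).
  by rewrite -[(`|h|%N)%:R]/((`|h|%N%:Z)%:~R) gez0_abs //; lra.
Qed.

Lemma box_icone S (h : nat) b : S \in T -> box S h b ->
  icone a (\sum_(i in S) a i - b).
Proof.
move=> ST /boxP[lb hb pb ub]; have bS := triang_basis ST.
apply: (icone_lexpos hq qi bS); apply/forall_inP => i iS.
have -> : \sum_(i in S) a i = \sum_(i in S) 1 *: a i.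
  by apply: eq_bigr => j _; rewrite scale1r.
rewrite coordB (coord_partial (fun=> 1)) // mulN1r oppr_gt0 subr_gt0 subr_eq0.
have := ub i iS; rewrite /below.
case: (ltrgtP 0 (coord a S q i)) (hq bS iS) => // q0 _; first by move=> ->.
by rewrite andbT orbC eq_sym -le_eqVlt.
Qed.

Variables (d : nat) (k : int).
Hypothesis hd : forall i : nat, (d < i)%N -> dlt D (ehr a) i = 0.
Hypothesis hk : dlt D (ehr a) d = k.
Hypothesis k0 : k != 0.

Lemma box_height_le S (h : nat) b : S \in T -> box S h b -> (h <= d)%N.
Proof.
move=> ST bb; rewrite leqNgt; apply/negP => /hd h0.
exact: (dlt_ehr_eq0 ht_gen sp lat_gen hw hq qi h0 ST bb).
Qed.

Lemma sum_ge_card S (kp : I -> int) : basis a S ->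
  (forall i, i \in S -> 1 <= kp i) ->
  (D%:R : R) <= \sum_(i in S) (kp i)%:~R.
Proof.
move=> bS h; rewrite -(basis_card bS) -sum1_card natr_sum ler_sum // => i iS.
by rewrite ler1z h.
Qed.

(** In [icone_box] the D integers [kp i] are at least 1 and sum to [h + ht z], while the box height
    h is at most d. *)
Lemma icone_height z : lattice_point z -> icone a z -> D%:R - d%:R <= ht z.
Proof.
move=> lz iz; have [S [kp [h [ST kp1 bb hs]]]] := icone_box lz iz.
have := sum_ge_card (triang_basis ST) kp1.
have := box_height_le ST bb; rewrite -(ler_nat R); lra.
Qed.

Lemma ht_sum_basis S : basis a S -> ht (\sum_(i in S) a i) = D%:R.
Proof.
move=> bS; rewrite ht_sum -(basis_card bS) -sum1_card natr_sum.
by apply: eq_bigr => i _; rewrite ht_gen.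
Qed.

(** At height D - d the inequalities of [icone_height] are equalities: h = d and every [kp i] is 1.
    So each such point is the complement of a box point counted by the top coefficient. *)
Lemma cnt_interior_le : (cnt (interior_points (D%:Z - d%:Z)))%:Z <= k.
Proof.
rewrite -hk (dlt_ehr ht_gen sp lat_gen hw hq qi).
rewrite -(big_morph Posz PoszD (erefl _)) lez_nat.
pose X S := (fun b => \sum_(i in S) a i - b) @` box S d.
apply: (@leq_trans (\sum_(S in T) cnt (X S))%N); last first.
  apply: leq_sum => S ST; rewrite /X cnt_image //.
    by apply: finite_box => //; apply: triang_basis ST.
  by move=> x y _ _ /addrI/oppr_inj.
apply: cnt_big_le => [S ST|z [lz iz hz]].
  by apply: finite_image; apply: finite_box => //; apply: triang_basis ST.
have [S [kp [h [ST kp1 bb hs]]]] := icone_box lz iz.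
have bS := triang_basis ST.
have hD := sum_ge_card bS kp1; have hle := box_height_le ST bb.
have hle' : (h%:R : R) <= d%:R by rewrite ler_nat.
move: hs; rewrite hz rmorphB /= -!pmulrn => hs.
have hh : h = d by apply/eqP; rewrite eqn_leq hle -(ler_nat R); lra.
rewrite hh in bb hs.
have kpE i : i \in S -> kp i = 1.
  move=> iS; apply/eqP; rewrite eq_le kp1 // andbT -(ler_int R).
  have : \sum_(j in S) ((kp j)%:~R - 1 : R) = 0.
    rewrite sumrB hs; have -> : \sum_(j in S) (1 : R) = D%:R.
      by rewrite -(basis_card bS) -sum1_card natr_sum.
    lra.
  move/eqP; rewrite psumr_eq0 => [/allP/(_ i (mem_index_enum _))|j jS].
    by rewrite iS subr_eq0 => /eqP ->.
  by rewrite subr_ge0 ler1z kp1.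
exists S => //; exists (\sum_(i in S) (kp i)%:~R *: a i - z) => //.
rewrite opprB addrC -addrA (_ : - _ + _ = 0) ?addr0 //.
rewrite addrC -sumrB big1 // => i iS.
by rewrite kpE // scale1r subrr.
Qed.

Lemma exists_interior : exists z, interior_points (D%:Z - d%:Z) z.
Proof.
move: k0; rewrite -hk (dlt_ehr ht_gen sp lat_gen hw hq qi).
rewrite -(big_morph Posz PoszD (erefl _)) eqz_nat sum_nat_eq0.
rewrite negb_forall_in => /exists_inP[S ST /cnt_neq0[b bb]].
have bS := triang_basis ST; have ib := box_icone ST bb.
have /boxP[lb hb _ _] := bb.
exists (\sum_(i in S) a i - b); split=> //.
  by apply: latB => //; apply: lat_sum.
by rewrite htB ht_sum_basis // hb rmorphB.
Qed.

Lemma sum_dlt_le :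
  \sum_(i < d.+1) dlt D (ehr a) i%:Z <= (cnt (box_points q d))%:Z.
Proof.
under eq_bigr => i _ do rewrite (dlt_ehr ht_gen sp lat_gen hw hq qi).
rewrite pair_big /=.
rewrite -(big_morph Posz PoszD (erefl _)) lez_nat.
pose X (f : 'I_d.+1 * {set I}) := if f.2 \in T then box f.2 f.1 else set0.
rewrite (eq_bigr (fun f => cnt (X f))) => [|f fT]; last by rewrite /X fT.
rewrite -cnt_big.
- apply: cnt_sub; first exact: finite_box_points.
  move=> z [[i S] /= ST]; rewrite /X /= ST => /boxP[lz hz pz bz].
  split=> //; first by rewrite hz -pmulrn ler_nat -ltnS.
  exists S; split=> //; first exact: triang_basis ST.
  by move=> j; apply: lexpos_ge0 pz.
- move=> [i S]; rewrite /X /=; case: ifP => [ST|_]; last exact: finite_set0.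
  by apply: finite_box => //; apply: triang_basis ST.
- move=> [i S] [i' S'] z /= ST ST'; rewrite /X /= ST ST' => /boxP[_ hz pz _].
  case/boxP=> _ hz' pz' _; have -> : S = S'.
    by apply: (lexpos_uniq hq _ ST ST' pz pz'); apply: oner_neq0.
  move: hz'; rewrite hz => /eqP; rewrite eqr_int eqz_nat => /eqP/val_inj -> //.
Qed.

Lemma dlt_ge0 m : 0 <= dlt D (ehr a) m.
Proof. by rewrite (dlt_ehr ht_gen sp lat_gen hw hq qi) sumr_ge0. Qed.

End Fixed.

(** The interface to [h*]: from here on only heights and numbers of interior points and box points
    are used, and of the generic data only [q] survives. *)
Theorem reciprocity (d : nat) (k : int) :
  (forall i : nat, (d < i)%N -> dlt D (ehr a) i = 0) ->
  dlt D (ehr a) d = k -> k != 0 ->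
  [/\ forall z, lattice_point z -> icone a z -> D%:R - d%:R <= ht z,
      (cnt (interior_points (D%:Z - d%:Z)))%:Z <= k,
      exists z, interior_points (D%:Z - d%:Z) z,
      forall m, 0 <= dlt D (ehr a) m &
      exists2 q, icone a q &
        \sum_(i < d.+1) dlt D (ehr a) i%:Z <= (cnt (box_points q d))%:Z].
Proof.
move=> hd hk k0; have [q qi hq] := exists_generic_q a.
have [w hw] := exists_generic_w a.
split.
- by move=> z; apply: (icone_height hw hq qi hd).
- exact: (cnt_interior_le hw hq qi hd hk).
- exact: (exists_interior hw hq qi hk k0).
- exact: (dlt_ge0 hw hq qi).
- by exists q => //; apply: (sum_dlt_le hw hq qi).
Qed.

End Reciprocity.

(** * A small core of a basis of maximal volume *)

Section MaxVolume.
Variables (R : realFieldType) (r : nat) (I : finType) (y : I -> 'rV[R]_r).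

Definition rowsof (f : 'I_r -> I) : 'M[R]_r := \matrix_j y (f j).

(** Cramer's rule. Exchanging one vertex scales the volume by a coordinate of the new vertex, so
    maximal volume forces all coordinates into [-1, 1]. *)
Lemma det_replace_row (f : {ffun 'I_r -> I}) (j : 'I_r) (v : I) :
  rowsof f \in unitmx ->
  \det (rowsof [ffun k => if k == j then v else f k]) =
  (y v *m invmx (rowsof f)) 0 j * \det (rowsof f).
Proof.
move=> uf; set B := rowsof f; set B' := rowsof _.
rewrite (expand_det_row B' j) /invmx uf -scalemxAr mxE mulrC mulrA divrr ?mul1r.
  rewrite mxE; apply: eq_bigr => k _; rewrite !mxE ffunE eqxx; congr (_ * _).
  rewrite /cofactor; congr (_ * \det _); apply/matrixP => i l; rewrite !mxE.
  by rewrite ffunE eq_sym (negPf (neq_lift _ _)).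
by rewrite -unitmxE.
Qed.

Lemma exists_max_volume : spans y -> exists2 f : {ffun 'I_r -> I},
  rowsof f \in unitmx & forall i j, `|(y i *m invmx (rowsof f)) 0 j| <= 1.
Proof.
move=> sp; have [S bS _] := caratheodory_basis sp (cone0 y).
have cS := basis_card bS.
pose f0 : {ffun 'I_r -> I} := [ffun j => enum_val (cast_ord (esym cS) j)].
have u0 : \det (rowsof f0) != 0.
  rewrite -unitfE -unitmxE -row_full_unit -sub1mx; apply/row_subP => k.
  rewrite -(comb_coord (row k 1%:M) bS); apply: summx_sub => i _.
  have [iS|iS] := boolP (i \in S); last by rewrite coord_notin // scale0r sub0mx.
  apply: scalemx_sub; have -> : y i = row (cast_ord cS (enum_rank_in iS i)) (rowsof f0).
    by rewrite rowK ffunE cast_ordK enum_rankK_in.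
  exact: row_sub.
have [f _ fmax] := arg_maxP (fun f : {ffun 'I_r -> I} => `|\det (rowsof f)|)
  (P := predT) (i0 := f0) isT.
have d0 : 0 < `|\det (rowsof f)|.
  by apply: lt_le_trans (fmax f0 isT); rewrite normr_gt0.
have uf : rowsof f \in unitmx by rewrite unitmxE unitfE -normr_gt0.
exists f => // i j.
have := fmax [ffun k => if k == j then i else f k] isT.
by rewrite /= det_replace_row // normrM -[X in _ <= X]mul1r ler_pM2r.
Qed.

End MaxVolume.

(** * Enlarging the core until all generators are axial *)

Section Structure.
Variables (R : realType) (n : nat) (I : finType) (a : I -> 'rV[R]_n.+1).
Hypothesis (ht_gen : forall i, ht (a i) = 1) (sp : spans a).
Hypothesis lat_gen : forall i, lattice_point (a i).
Local Notation D := n.+1.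
Local Notation vec := 'rV[R]_D.
Variable f : {ffun 'I_D -> I}.
Hypothesis uf : rowsof a f \in unitmx.
Implicit Types (x z w Y : vec) (J : {set 'I_D}).

Local Notation b j := (a (f j)).
Definition co z (j : 'I_D) : R := (z *m invmx (rowsof a f)) 0 j.

Lemma co_sum z : z = \sum_j co z j *: b j.
Proof.
rewrite -{1}(mulmxKV uf z) mulmx_sum_row; apply: eq_bigr => j _.
by rewrite rowK.
Qed.

Lemma coD x z j : co (x + z) j = co x j + co z j.
Proof. by rewrite /co mulmxDl mxE. Qed.

Lemma coZ c z j : co (c *: z) j = c * co z j.
Proof. by rewrite /co -scalemxAl mxE. Qed.

Lemma coN z j : co (- z) j = - co z j.
Proof. by rewrite -scaleN1r coZ mulN1r. Qed.

Lemma coB x z j : co (x - z) j = co x j - co z j.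
Proof. by rewrite coD coN. Qed.

Lemma co_big (K : Type) (r : seq K) (P : pred K) (F : K -> vec) j :
  co (\sum_(k <- r | P k) F k) j = \sum_(k <- r | P k) co (F k) j.
Proof.
elim/big_rec2: _ => [|k u z _ <-]; last by rewrite coD.
by rewrite -(scale0r 0) coZ mul0r.
Qed.

Lemma co_basis k j : co (b k) j = (j == k)%:R.
Proof.
have -> : b k = row k (rowsof a f) by rewrite rowK.
by rewrite /co -row_mul mulmxV // !mxE eq_sym.
Qed.

Lemma co_lin (c : 'I_D -> R) j : co (\sum_k c k *: b k) j = c j.
Proof.
rewrite co_big (bigD1 j) //= coZ co_basis eqxx mulr1 big1 ?addr0 // => k kj.
by rewrite coZ co_basis eq_sym (negPf kj) mulr0.
Qed.

Lemma ht_co z : ht z = \sum_j co z j.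
Proof.
by rewrite {1}[z]co_sum ht_sum; apply: eq_bigr => j _; rewrite htZ ht_gen mulr1.
Qed.

Definition nonint : {set 'I_D} :=
  [set j | `[< exists2 z, lattice_point z & co z j \isn't a Num.int >]].

Lemma co_int z j : lattice_point z -> j \notin nonint -> co z j \is a Num.int.
Proof.
move=> lz; rewrite inE => /asboolPn h; apply/negPn/negP => hz; apply: h.
by exists z.
Qed.

Definition bad z : {set 'I_D} := [set j | co z j \isn't a Num.int].

Lemma bad_nonint z : lattice_point z -> bad z \subset nonint.
Proof.
move=> lz; apply/fintype.subsetP => j; rewrite !inE => h; apply/asboolP.
by exists z.
Qed.

(* A random subset sum of witnesses is non-integral at each coordinate of
   nonint with probability at least 1/2. *)
Lemma exists_bad_half : exists2 z, lattice_point z & (#|nonint| <= 2 * #|bad z|)%N.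
Proof.
have hg j : exists z, lattice_point z /\
    (j \in nonint -> co z j \isn't a Num.int).
  have [|jN] := boolP (j \in nonint).
    by rewrite inE => /asboolP[z lz hz]; exists z.
  exists 0; split=> // i; by rewrite mxE.
have [g hg'] := choice hg.
pose s (E : {set 'I_D}) := \sum_(j in E) g j.
have ls E : lattice_point (s E) by apply: lat_sum => j _; have [] := hg' j.
apply: contrapT => hn.
have small E : (2 * #|bad (s E)| < #|nonint|)%N.
  by rewrite ltnNge; apply/negP => h; apply: hn; exists (s E).
have cnt_j j : j \in nonint ->
    (#|{set 'I_D}| <= 2 * #|[set E | j \in bad (s E)]|)%N.
  (* Toggling [j] changes the subset sum by [g j], which is non-integral at [j]. Hence [tog] injects
     the subsets with integral j-coordinate into the others. *)
  move=> jN; pose tog (E : {set 'I_D}) := if j \in E then E :\ j else j |: E.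
  have togK : involutive tog.
    move=> E; rewrite /tog; case: (boolP (j \in E)) => jE.
      by rewrite !inE eqxx /= finset.setD1K.
    by rewrite finset.setU11 finset.setU1K.
  have sub : tog @: (~: [set E | j \in bad (s E)]) \subset [set E | j \in bad (s E)].
    apply/fintype.subsetP => _ /imsetP[E + ->]; rewrite !inE negbK /tog => hE.
    have [_ /(_ jN) hj] := hg' j.
    case: ifP => jE; apply: contra hj => h.
      have -> : g j = s E - s (E :\ j) by rewrite /s (big_setD1 j) //= addrK.
      by rewrite coB rpredB.
    have -> : g j = s (j |: E) - s E by rewrite /s big_setU1 ?jE //= addrK.
    by rewrite coB rpredB.
  have := fintype.subset_leq_card sub; rewrite card_imset; last exact: inv_inj.
  by rewrite -(cardsC [set E | j \in bad (s E)]); lia.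
have N0 : (0 < #|nonint|)%N by exact: leq_ltn_trans (leq0n _) (small finset.set0).
have : (\sum_(E : {set 'I_D}) 2 * #|bad (s E)| < #|{set 'I_D}| * #|nonint|)%N.
  rewrite -sum_nat_const -[X in (_ < X)%N]subn0.
  rewrite (bigD1 finset.set0) //= [X in (_ < X - 0)%N](bigD1 finset.set0) //= subn0.
  by rewrite -addSn leq_add ?small // leq_sum // => E _; apply: ltnW.
rewrite ltnNge => /negP; apply.
have -> : (\sum_(E : {set 'I_D}) 2 * #|bad (s E)| =
    \sum_(j in nonint) 2 * #|[set E | j \in bad (s E)]|)%N.
  rewrite -!big_distrr /=; congr (_ * _)%N.
  have cE E : (#|bad (s E)| = \sum_(j in nonint) (j \in bad (s E)))%N.
    rewrite -sum1_card big_mkcond [RHS]big_mkcond; apply: eq_bigr => j _ /=.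
    have [jb|_] := boolP (j \in bad (s E)); last by case: ifP.
    by rewrite (fintype.subsetP (bad_nonint (ls E))).
  under eq_bigr do rewrite cE.
  rewrite exchange_big; apply: eq_bigr => j _.
  rewrite -sum1_card [RHS]big_mkcond; apply: eq_bigr => E _ /=.
  by rewrite [in RHS]inE; case: ifP.
by rewrite mulnC -sum_nat_const leq_sum // => j jN; apply: cnt_j.
Qed.

(** Subtracting ceiling minus 1 instead of the floor lands in (0, 1], so integral coordinates become
    1 and all coordinates in [nonint] stay strictly positive. *)
Definition round_pos z : vec := z -
  \sum_j (if j \in nonint then (Num.ceil (co z j))%:~R - 1 else co z j) *: b j.

Lemma co_round_pos z j : co (round_pos z) j =
  if j \in nonint then co z j - (Num.ceil (co z j))%:~R + 1 else 0.
Proof.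
by rewrite /round_pos coB co_lin; case: ifP => _; [ring|rewrite subrr].
Qed.

Lemma lat_round_pos z : lattice_point z -> lattice_point (round_pos z).
Proof.
move=> lz; apply: latB => //; apply: lat_sum => j _; apply: latZ => //.
case: ifPn => [_|/(co_int lz) //]; rewrite rpredB ?rpred1 //.
exact: rpred_int.
Qed.

(** A coordinate contributes 1 to [round_pos z + round_pos (- z)] if it is non-integral and 2
    otherwise. With half of [nonint] bad, the lower of the two points meets the 3/4 bound. *)
Lemma exists_short_positive : exists Y, [/\ lattice_point Y,
  forall j, j \in nonint -> 0 < co Y j, forall j, j \notin nonint -> co Y j = 0
  & 4%:R * ht Y <= 3%:R * #|nonint|%:R].
Proof.
have [z lz hz] := exists_bad_half.
suff [Y lY hY] : exists2 Y, lattice_point Y &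
    4%:R * ht (round_pos Y) <= 3%:R * #|nonint|%:R.
  exists (round_pos Y); split=> //; first exact: lat_round_pos.
    move=> j jN; rewrite co_round_pos jN.
    by have := ceil_itv (co Y j); rewrite rmorphB /=; lra.
  by move=> j /negPf jN; rewrite co_round_pos jN.
have htE x : ht (round_pos x) = \sum_(j in nonint) (co x j - (Num.ceil (co x j))%:~R + 1).
  by rewrite ht_co [RHS]big_mkcond; apply: eq_bigr => j _; rewrite co_round_pos.
have sumE : ht (round_pos z) + ht (round_pos (- z)) = 2%:R * #|nonint|%:R - #|bad z|%:R.
  rewrite !htE -big_split /=.
  have -> : #|bad z|%:R = \sum_(j in nonint) (j \in bad z)%:R :> R.
    rewrite -natr_sum; congr _%:R.
    rewrite -sum1_card big_mkcond [RHS]big_mkcond; apply: eq_bigr => j _ /=.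
    have [jb|_] := boolP (j \in bad z); last by case: ifP.
    by rewrite (fintype.subsetP (bad_nonint lz)).
  have -> : #|nonint|%:R = \sum_(j in nonint) (1 : R).
    by rewrite -sum1_card natr_sum.
  rewrite mulr_sumr -sumrB; apply: eq_bigr => j _.
  have -> : Num.ceil (co (- z) j) = - Num.floor (co z j).
    by rewrite coN ceilNfloor opprK.
  rewrite coN ceil_floor inE rmorphN rmorphD /=.
  by case: (co z j \isn't a Num.int) => /=; ring.
have {hz} : (#|nonint|%:R : R) <= 2%:R * #|bad z|%:R.
  by rewrite -natrM ler_nat.
have [h|h] := lerP (ht (round_pos z)) (ht (round_pos (- z))) => hz.
  by exists z => //; lra.
by exists (- z); [exact: latN|lra].
Qed.

Variable d : nat.
Hypothesis hmin : forall z, lattice_point z -> icone a z -> D%:R - d%:R <= ht z.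

(** The invariant of the enlargement: absorbing [- b j] for [j] in [J] means that adding the
    remaining [b j] makes [Y] interior, and the height budget is 3/4 per element of [J]. *)
Definition reach J Y := [/\ nonint \subset J, lattice_point Y, cone a Y,
  forall j, j \in J -> absorbs a Y (- b j) & 4%:R * ht Y <= 3%:R * #|J|%:R].

Lemma absorbs_combination Y (P : pred 'I_D) (c : 'I_D -> R) : cone a Y ->
  (forall j, P j -> absorbs a Y (- b j)) -> absorbs a Y (\sum_(j | P j) c j *: b j).
Proof.
move=> cY h; apply: absorbs_sum => // j Pj.
have [c0|c0] := lerP 0 (c j).
  by apply: absorbs_cone => //; apply: coneZ => //; apply: cone_gen.
rewrite -[_ *: _]opprK -scaleNr -scalerN; apply: absorbsZ => //; last exact: h.
by rewrite oppr_ge0 ltW.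
Qed.

(** The interior point [Y + Z] has height at most D - |J|/4, whereas interior lattice points have
    height at least D - d. *)
Lemma reach_card J Y : reach J Y -> (#|J| <= 4 * d)%N.
Proof.
case=> _ lY cY aY hY; pose Z := \sum_(j in ~: J) b j.
have cZ : cone a Z by apply: cone_sum => j _; apply: cone_gen.
have iYZ : icone a (Y + Z).
  apply: absorbs_gen_icone; rewrite [- _]co_sum.
  apply: absorbs_combination => [|j _]; first exact: coneD.
  have [jJ|jJ] := boolP (j \in J); first by apply: absorbsDr => //; apply: aY.
  exists 1 => //; rewrite scale1r -addrA; apply: coneD => //.
  rewrite /Z (bigD1 j) ?inE //= addrAC subrr add0r.
  by apply: cone_sum => k _; apply: cone_gen.
have lZ : lattice_point Z by apply: lat_sum.
have := hmin (latD lY lZ) iYZ; rewrite htD.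
have -> : ht Z = D%:R - #|J|%:R.
  rewrite ht_sum; under eq_bigr do rewrite ht_gen.
  rewrite sumr_const cardsCs finset.setCK card_ord natrB //.
  by rewrite -[X in (_ <= X)%N]card_ord max_card.
move=> h; rewrite -(ler_nat R) natrM; lra.
Qed.

(** The surviving coordinate is only asked to be positive here; [co_blk] later finds it to be 1,
    from integrality and the bound by 1. *)
Definition axial J i :=
  (forall j, j \notin J -> co (a i) j = 0) \/
  (exists j, [/\ j \notin J, 0 < co (a i) j &
      forall k, k \notin J -> k != j -> co (a i) k = 0]).

(** Let [P] and [Q] hold the positive and negative coordinates of [a i] outside [J]. Once all
    directions of one sign are available, the expansion of [a i] solves for those of the other sign;
    non-axiality says that [Q] is nonempty or [P] has two elements. *)
Lemma reach_step J Y i : reach J Y -> ~ axial J i ->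
  exists J' Y', reach J' Y' /\ (#|J| < #|J'|)%N.
Proof.
case=> NJ lY cY aY hY ni.
pose c := co (a i).
pose P := [set j | (j \notin J) && (0 < c j)].
pose Q := [set j | (j \notin J) && (c j < 0)].
have c0 j : j \notin J -> j \notin P -> j \notin Q -> c j = 0.
  by rewrite !inE => -> /=; case: ltrgtP.
have dPQ : [disjoint P & Q].
  by apply/pred0P => j /=; rewrite !inE; case: ltrgtP; rewrite ?andbF.
have dJ : [disjoint J & P :|: Q].
  apply/pred0P => j /=; rewrite !inE.
  by case: (j \in J) => //=.
pose J' := J :|: (P :|: Q).
have cJ' : #|J'| = (#|J| + (#|P| + #|Q|))%N.
  by rewrite cardsU disjoint_setI0 // cards0 subn0 cardsU disjoint_setI0 // cards0 subn0.
have pq : (0 < #|Q|)%N || (1 < #|P|)%N.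
  apply: contra_notT ni; rewrite negb_or -leqNgt leqn0 cards_eq0 -leqNgt.
  case/andP=> /eqP Q0; rewrite leq_eqVlt ltnS leqn0 => /orP[/cards1P[j P1]|].
    right; exists j; have : j \in P by rewrite P1 inE.
    rewrite inE => /andP[jJ cj]; split=> // k kJ kj.
    by apply: c0; rewrite ?P1 ?Q0 ?inE.
  rewrite cards_eq0 => /eqP P0; left => j jJ.
  by apply: c0; rewrite ?P0 ?Q0 ?inE.
pose w := \sum_(j in J) c j *: b j.
have aE : a i = w + \sum_(j in P) c j *: b j + \sum_(j in Q) c j *: b j.
  rewrite {1}[a i]co_sum (bigID (mem J)) /= -addrA; congr (_ + _).
  rewrite (bigID (mem P)) /=; congr (_ + _).
    by apply: eq_bigl => j; rewrite !inE; case: (j \in J).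
  rewrite (bigID (mem Q)) /= [X in _ + X]big1 ?addr0.
    apply: eq_bigl => j; rewrite !inE; case: (j \in J) => //=.
    by case: ltrgtP.
  by move=> j /andP[/andP[jJ jP] jQ]; rewrite -/(c j) c0 // scale0r.
have aw Z s : cone a Z -> absorbs a (Y + Z) (s *: w).
  move=> cZ; apply: absorbsDr => //; rewrite scaler_sumr.
  under eq_bigr do rewrite scalerA.
  exact: absorbs_combination.
have cb j : cone a (b j) by apply: cone_gen.
have key Y' Z : Y' = Y + Z -> lattice_point Z -> cone a Z ->
    (forall j, j \in P -> absorbs a Y' (- b j)) ->
    (forall j, j \in Q -> absorbs a Y' (- b j)) ->
    4%:R * ht Z <= 3%:R * (#|P| + #|Q|)%:R -> reach J' Y'.
  move=> -> lZ cZ aP aQ hZ; split.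
  - exact: fintype.subset_trans NJ (finset.subsetUl _ _).
  - exact: latD.
  - exact: coneD.
  - move=> j; rewrite !inE => /orP[/aY|]; first exact: absorbsDr.
    by case/orP=> h; [apply: aP|apply: aQ]; rewrite inE.
  - by rewrite cJ' natrD htD !mulrDr lerD.
have htb (A : {set 'I_D}) : ht (\sum_(j in A) b j) = #|A|%:R.
  by rewrite ht_sum; under eq_bigr do rewrite ht_gen; rewrite sumr_const.
have lb (A : {set 'I_D}) : lattice_point (\sum_(j in A) b j) by apply: lat_sum.
have cbA (A : {set 'I_D}) : cone a (\sum_(j in A) b j) by apply: cone_sum.
have sub1 (A : {set 'I_D}) j : j \in A -> cone a (\sum_(j in A) b j - b j).
  move=> jA; rewrite (bigD1 j) //= addrAC subrr add0r; apply: cone_sum => k _.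
  exact: cb.
have ge0P j : j \in P -> 0 <= c j by rewrite inE => /andP[_ /ltW].
have le0Q j : j \in Q -> c j <= 0 by rewrite inE => /andP[_ /ltW].
exists J'; have ltJ : (#|J| < #|J'|)%N by rewrite cJ'; lia.
(* The cheaper option is taken: add all [b j] with [j] in [P] at cost |P|, or add [a i] and all
   [b j] with [j] in [Q] at cost |Q| + 1, which makes [- a i] absorbed. *)
have [pq1|pq1] := leqP #|P| #|Q|.+1.
- pose Y' := Y + \sum_(j in P) b j; exists Y'; split=> //.
  have cY' : cone a Y' by apply: coneD.
  have aP j : j \in P -> absorbs a Y' (- b j).
    by move=> jP; exists 1 => //; rewrite scale1r -addrA; apply: coneD => //; apply: sub1.
  apply: (key Y' _ erefl) => // [j jQ|]; last first.
    by rewrite htb -!natrM ler_nat; lia.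
  have cj : c j < 0 by move: jQ; rewrite inE => /andP[].
  have -> : - b j = (- c j)^-1 *: (c j *: b j).
    by rewrite scalerA -scaleN1r; congr (_ *: _); field; rewrite lt_eqF.
  apply: absorbsZ => //; first by rewrite invr_ge0 oppr_ge0 ltW.
  have -> : c j *: b j = a i + ((-1) *: w + (\sum_(k in P) (- c k) *: b k
       + \sum_(k in Q | k != j) (- c k) *: b k)).
    rewrite {1}aE (bigD1 j jQ) /= scaleN1r.
    under [\sum_(k in P) - _ *: _]eq_bigr do rewrite scaleNr.
    under [\sum_(k in Q | _) - _ *: _]eq_bigr do rewrite scaleNr.
    rewrite !sumrN; apply/rowP => t; rewrite !mxE; ring.
  apply: absorbsD; first by apply: absorbs_cone => //; apply: cone_gen.
  apply: absorbsD; first exact: aw.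
  apply: absorbsD; first exact: absorbs_combination.
  apply: absorbs_cone => //; apply: cone_sum => k /andP[kQ _].
  by apply: coneZ => //; rewrite oppr_ge0 le0Q.
- pose Z := a i + \sum_(j in Q) b j.
  pose Y' := Y + Z; exists Y'; split=> //.
  have cZ : cone a Z by apply: coneD => //; apply: cone_gen.
  have cY' : cone a Y' by apply: coneD.
  have aQ j : j \in Q -> absorbs a Y' (- b j).
    move=> jQ; exists 1 => //; rewrite scale1r -!addrA; apply: coneD => //.
    by apply: coneD; [exact: cone_gen|exact: sub1].
  have ai : absorbs a Y' (- a i).
    exists 1 => //; rewrite scale1r -addrA; apply: coneD => //.
    by rewrite /Z addrAC subrr add0r.
  apply: (key Y' Z erefl) => // [||].
  + by apply: latD.
  + move=> j jP.
    have cj : 0 < c j by move: jP; rewrite inE => /andP[].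
    have -> : - b j = (c j)^-1 *: (- c j *: b j).
      by rewrite scalerA -scaleN1r; congr (_ *: _); field; rewrite gt_eqF.
    apply: absorbsZ => //; first by rewrite invr_ge0 ltW.
    have -> : - c j *: b j = - a i + (1 *: w + (\sum_(k in P | k != j) c k *: b k
       + \sum_(k in Q) c k *: b k)).
      rewrite {1}aE (bigD1 j jP) /= scale1r.
      by apply/rowP => t; rewrite !mxE; ring.
    apply: absorbsD => //; apply: absorbsD; first exact: aw.
    apply: absorbsD; last exact: absorbs_combination.
    apply: absorbs_cone => //; apply: cone_sum => k /andP[kP _].
    by apply: coneZ => //; apply: ge0P.
  + rewrite htD ht_gen htb -natr1 -!natrM -[1]/(1%:R) -!natrD -natrM ler_nat; lia.
Qed.

Lemma exists_reach0 : exists Y, reach nonint Y.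
Proof.
have [Y [lY Ypos Y0 hY]] := exists_short_positive.
have Yge0 j : 0 <= co Y j.
  by have [/Ypos/ltW|/Y0 ->] := boolP (j \in nonint).
have cco x : (forall j, 0 <= co x j) -> cone a x.
  move=> h; rewrite [x]co_sum; apply: cone_sum => j _; apply: coneZ => //.
  exact: cone_gen.
exists Y; split=> //; first exact: cco.
move=> j jN; exists (co Y j); first exact: Ypos.
apply: cco => k; rewrite coD coZ coN co_basis.
by have [->|_] := eqVneq k j; rewrite ?mulrN ?mulr1 ?subrr // mulr0 subr0.
Qed.

Theorem exists_small_core : exists J, [/\ (#|J| <= 4 * d)%N, nonint \subset J
  & forall i, axial J i].
Proof.
have [Y0 r0] := exists_reach0.
have [N hN] := ubnP (D - #|nonint|)%N.
elim: N {-3}nonint Y0 hN r0 => // N IH J Y hN rJ.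
have [h|/existsNP[i hi]] := pselect (forall i, axial J i).
  by exists J; split=> //; [exact: reach_card rJ|case: rJ].
have [J' [Y' [rJ' lt]]] := reach_step rJ hi.
apply: IH rJ'; have : (#|J'| <= D)%N by rewrite -[X in (_ <= X)%N]card_ord max_card.
lia.
Qed.

End Structure.

(** * Simultaneous approximation *)

Section Dirichlet.
Variables (R : realType) (U : finType).
Implicit Types (lam : U -> R) (H : {set U}).

(** Dirichlet's pigeonhole on fractional parts of multiples of [lam], with its own number of
    subintervals for each coordinate. *)
Lemma simultaneous_approximation lam (c : U -> nat) : exists (j : nat) (m : U -> int),
  [/\ (0 < j)%N, (j <= \prod_i (c i).+1)%N &
      forall i, `|j%:R * lam i - (m i)%:~R| * (c i).+1%:R < 1].
Proof.
pose N := (\prod_i (c i).+1)%N.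
pose frac (j : nat) i := j%:R * lam i - (Num.floor (j%:R * lam i))%:~R.
have frac01 j i : 0 <= frac j i < 1.
  by have := floor_itv (j%:R * lam i); rewrite /frac rmorphD /=; lra.
pose cell (j : nat) i := Num.truncn (frac j i * (c i).+1%:R).
have cell_lt j i : (cell j i < (c i).+1)%N.
  have /andP[f0 f1] := frac01 j i.
  rewrite /cell -(ltr_nat R); apply: (@le_lt_trans _ _ (frac j i * (c i).+1%:R)).
    by rewrite truncn_le // mulr_ge0.
  by rewrite gtr_pMl // ltr0n.
pose key (j : 'I_N.+1) : {dffun forall i : U, 'I_(c i).+1} :=
  [ffun i => inord (cell j i)].
have /injectivePn[j1 [j2 jj kk]] : ~~ injectiveb key.
  apply/negP => /injectiveP/leq_card; rewrite card_ord card_dep_ffun foldrE big_map big_enum /=.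
  rewrite (eq_bigr (fun i => (c i).+1)) => [|i _]; last by rewrite card_ord.
  by rewrite ltnn.
wlog lt12 : j1 j2 jj kk / (j1 < j2)%N => [wl|].
  case: (ltngtP j1 j2) => [h|h|/val_inj h]; first exact: wl h.
    by apply: wl h; rewrite 1?eq_sym.
  by rewrite h eqxx in jj.
exists (j2 - j1)%N, (fun i => Num.floor (j2%:R * lam i) - Num.floor (j1%:R * lam i)).
split; rewrite ?subn_gt0 //.
  by apply: leq_trans (leq_subr _ _) _; rewrite -ltnS.
move=> i; have /(congr1 val) := congr1 (fun g : {dffun forall i : U, 'I_(c i).+1} => g i) kk.
rewrite /key !ffunE /= !inordK ?cell_lt // => ce.
have pos (j : nat) : 0 <= frac j i * (c i).+1%:R.
  by have /andP[f0 _] := frac01 j i; rewrite mulr_ge0.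
have := truncn_itv (pos j1); have := truncn_itv (pos j2).
rewrite -/(cell j1 i) -/(cell j2 i) -ce.
rewrite -!natr1 => /andP[h1 h2] /andP[h3 h4].
rewrite -[X in _ * X](@ger0_norm _ (_ + 1)); last by rewrite addr_ge0.
rewrite -normrM ltr_norml natrB ?(ltnW lt12) // rmorphB /=.
by move: h1 h2 h3 h4; rewrite /frac; lra.
Qed.

(* If the coordinates outside H are tiny compared with those in H, some
   multiple of lam is close to an integer vector, and moving along it increases
   all the tiny coordinates by a factor of at least two. *)
Lemma improve_at_gap lam mu H : 0 < mu -> (forall i, mu <= lam i) ->
  \sum_i lam i = 1 ->
  (exists i, i \notin H) ->
  (forall i, i \notin H ->
     lam i * (2 * #|U|%:R * \prod_(k in H) (3 / lam k)) < 1) ->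
  exists (j : nat) (m : U -> int),
    (forall i, 3 / 2 * mu <= (1 + j%:R) * lam i - (m i)%:~R) /\
    \sum_i ((1 + j%:R) * lam i - (m i)%:~R) = 1.
Proof.
move=> mu0 hmu sum1 [i0 i0H] small.
have lam0 i : 0 < lam i by apply: lt_le_trans (hmu i).
have lam1 i : lam i <= 1.
  by rewrite -sum1 (bigD1 i) //= lerDl sumr_ge0 // => k _; apply: ltW.
(* On [H] the error falls below [lam i / 2]; off [H] a single subinterval is used, which keeps the
   bound on j a product over [H]. *)
pose c i := if i \in H then Num.truncn (2 / lam i) else 0%N.
have [j [m [j0 jN jm]]] := simultaneous_approximation lam c.
set M := \prod_(k in H) (3 / lam k) in small.
have M1 : 1 <= M.
  rewrite /M; elim/big_ind: _ => // [x y x1 y1|k _]; first by nra.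
  by rewrite ler_pdivlMr //; have := lam1 k; lra.
have jM : (j%:R : R) <= M.
  apply: (@le_trans _ _ (\prod_i (c i).+1)%N%:R); first by rewrite ler_nat.
  rewrite natr_prod /M [X in _ <= X]big_mkcond ler_prod // => i _; rewrite ler0n /c.
  case: ifP => _; last exact: lexx.
  rewrite -natr1 andTb.
  have h : 0 <= 2 / lam i by rewrite divr_ge0 // ltW.
  have /andP[h1 _] := truncn_itv h.
  have : 1 <= 1 / lam i by rewrite ler_pdivlMr ?mul1r.
  have -> : 3 / lam i = 2 / lam i + 1 / lam i by field; rewrite gt_eqF.
  lra.
have close i : i \in H -> `|j%:R * lam i - (m i)%:~R| < lam i / 2.
  move=> iH; have := jm i; rewrite /c iH => h.
  have h2 : 0 <= 2 / lam i by rewrite divr_ge0 // ltW.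
  have /andP[_ h3] := truncn_itv h2.
  have h4 : 2 < lam i * (Num.truncn (2 / lam i)).+1%:R.
    by rewrite mulrC -ltr_pdivrMr.
  have := normr_ge0 (j%:R * lam i - (m i)%:~R).
  move: h; set x := `|_|; set t := _.+1%:R in h4 * => h x0.
  have l0 := lam0 i; nra.
pose m' i := if i \in H then m i else 0.
exists j, m'.
have U0 : (0 < #|U|%:R :> R) by rewrite ltr0n; apply/card_gt0P; exists i0.
have tail i : i \notin H -> lam i * M < (2 * #|U|%:R)^-1.
  move=> iH; rewrite -[X in _ < X]mul1r ltr_pdivlMr ?mulr_gt0 //.
  by apply: le_lt_trans (small i iH); lra.
(* The gap makes entries of [H] at least three times [mu]; losing at most half of such an entry
   still leaves 3/2 of [mu]. *)
have mu_small i : i \in H -> 3 * mu <= lam i.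
  move=> iH; have h := small i0 i0H.
  have : 3 / lam i <= M.
    rewrite /M (bigD1 i) //=; apply: ler_peMr; first by rewrite divr_ge0 // ltW.
    elim/big_ind: _ => // [x y x1 y1|k _]; first by nra.
    by rewrite ler_pdivlMr //; have := lam1 k; lra.
  have U1 : 1 <= #|U|%:R :> R by rewrite ler1n; apply/card_gt0P; exists i0.
  rewrite ler_pdivrMr // => h3; have := hmu i0 => h4.
  have l0 := lam0 i; have l00 := lam0 i0.
  have h5 : lam i0 * M < 1.
    apply: le_lt_trans h; rewrite ler_pM2l // ler_peMl; lra.
  have : 3 * lam i0 <= lam i by nra.
  lra.
split.
  move=> i; rewrite /m'; have [iH|iH] := boolP (i \in H).
    have := close i iH; have := mu_small i iH; rewrite ltr_norml; lra.
  have : (1 : R) <= j%:R by rewrite ler1n.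
  have := hmu i; rewrite subr0; nra.
(* The new total is 1 plus an integer, and that integer vanishes because the errors on [H] and the
   increments off [H] each stay within 1/2 in total, the latter strictly. *)
have [z hz] : exists z : int, \sum_i ((1 + j%:R) * lam i - (m' i)%:~R) = 1 + z%:~R.
  exists (j%:Z - \sum_i m' i).
  rewrite sumrB -mulr_sumr sum1 mulr1 rmorphB /= rmorph_sum /= -addrA.
  by congr (1 + (_ - _)).
rewrite hz; suff -> : z = 0 by rewrite addr0.
have hz' : z%:~R = \sum_i (j%:R * lam i - (m' i)%:~R).
  apply: (addrI (1 : R)); rewrite -hz -[X in _ = X + _]sum1 -big_split /=.
  by apply: eq_bigr => i _; ring.
have bound : `|z%:~R : R| < 1.
  rewrite hz'; apply: le_lt_trans (ler_norm_sum _ _ _) _.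
  rewrite (bigID (mem H)) /=.
  have hH : \sum_(i in H) `|j%:R * lam i - (m' i)%:~R| <= 1 / 2.
    apply: (@le_trans _ _ (\sum_(i in H) lam i / 2)).
      by apply: ler_sum => i iH; rewrite /m' iH ltW // close.
    have : \sum_(i in H) lam i <= 1.
      rewrite -sum1 [X in _ <= X](bigID (mem H)) /= lerDl sumr_ge0 // => k _.
      exact: ltW.
    by rewrite -mulr_suml; lra.
  have hT : \sum_(i | i \notin H) `|j%:R * lam i - (m' i)%:~R| < 1 / 2.
    have step i : i \notin H -> `|j%:R * lam i - (m' i)%:~R| < (2 * #|U|%:R)^-1.
      move=> iH; rewrite /m' (negPf iH) subr0 ger0_norm; last first.
        by rewrite mulr_ge0 // ltW.
      by apply: le_lt_trans (tail i iH); rewrite mulrC ler_pM2l.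
    rewrite (bigD1 i0) //=.
    apply: (@lt_le_trans _ _ ((2 * #|U|%:R)^-1 +
        \sum_(i | (i \notin H) && (i != i0)) (2 * #|U|%:R)^-1)).
      by rewrite ltr_leD ?step // ler_sum // => i /andP[iH _]; rewrite ltW // step.
    apply: (@le_trans _ _ (\sum_(i : U) (2 * #|U|%:R)^-1)).
      rewrite [X in _ <= X](bigD1 i0) //= lerD2l.
      rewrite [X in _ <= X](bigID [pred i | i \notin H]) /=.
      rewrite [X in _ <= X + _](eq_bigl (fun i => (i \notin H) && (i != i0))).
        by rewrite lerDl sumr_ge0 // => k _; rewrite invr_ge0 mulr_ge0 // ltW.
      by move=> i; rewrite andbC.
    rewrite sumr_const -[X in X <= _]mulr_natl.
    have e2 (x : R) : 0 < x -> x * (2 * x)^-1 = 1 / 2 by move=> x0; field; rewrite gt_eqF.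
    by rewrite e2 ?lexx.
  lra.
move: bound; rewrite -intr_norm -[1]/(1%:~R) ltr_int; lia.
Qed.

Definition dirichlet_beta (u : nat) : R := ((6 * u)%:R ^+ (2 ^ u.-1))^-1.

(** If no [H] has a gap, entries can be collected one by one. With C = 6u the product M of the
    [3 / lam k] becomes at most C M^2, so after q entries it is at most C^(2^q - 1), and the next
    entry is at least 1/(C M), hence at least C^(-2^q). *)
Lemma dirichlet_improve lam mu : 0 < mu -> (forall i, mu <= lam i) ->
  \sum_i lam i = 1 ->
  (forall i, dirichlet_beta #|U| <= lam i) \/
  exists (j : nat) (m : U -> int),
    (forall i, 3 / 2 * mu <= (1 + j%:R) * lam i - (m i)%:~R) /\
    \sum_i ((1 + j%:R) * lam i - (m i)%:~R) = 1.
Proof.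
move=> mu0 hmu sum1; set u := #|U|; set C : R := (6 * u)%:R.
apply: contrapT => /not_orP[nb ni].
have lam0 i : 0 < lam i by apply: lt_le_trans (hmu i).
have u0 : (0 < u)%N.
  rewrite /u lt0n; apply/eqP => U0; apply: nb => i.
  by have := card0_eq U0 i.
have C1 : 1 <= C by rewrite ler1n muln_gt0.
have [H [cH MH bH]] : exists H, [/\ #|H| = u,
    \prod_(k in H) (3 / lam k) <= C ^+ (2 ^ u).-1 & forall i, i \in H -> dirichlet_beta u <= lam i].
  have : (u <= u)%N by [].
  elim: {1 3 4}u => [|q IH] qu.
    exists finset.set0; rewrite cards0; split=> //.
      by rewrite big_set0 expr0.
    by move=> i; rewrite inE.
  have [H [cH MH bH]] := IH (ltnW qu).
  set M := \prod_(k in H) (3 / lam k) in MH.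
  have M0 : 0 < M by apply: prodr_gt0 => k _; rewrite divr_gt0.
  have [i iH hi] : exists2 i, i \notin H & 1 <= lam i * (2 * u%:R * M).
    apply: contrapT => hn; apply: ni.
    apply: (improve_at_gap (H := H) mu0 hmu sum1).
      apply: contrapT => hH; suff : #|H| = u by move=> h; rewrite -cH h ltnn in qu.
      rewrite /u -cardsT; congr #|pred_of_set _|; apply/setP => i; rewrite inE.
      by apply/negPn/negP => iH; apply: hH; exists i.
    move=> i iH; rewrite ltNge; apply/negP => h; apply: hn.
    by exists i.
  have uM : 0 < 2 * u%:R * M by rewrite !mulr_gt0 // ltr0n.
  have inv_le : (lam i)^-1 <= 2 * u%:R * M.
    by rewrite -[X in X <= _]mul1r ler_pdivrMr // mulrC.
  have e2 : (2 ^ q.+1).-1 = (1 + (2 ^ q).-1 + (2 ^ q).-1)%N.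
    by rewrite expnS; have := expn_gt0 2 q; lia.
  exists (i |: H); split.
  - by rewrite cardsU1 iH cH.
  - rewrite big_setU1 //= -/M e2 !exprD expr1.
    apply: (@le_trans _ _ (C * M * M)); last first.
      rewrite -!mulrA; apply: ler_wpM2l; first lra.
      by apply: ler_pM => //; apply: ltW.
    rewrite ler_pM2r //.
    apply: (@le_trans _ _ (3 * (2 * u%:R * M))); first by rewrite ler_pM2l.
    by rewrite /C natrM; lra.
  - move=> k; rewrite !inE => /predU1P[->|]; last exact: bH.
    rewrite /dirichlet_beta -/C -[X in _ <= X]invrK lef_pV2 ?posrE ?invr_gt0 ?exprn_gt0 //;
      last lra.
    apply: le_trans inv_le _.
    apply: (@le_trans _ _ (C * M)).
      rewrite ler_pM2r // /C natrM ler_pM2r ?ltr0n //; lra.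
    apply: (@le_trans _ _ (C ^+ (2 ^ q).-1.+1)).
      by rewrite exprS ler_wpM2l //; lra.
    rewrite prednK ?expn_gt0 // ler_weXn2l // leq_exp2l //.
    by rewrite -ltnS prednK.
apply: nb => i; apply: bH; have : H == [set: U]%SET.
  by rewrite eqEcard finset.subsetT /= cardsT cH.
by move=> /eqP ->; rewrite inE.
Qed.

Lemma fin_pos_lower lam : (forall i, 0 < lam i) ->
  exists2 e, 0 < e & forall i, e <= lam i.
Proof.
move=> h; have [e e0 he] := exists_pos_small (fun=> 1) h.
by exists e => // i; have := he i; rewrite normr1 mulr1.
Qed.

(** Each unsuccessful round multiplies the lower bound on the entries by 3/2, but entries summing to
    1 cannot exceed 1. [P] will say that the combination is a lattice point. *)
Lemma dirichlet_iterate (P : (U -> R) -> Prop) lam :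
  (forall i, 0 < lam i) -> \sum_i lam i = 1 -> P lam ->
  (forall l (j : nat) (m : U -> int), P l ->
     P (fun i => (1 + j%:R) * l i - (m i)%:~R)) ->
  exists l, [/\ P l, \sum_i l i = 1 & forall i, dirichlet_beta #|U| <= l i].
Proof.
move=> lam0 sum1 Pl hP; apply: contrapT => hn.
have [e e0 he] := fin_pos_lower lam0.
have step t : exists l, [/\ P l, \sum_i l i = 1 & forall i, (3 / 2) ^+ t * e <= l i].
  elim: t => [|t [l [Pt st lt]]].
    by exists lam; split=> // i; rewrite expr0 mul1r.
  have [|h|[j [m [h1 h2]]]] := dirichlet_improve _ lt st.
  - by rewrite mulr_gt0 // exprn_gt0 // divr_gt0.
  - by case: hn; exists l.
  - exists (fun i => (1 + j%:R) * l i - (m i)%:~R); split=> //; first exact: hP.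
    move=> i; apply: le_trans (h1 i); rewrite exprS; lra.
have [i0 _] : exists i : U, True.
  apply: contrapT => hU; have := sum1; rewrite big1.
    by move/eqP; rewrite eq_sym oner_eq0.
  by move=> i _; case: hU; exists i.
have bern t : 1 + t%:R / 2 <= (3 / 2 : R) ^+ t.
  elim: t => [|t IH]; first by rewrite expr0; lra.
  rewrite exprS -natr1; have := ler0n R t; nra.
pose t := Num.bound (2 / e); have [l [_ sl hl]] := step t.
have : l i0 <= 1.
  rewrite -sl (bigD1 i0) //= lerDl sumr_ge0 // => i _.
  by apply: le_trans (hl i); rewrite mulr_ge0 ?exprn_ge0 ?divr_ge0 // ltW.
apply/negP; rewrite -ltNge; apply: lt_le_trans (hl i0).
have ht : 2 / e < t%:R by apply: archi_boundP; rewrite divr_ge0 // ltW.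
rewrite -ltr_pdivrMr // mul1r; apply: lt_le_trans (bern t).
have -> : e^-1 = (2 / e) / 2 by field; rewrite gt_eqF.
lra.
Qed.

End Dirichlet.

(** * Sparse positive representations *)

Section Marginals.
Variables (R : comPzRingType) (A B : finType) (p : A -> B -> R).
Hypothesis p1 : forall x, \sum_b p x b = 1.

(** Expectation under a product of probability vectors: a function of one factor sees only its
    marginal. *)
Lemma sum_product_marginal x0 (h : B -> R) :
  \sum_(s : {ffun A -> B}) (\prod_x p x (s x)) * h (s x0) = \sum_b p x0 b * h b.
Proof.
pose p' x b := p x b * (if x == x0 then h b else 1).
transitivity (\sum_(s : {ffun A -> B}) \prod_x p' x (s x)).
  apply: eq_bigr => s _; rewrite /p' big_split /=; congr (_ * _).
  by rewrite (bigD1 x0) //= eqxx big1 ?mulr1 // => x /negPf ->.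
rewrite -bigA_distr_bigA (bigD1 x0) //= [X in _ * X]big1 ?mulr1.
  by apply: eq_bigr => b _; rewrite /p' eqxx.
move=> x /negPf xx0; rewrite -(p1 x); apply: eq_bigr => b _.
by rewrite /p' xx0 mulr1.
Qed.

End Marginals.

Section Reduced.
Variables (R : realFieldType) (D : nat) (I : finType) (y : I -> 'rV[R]_D).

(** A rank factorization: [exists_max_volume] and [caratheodory_basis] require a spanning family, so
    the vectors are rewritten in coordinates of their own span. *)
Lemma reduced_family m (N : 'M[R]_(m, D)) : (forall i, (y i <= N)%MS) ->
  exists (r : nat) (y' : I -> 'rV[R]_r) (M : 'M[R]_(r, D)),
    [/\ (r <= m)%N, spans y' & forall i, y i = y' i *m M].
Proof.
move=> yN; pose Y : 'M[R]_(#|I|, D) := \matrix_k y (enum_val k).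
exists (\rank Y), (fun i => row (enum_rank i) (col_base Y)), (row_base Y); split.
- apply: leq_trans (rank_leq_row N); apply: mxrankS.
  by apply/row_subP => k; rewrite rowK.
- move=> x; have : (x <= col_base Y)%MS by rewrite submx_full // col_base_full.
  case/submxP => c ->; exists (fun i => c 0 (enum_rank i)).
  rewrite mulmx_sum_row /comb (reindex enum_rank) //.
  by apply: onW_bij; apply: enum_rank_bij.
- by move=> i; rewrite -row_mul mulmx_base rowK enum_rankK.
Qed.

Lemma comb_mulmx r (y' : I -> 'rV[R]_r) (M : 'M[R]_(r, D)) l :
  (forall i, y i = y' i *m M) -> comb y l = comb y' l *m M.
Proof.
move=> yM; rewrite /comb mulmx_suml; apply: eq_bigr => i _.
by rewrite yM scalemxAl.
Qed.

(* Caratheodory is applied to x minus a small multiple of the sum of a basis of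
   maximal volume. *)
Lemma spread_representation m (N : 'M[R]_(m, D)) x :
  (forall i, (y i <= N)%MS) -> (forall v, cone y v -> absorbs y x (- v)) ->
  exists (r : nat) (g : 'I_r -> I) (T : finType) (t : T -> I)
         (l1 : 'I_r -> R) (l2 : T -> R),
    [/\ (r <= m)%N, (#|T| <= r)%N,
        (forall j, 0 < l1 j) /\ (forall k, 0 < l2 k),
        x = \sum_j l1 j *: y (g j) + \sum_k l2 k *: y (t k) &
        forall i, exists2 c : 'I_r -> R, (forall j, `|c j| <= 1) &
          y i = \sum_j c j *: y (g j)].
Proof.
move=> yN xint; have [r [y' [M [rm sp yM]]]] := reduced_family yN.
have [g ug hg] := exists_max_volume sp.
have coefs i : exists2 c : 'I_r -> R, (forall j, `|c j| <= 1) &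
    y i = \sum_j c j *: y (g j).
  exists (fun j => (y' i *m invmx (rowsof y' g)) 0 j) => //.
  rewrite yM -{1}(mulmxKV ug (y' i)) [X in X *m M]mulmx_sum_row mulmx_suml.
  by apply: eq_bigr => j _; rewrite rowK -scalemxAl -yM.
have [e e0 [k k0 hk]] := xint (\sum_j y (g j))
  ltac:(apply: cone_sum => j _; apply: cone_gen).
have [S bS cS] : exists2 S, basis y' S & forall i, 0 <= coord y' S (comb y' k) i.
  by apply: caratheodory_basis => //; exists k.
have e1 : comb y k = comb y (coord y' S (comb y' k)).
  by rewrite !(comb_mulmx _ yM) comb_coord.
set c := coord y' S _ in cS e1.
(* Zero coefficients are discarded, since the approximation argument starts from strictly positive
   weights. *)
pose T := {i : I | (i \in S) && (0 < c i)}.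
exists r, (fun j => g j), T, (fun k : T => val k), (fun=> e), (fun k => c (val k)).
split=> //.
- rewrite card_sig -(basis_card bS); apply: subset_leq_card.
  by apply/fintype.subsetP => i; rewrite inE => /andP[].
- by split=> // -[i /= /andP[]].
- rewrite -scaler_sumr; apply: (addrI (- (e *: \sum_j y (g j)))).
  rewrite addKr addrC -scalerN hk e1 /comb.
  rewrite -(@big_sub _ _ _ _ [pred i | (i \in S) && (0 < c i)] (fun i => c i *: y i)).
  rewrite [RHS]big_mkcond; apply: eq_bigr => i _; rewrite inE.
  have [iS|iS] := boolP (i \in S); last by rewrite /c coord_notin // scale0r.
  rewrite /= lt_def cS andbT; case: eqP => //= ->.
  by rewrite scale0r.
Qed.

End Reduced.

(** * Counting box points *)

Lemma sum_option (V : nmodType) (T : finType) (F : option T -> V) :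
  \sum_B F B = F None + \sum_x F (Some x).
Proof.
rewrite (bigD1 None) //=; congr (_ + _).
rewrite (reindex_omap Some id) => [|[x|]] //=.
by apply: eq_bigl => x; rewrite eqxx.
Qed.

(** A multiset of size at most e is written into e slots, [None] marking an empty slot; this caps
    the number of mass vectors at (|T| + 1)^e. *)
Lemma exists_code (T : finType) (m : T -> nat) (e : nat) : (\sum_x m x <= e)%N ->
  exists code : {ffun 'I_e -> option T},
    forall x, (\sum_(i < e) (code i == Some x) = m x)%N.
Proof.
elim: e m => [|e IH] m hm.
  exists [ffun=> None] => x; rewrite big_ord0; move: hm.
  by rewrite leqn0 sum_nat_eq0 => /forallP/(_ x) /= /eqP.
have ext o (code : {ffun 'I_e -> option T}) : exists code' : {ffun 'I_e.+1 -> option T},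
    forall x, (\sum_(i < e.+1) (code' i == Some x) =
               (o == Some x) + \sum_(i < e) (code i == Some x))%N.
  exists [ffun i => if unlift ord0 i is Some i' then code i' else o] => x.
  rewrite big_ord_recl ffunE unlift_none; congr (_ + _)%N.
  by apply: eq_bigr => i _; rewrite ffunE liftK.
have [hle|hgt] := leqP (\sum_x m x) e.
  have [code hc] := IH m hle; have [code' hc'] := ext None code.
  by exists code' => x; rewrite hc' hc.
have [x0' hx0'] : exists x, (0 < m x)%N.
  apply/existsP; apply: contraLR hgt; rewrite negb_exists => /forallP h.
  rewrite -leqNgt big1 // => x _; by apply/eqP; rewrite -leqn0 leqNgt; apply: h.
pose m' x := (m x - (x == x0'))%N.
have [|code hc] := IH m'.
  have : (\sum_x m x = \sum_x (m' x + (x == x0')))%N.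
    apply: eq_bigr => x _; rewrite /m'; case: eqP => [->|_]; first by rewrite subnK.
    by rewrite subn0 addn0.
  rewrite big_split /= [X in (_ + X)%N](bigD1 x0') //= eqxx [X in (_ + (_ + X))%N]big1.
    by move: hm; lia.
  by move=> x /negPf ->.
have [code' hc'] := ext (Some x0') code.
exists code' => x; rewrite hc' hc (inj_eq Some_inj) eq_sym /m'.
by case: eqP => [->|_]; [rewrite subnKC|rewrite subn0].
Qed.

(** * The Cayley structure and its slices *)

Section Blocks.
Variables (R : realType) (n : nat) (I : finType) (a : I -> 'rV[R]_n.+1).
Hypothesis (ht_gen : forall i, ht (a i) = 1) (sp : spans a).
Hypothesis lat_gen : forall i, lattice_point (a i).
Local Notation D := n.+1.
Local Notation vec := 'rV[R]_D.
Variable f : {ffun 'I_D -> I}.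
Hypothesis uf : rowsof a f \in unitmx.
Variable J : {set 'I_D}.
Hypothesis co_le1 : forall i j, `|co a f (a i) j| <= 1.
Hypothesis nonintJ : nonint a f \subset J.
Hypothesis axialJ : forall i, axial a f J i.
Local Notation co := (co a f).
Local Notation block := (option 'I_D).
Implicit Types (x z w : vec) (B : block) (i : I).

Definition blk i : block := [pick j | (j \notin J) && (co (a i) j != 0)].

Lemma coJ_int z j : lattice_point z -> j \notin J -> co z j \is a Num.int.
Proof. by move=> lz jJ; apply: co_int => //; apply: contra jJ; apply/fintype.subsetP. Qed.

(** Outside [J] a nonzero coordinate of a generator is a positive integer of absolute value at most
    1. *)
Lemma co_blk i j : j \notin J -> co (a i) j = (blk i == Some j)%:R.
Proof.
move=> jJ; rewrite /blk; case: pickP => [j' /andP[j'J nz]|h]; last first.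
  by have := h j; rewrite jJ /=; case: eqP.
rewrite (inj_eq Some_inj); have [z0|[j0 [j0J pos0 z0]]] := axialJ i.
  by rewrite z0 ?eqxx in nz.
have j'0 : j' = j0 by apply/eqP; apply: contraNT nz => h; rewrite z0.
have [jj|jj] := eqVneq j' j; last by rewrite z0 // -j'0 eq_sym.
rewrite -jj j'0; have [m hm] := intrP (coJ_int (lat_gen i) j0J).
have := co_le1 i j0; rewrite (ger0_norm (ltW pos0)) hm lerz1.
move: pos0; rewrite hm ltr0z => m0 m1.
by have -> : m = 1 by lia.
Qed.

Lemma blk_notin i j : blk i = Some j -> j \notin J.
Proof. by rewrite /blk; case: pickP => // j' /andP[jJ _] [<-]. Qed.

(** Block [None] gathers the generators vanishing outside [J] and receives the remaining height;
    [Some j] with [j] in [J] is a dummy block of mass 0. Thus the masses add up to [ht]. *)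
Definition mass B z : R :=
  match B with
  | Some j => if j \in J then 0 else co z j
  | None => ht z - \sum_(j | j \notin J) co z j
  end.

Lemma massD B x z : mass B (x + z) = mass B x + mass B z.
Proof.
case: B => [j|] /=; first by case: ifP; rewrite ?addr0 ?coD.
by rewrite htD; under eq_bigr do rewrite coD; rewrite big_split /=; ring.
Qed.

Lemma massZ B c z : mass B (c *: z) = c * mass B z.
Proof.
case: B => [j|] /=; first by case: ifP; rewrite ?mulr0 ?coZ.
by rewrite htZ; under eq_bigr do rewrite coZ; rewrite -mulr_sumr; ring.
Qed.

Lemma mass_big B (T : Type) (r : seq T) (P : pred T) (F : T -> vec) :
  mass B (\sum_(k <- r | P k) F k) = \sum_(k <- r | P k) mass B (F k).
Proof.
elim/big_rec2: _ => [|k u z _ <-]; last by rewrite massD.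
by rewrite -(scale0r 0) massZ mul0r.
Qed.

Lemma mass_gen B i : mass B (a i) = (blk i == B)%:R.
Proof.
case: B => [j|] /=.
  case: ifPn => [jJ|jJ]; last exact: co_blk.
  by case: eqP => // /blk_notin; rewrite jJ.
under eq_bigr => j jJ do rewrite co_blk //.
rewrite ht_gen; case e: (blk i) => [j0|] /=.
  have j0J := blk_notin e; rewrite (bigD1 j0) //= eqxx big1 ?addr0 ?subrr //.
  by move=> j /andP[_ jj]; rewrite (inj_eq Some_inj) eq_sym (negPf jj).
by rewrite big1 ?subr0.
Qed.

Lemma mass_comb B l : mass B (comb a l) = \sum_(i | blk i == B) l i.
Proof.
rewrite mass_big [RHS]big_mkcond; apply: eq_bigr => i _.
by rewrite massZ mass_gen; case: eqP; rewrite ?mulr1 ?mulr0.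
Qed.

Lemma sum_mass z : \sum_B mass B z = ht z.
Proof.
rewrite sum_option /= addrC [X in X + _](bigID (mem J)) /= big1 ?add0r.
  rewrite (eq_bigr (fun j => co z j)) => [|j /negPf -> //].
  by rewrite addrC subrK.
by move=> j ->.
Qed.

Lemma mass_int B z : lattice_point z -> mass B z \is a Num.int.
Proof.
move=> lz; case: B => [j|] /=; first by case: ifPn => // jJ; apply: coJ_int.
by rewrite rpredB ?ht_int // rpred_sum // => j jJ; apply: coJ_int.
Qed.

Lemma mass_ge0 B z : cone a z -> 0 <= mass B z.
Proof. by case=> l l0 ->; rewrite mass_comb sumr_ge0. Qed.

Lemma mass_icone_gt0 B z i : icone a z -> blk i = B -> 0 < mass B z.
Proof.
case=> l l0 -> iB; rewrite mass_comb (bigD1 i) ?iB ?eqxx //=.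
by rewrite ltr_wpDr // sumr_ge0 // => k _; apply: ltW.
Qed.

Variables (d k : nat) (x0 : vec).
Local Notation c0 := (D%:Z - d%:Z).
Hypothesis int_le : (cnt (interior_points a c0) <= k)%N.
Hypothesis x0_int : interior_points a c0 x0.

Let lx0 : lattice_point x0. Proof. by case: x0_int. Qed.
Let ix0 : icone a x0. Proof. by case: x0_int. Qed.

Definition weight B : R := mass B x0.

Lemma weight_ge1 i : 1 <= weight (blk i).
Proof.
have p := mass_icone_gt0 ix0 (erefl (blk i)).
have [m hm] := intrP (mass_int (blk i) lx0).
by move: p; rewrite /weight hm ltr0z ler1z gtz0_ge1.
Qed.

Lemma weight_empty B : (forall i, blk i != B) -> weight B = 0.
Proof.
by move=> h; have [l _ e] := ix0; rewrite /weight e mass_comb big1 // => i; rewrite (negPf (h i)).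
Qed.

Definition rep B : I := odflt (f ord0) [pick i | blk i == B].

Lemma blk_rep i : blk (rep (blk i)) = blk i.
Proof. by rewrite /rep; case: pickP => [i' /eqP //|/(_ i)]; rewrite eqxx. Qed.

(** Corrects a choice outside the block, so that [pt] is total on functions. In an empty block the
    value is arbitrary, and harmless since its weight is 0. *)
Definition into B i : I := if blk i == B then i else rep B.

Lemma blk_into i' i : blk (into (blk i') i) = blk i'.
Proof. by rewrite /into; case: eqP => // _; apply: blk_rep. Qed.

(* Lattice points of the slice of the cone with the same block masses as x0:
   one vertex is selected in each block. *)
Definition pt (s : {ffun block -> I}) : vec :=
  \sum_B weight B *: a (into B (s B)).

Lemma weight_int B : weight B \is a Num.int.
Proof. exact: mass_int. Qed.

Lemma weight_ge0 B : 0 <= weight B.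
Proof. by apply: mass_ge0; apply: icone_cone. Qed.

Lemma lat_pt s : lattice_point (pt s).
Proof. by apply: lat_sum => B _; apply: latZ => //; apply: weight_int. Qed.

Lemma cone_pt s : cone a (pt s).
Proof.
apply: cone_sum => B _; apply: coneZ; first exact: weight_ge0.
exact: cone_gen.
Qed.

Lemma mass_pt B s : mass B (pt s) = weight B.
Proof.
rewrite mass_big (bigD1 B) //= massZ mass_gen.
have [i iB|h] := pickP (fun i => blk i == B); last first.
  have w0 B' : B' = B -> weight B' = 0.
    by move=> ->; apply: weight_empty => i; rewrite h.
  rewrite w0 // mul0r add0r big1 // => B' BB.
  by rewrite massZ mass_gen h mulr0.
rewrite -(eqP iB) blk_into eqxx mulr1 big1 ?addr0 // => B' BB.
rewrite massZ mass_gen.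
have [i' iB'|h] := pickP (fun i => blk i == B'); last first.
  by rewrite weight_empty ?mul0r // => i'; rewrite h.
by rewrite -(eqP iB') blk_into (eqP iB') (negPf BB) mulr0.
Qed.

Lemma ht_pt s : ht (pt s) = ht x0.
Proof. by rewrite -!sum_mass; apply: eq_bigr => B _; rewrite mass_pt. Qed.

(** Normalizing the coefficients of [z] inside each block gives a probability vector per block. The
    product distribution on selections has expectation [z / t] when t > 0. *)
Lemma cone_pt_of_mass t z : 0 <= t -> cone a z ->
  (forall B, mass B z = t * weight B) -> cone pt z.
Proof.
move=> t0 [l l0 zl] hz.
have blksum B : \sum_(i | blk i == B) l i = t * weight B by rewrite -hz zl mass_comb.
move: t0; rewrite le_eqVlt => /predU1P[t0|t0].
  rewrite zl (_ : comb a l = 0); first exact: cone0.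
  rewrite /comb big1 // => i _; have := blksum (blk i); rewrite -t0 mul0r.
  by move/(psumr_eq0P (fun i _ => l0 i)) => ->; rewrite ?scale0r.
(* A block of weight 0 gets a point mass, only to make its probabilities sum to 1. *)
pose p B i := if weight B == 0 then (i == f ord0)%:R
              else (blk i == B)%:R * l i / (t * weight B).
have p0 B i : 0 <= p B i.
  rewrite /p; case: ifP => _; first exact: ler0n.
  by rewrite divr_ge0 ?mulr_ge0 ?ler0n ?weight_ge0 // ltW.
have p1 B : \sum_i p B i = 1.
  rewrite /p; case: eqP => [_|/eqP w0].
    by rewrite (bigD1 (f ord0)) //= eqxx big1 ?addr0 // => i /negPf ->.
  rewrite -mulr_suml (_ : \sum_i _ = t * weight B) ?divff ?mulf_neq0 ?(gt_eqF t0) //.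
  rewrite -blksum [RHS]big_mkcond; apply: eq_bigr => i _.
  by case: eqP; rewrite ?mul1r ?mul0r.
exists (fun s : {ffun block -> I} => t * \prod_B p B (s B)).
  by move=> s; rewrite mulr_ge0 ?(ltW t0) // prodr_ge0.
have -> : comb pt (fun s : {ffun block -> I} => t * \prod_B p B (s B)) =
    \sum_B (t * weight B) *: \sum_i p B i *: a (into B i).
  rewrite /comb; under eq_bigr => s _ do rewrite /pt scaler_sumr.
  rewrite exchange_big; apply: eq_bigr => B _ /=.
  apply/rowP => m; rewrite summxE !mxE summxE.
  under [X in _ = _ * X]eq_bigr => i _ do rewrite mxE.
  rewrite -(sum_product_marginal p1 B (fun i => a (into B i) 0 m)) mulr_sumr.
  by apply: eq_bigr => s _; rewrite !mxE; ring.
rewrite zl /comb (partition_big blk predT) //=; apply: eq_bigr => B _.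
have [w0|w0] := eqVneq (weight B) 0.
  rewrite w0 mulr0 scale0r big1 // => i /eqP iB.
  by have := weight_ge1 i; rewrite iB w0 ler10.
rewrite scaler_sumr big_mkcond; apply: eq_bigr => i _.
rewrite /p (negPf w0) /into; case: ifP => _.
  rewrite mul1r scalerA; congr (_ *: _).
  by rewrite mulrC divfK // mulf_neq0 ?(gt_eqF t0).
by rewrite mul0r mul0r scale0r scaler0.
Qed.

Lemma pt_relint v : cone pt v -> absorbs pt x0 (- v).
Proof.
move=> [l l0 vl].
have hv B : mass B v = (\sum_s l s) * weight B.
  rewrite vl mass_big mulr_suml; apply: eq_bigr => s _.
  by rewrite massZ mass_pt.
have cv : cone a v.
  by rewrite vl; apply: cone_sum => s _; apply: coneZ => //; apply: cone_pt.
set t := \sum_s l s in hv.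
have t0 : 0 <= t by apply: sumr_ge0.
have [e e0 he] := icone_absorbs (- v) sp ix0.
(* This step size leaves the masses scaled by 1/(1 + e t), which is nonnegative, and writes the new
   point as a convex combination of [x0 - e v] and [x0]. *)
exists (e / (1 + e * t)).
  by rewrite divr_gt0 // ltr_wpDr // mulr_ge0 // ltW.
have et : 0 <= e * t by rewrite mulr_ge0 // ltW.
have et1 : 0 < 1 + e * t by lra.
apply: (@cone_pt_of_mass (1 - e / (1 + e * t) * t)).
- by rewrite subr_ge0 -mulrA [_^-1 * _]mulrC mulrA ler_pdivrMr // mul1r lerDr.
- have c1 : 0 <= (1 + e * t)^-1 by rewrite invr_ge0 ltW.
  have c2 : 0 <= e * t / (1 + e * t) by rewrite divr_ge0 // ltW.
  have := coneD (coneZ c1 he) (coneZ c2 (icone_cone ix0)).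
  by congr cone; apply/rowP => i; rewrite !mxE; field; rewrite gt_eqF.
- by move=> B; rewrite massD massZ -scaleN1r massZ hv -/(weight B); ring.
Qed.

Let s0 : {ffun block -> I} := [ffun=> f ord0].

(** All [pt s] share their coordinates outside [J], so they differ by combinations of the |J|
    vectors [a (f j)] with [j] in [J]. *)
Lemma pt_span s : (pt s <= \matrix_(m < #|J|.+1)
   (if unlift ord0 m is Some m' then a (f (enum_val m'))
    else pt s0))%MS.
Proof.
set N := \matrix_m _.
have -> : pt s = pt s0 + \sum_(j in J) (co (pt s) j - co (pt s0) j) *: a (f j).
  rewrite {1}[pt s](co_sum uf) {1}[pt s0](co_sum uf).
  rewrite (bigID (mem J)) [in RHS](bigID (mem J)) /= addrAC -big_split /=.
  congr (_ + _); first by apply: eq_bigr => j _; rewrite -scalerDl addrC subrK.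
  apply: eq_bigr => j jJ; congr (_ *: _).
  by have := mass_pt (Some j) s; rewrite -(mass_pt (Some j) s0) /= (negPf jJ).
apply: addmx_sub.
  have -> : pt s0 = row ord0 N by rewrite rowK unlift_none.
  exact: row_sub.
apply: summx_sub => j jJ; apply: scalemx_sub.
have -> : a (f j) = row (lift ord0 (enum_rank_in jJ j)) N.
  by rewrite rowK liftK enum_rankK_in.
exact: row_sub.
Qed.

Local Notation u0 := (2 * #|J|.+1)%N.
Local Notation beta := (dirichlet_beta R u0).

Lemma beta_gt0 : 0 < beta.
Proof. by rewrite /dirichlet_beta invr_gt0 exprn_gt0 // ltr0n. Qed.

Lemma beta_le (u : nat) : (0 < u <= u0)%N -> beta <= dirichlet_beta R u.
Proof.
case/andP=> u1 uu; rewrite /dirichlet_beta lef_pV2 ?posrE ?exprn_gt0 ?ltr0n ?muln_gt0 //.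
apply: (@le_trans _ _ ((6 * u0)%:R ^+ (2 ^ u.-1))).
  by rewrite lerXn2r ?nnegrE ?ler0n // ler_nat leq_mul2l uu orbT.
rewrite ler_weXn2l ?ler1n // leq_exp2l //; move: u1 uu; lia.
Qed.

(** Run the Dirichlet iteration on the sparse weights of [x0]; replacing [l] by [(1 + j) l - m]
    keeps lattice points, and total 1 keeps the height. Afterwards every weight is at least [beta],
    so changing those of the volume basis by less keeps all of them positive. *)
Lemma exists_good_point : exists (r : nat) (g : 'I_r -> {ffun block -> I}) (x1 : vec),
  [/\ (r <= #|J|.+1)%N,
      forall s, exists2 c : 'I_r -> R, (forall j, `|c j| <= 1) &
         pt s = \sum_j c j *: pt (g j) &
      forall v, lattice_point v -> ht v = 0 ->
        (exists2 c : 'I_r -> R, (forall j, `|c j| < beta) &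
           v = \sum_j c j *: pt (g j)) ->
        interior_points a c0 (x1 + v)].
Proof.
have [r [g [T [t [l1 [l2 [rJ Tr [l1p l2p] x0e coefs]]]]]]] :=
  spread_representation pt_span pt_relint.
pose U := ('I_r + T)%type.
pose y (u : U) := match u with inl j => pt (g j) | inr m => pt (t m) end.
pose lam (u : U) := match u with inl j => l1 j | inr m => l2 m end.
have lam0 u : 0 < lam u by case: u.
have x0lam : x0 = comb y lam by rewrite /comb big_sumType.
have hc : 0 < ht x0.
  have [l lp ->] := ix0; rewrite (ht_comb ht_gen) (bigD1 (f ord0)) //= ltr_wpDr //.
  by rewrite sumr_ge0 // => i _; apply: ltW.
have ht_y u : ht (y u) = ht x0 by case: u => ?; rewrite /= ht_pt.
have ht_comb_y l : ht (comb y l) = (\sum_u l u) * ht x0.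
  by rewrite ht_sum mulr_suml; apply: eq_bigr => u _; rewrite htZ ht_y.
have sum_lam : \sum_u lam u = 1.
  by apply: (mulIf (lt0r_neq0 hc)); rewrite mul1r -ht_comb_y -x0lam.
have lat_y u : lattice_point (y u) by case: u => ?; apply: lat_pt.
have [||l [ll sl bl]] := dirichlet_iterate (P := fun l => lattice_point (comb y l))
    lam0 sum_lam.
- by rewrite -x0lam.
- move=> l j m hl.
  have -> : comb y (fun u => (1 + j%:R) * l u - (m u)%:~R) =
      (1 + j%:R) *: comb y l - \sum_u (m u)%:~R *: y u.
    by rewrite -/(comb y (fun u => (m u)%:~R)) combZ combN combD.
  apply: latB; first by apply: latZ => //; rewrite rpredD ?rpred1 // rpred_nat.
  by apply: lat_sum => u _; apply: latZ => //; apply: rpred_int.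
have cU : (#|{: U}| <= u0)%N.
  by rewrite card_sum card_ord; move: rJ Tr; lia.
have lb u : beta <= l u.
  apply: le_trans (bl u); apply: beta_le; rewrite cU andbT.
  by apply/card_gt0P; exists u.
exists r, g, (comb y l); split=> // v lv hv [c cb ve].
pose l' (u : U) := l u + match u with inl j => c j | inr _ => 0 end.
have l'0 u : 0 < l' u.
  have := lb u; rewrite /l'; case: u => [j|m] h; last first.
    by rewrite addr0; apply: lt_le_trans beta_gt0 h.
  by have := cb j; rewrite ltr_norml; lra.
have xv : comb y l + v = comb y l'.
  rewrite -combD; congr (_ + _).
  rewrite ve /comb big_sumType /= [X in _ = _ + X]big1 ?addr0 // => m _.
  by rewrite scale0r.
rewrite xv; split.
- by rewrite -xv; apply: latD.
(* Positive weights dominate a small multiple of [lam], so the point is a multiple of the interior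
   point [x0] plus a cone point. *)
- have [e e0 he] := exists_pos_small lam l'0.
  have -> : comb y l' = e *: x0 + comb y (fun u => l' u - e * lam u).
    rewrite x0lam combZ combD; apply: eq_bigr => u _.
    by congr (_ *: _); ring.
  apply: iconeD; first exact: iconeZ.
  apply: cone_sum => u _; apply: coneZ; last by case: u => ?; apply: cone_pt.
  by have := he u; rewrite ger0_norm ?subr_ge0 // ltW.
- by rewrite -xv htD ht_comb_y sl mul1r hv addr0; case: x0_int.
Qed.

Definition invbeta : nat := ((6 * u0) ^ (2 ^ u0.-1))%N.

Lemma betaE : beta = invbeta%:R^-1.
Proof. by rewrite /dirichlet_beta /invbeta natrX. Qed.

(* Two lattice points in the same small cell differ by a vector that maps the
   good point to another interior point, so each cell contains at most k. *)
Lemma cell_bound : exists (r : nat) (g : 'I_r -> {ffun block -> I}),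
  [/\ (r <= #|J|.+1)%N,
      forall s, exists2 c : 'I_r -> R, (forall j, `|c j| <= 1) &
         pt s = \sum_j c j *: pt (g j) &
    forall (F : finType) (key : vec -> F) (off : F -> vec) (A : nat) (Z : set vec),
      finite_set Z -> (forall z, Z z -> lattice_point z) ->
      (forall z z', Z z -> Z z' -> key z = key z' -> ht z = ht z') ->
      (forall z, Z z -> exists2 c : 'I_r -> R, (forall j, `|c j| <= A%:R) &
          z - off (key z) = \sum_j c j *: pt (g j)) ->
      (cnt Z <= #|F| * (2 * A * invbeta).+1 ^ r * k)%N].
Proof.
have [r [g [x1 [rJ coefs good]]]] := exists_good_point.
exists r, g; split=> // F key off A Z fZ lZ hZ cZ.
have /choice[c hc] : forall z, exists c : 'I_r -> R, Z z ->
    (forall j, `|c j| <= A%:R) /\ z - off (key z) = \sum_j c j *: pt (g j).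
  move=> z; have [/cZ[c c1 c2]|nZ] := pselect (Z z); first by exists c.
  by exists (fun=> 0).
pose G := (2 * A * invbeta)%N.
have ib0 : 0 < invbeta%:R :> R by rewrite -invr_gt0 -betaE beta_gt0.
(* Coefficients in [-A, A], shifted by A and divided by [beta], have integer part between 0 and 2 A
   [invbeta]. *)
pose cell z j := Num.truncn ((c z j + A%:R) * invbeta%:R).
have cell_arg z j : Z z -> 0 <= (c z j + A%:R) * invbeta%:R <= G%:R.
  move=> Zz; have [/(_ j) + _] := hc z Zz; rewrite ler_norml => /andP[h1 h2].
  rewrite mulr_ge0 /=; [|lra|exact: ltW].
  by rewrite /G natrM ler_pM2r // natrM; lra.
pose K : vec -> F * {ffun 'I_r -> 'I_G.+1} :=
  fun z => (key z, [ffun j => inord (cell z j)]).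
have -> : (#|F| * G.+1 ^ r)%N = #|{: F * {ffun 'I_r -> 'I_G.+1}}|.
  by rewrite card_prod card_ffun !card_ord.
apply: (@cnt_fibre _ _ K) => // z Zz.
apply: leq_trans int_le.
apply: (@cnt_inj _ _ (fun z' => x1 + (z' - z))).
- by apply: sub_finite_set fZ => z' [].
- exact: finite_interior.
- move=> z' [Zz' [kk cc]].
  apply: good; first by apply: latB; apply: lZ.
    by rewrite htB (hZ _ _ Zz' Zz kk) subrr.
  exists (fun j => c z' j - c z j) => [j|].
    have /(congr1 val) := congr1 (fun h : {ffun 'I_r -> 'I_G.+1} => h j) cc.
    have [a1 a2] := andP (cell_arg z j Zz); have [b1 b2] := andP (cell_arg z' j Zz').
    have cl w : 0 <= (c w j + A%:R) * invbeta%:R <= G%:R -> (cell w j < G.+1)%N.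
      case/andP=> w1 w2; rewrite ltnS -(ler_nat R); apply: le_trans w2.
      by rewrite /cell truncn_le.
    rewrite !ffunE /= !inordK ?(cl _ (cell_arg z j Zz)) ?(cl _ (cell_arg z' j Zz')) // => ce.
    have := truncn_itv a1; have := truncn_itv b1.
    rewrite -/(cell z j) -/(cell z' j) ce -!natr1 => /andP[h1 h2] /andP[h3 h4].
    rewrite betaE -[_^-1]mul1r ltr_pdivlMr // -[X in _ * X](gtr0_norm ib0) -normrM.
    by rewrite ltr_norml; apply/andP; split; lra.
  have [_ e'] := hc z' Zz'; have [_ e] := hc z Zz.
  under eq_bigr do rewrite scalerBl.
  by rewrite sumrB -e -e' kk opprB addrA subrK.
- by move=> z1 z2 _ _ /addrI/addIr.
Qed.

Definition nontrivial : {set 'I_D} :=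
  [set j | [exists i, exists i', [&& blk i == Some j, blk i' == Some j & a i != a i']]].

Lemma weight_Some_gt0 j : j \in nontrivial -> 0 < weight (Some j).
Proof.
rewrite inE => /existsP[i /existsP[i' /and3P[/eqP <- _ _]]].
by apply: lt_le_trans (weight_ge1 i).
Qed.

(** A generic linear functional orders a pair of distinct generators in each nontrivial block.
    Switching the blocks one after another from the lower to the higher choice yields a strictly
    increasing chain of slice points, all with coefficients at most 1. *)
Lemma card_nontrivial : exists (r : nat), (r <= #|J|.+1)%N /\
  (#|nontrivial|.+1 <= (2 * invbeta).+1 ^ r * k)%N.
Proof.
have [r [g [rJ coefs cb]]] := cell_bound; exists r; split=> //.
have hpair j : exists p : I * I, j \in nontrivial ->
    [/\ blk p.1 = Some j, blk p.2 = Some j & a p.1 != a p.2].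
  have [|jn] := boolP (j \in nontrivial); last by exists (f ord0, f ord0).
  rewrite inE => /existsP[i /existsP[i' /and3P[/eqP h1 /eqP h2 h3]]].
  by exists (i, i').
have [p hp] := choice hpair.
have [|w w0 hw] := @generic_weights R 'I_D 'I_D (mem nontrivial)
    (fun j m => (a (p j).1 - a (p j).2) 0 m).
  move=> j /hp[_ _]; rewrite -subr_eq0 => h; apply/existsP.
  apply: contraNT h; rewrite negb_exists => /forallP h.
  by apply/eqP/rowP => m; rewrite [RHS]mxE; apply/eqP; rewrite -[_ == _]negbK.
pose phi (z : vec) := \sum_m z 0 m * w m.
have phiB x z : phi (x - z) = phi x - phi z.
  by rewrite /phi -sumrB; apply: eq_bigr => m _; rewrite !mxE mulrBl.
have phi_sum (T : finType) (P : pred T) (c : T -> R) (F : T -> vec) :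
    phi (\sum_(t | P t) c t *: F t) = \sum_(t | P t) c t * phi (F t).
  rewrite /phi; under eq_bigr do rewrite summxE mulr_suml.
  rewrite exchange_big; apply: eq_bigr => t _; rewrite mulr_sumr.
  by apply: eq_bigr => m _; rewrite mxE mulrA.
pose hi j := if phi (a (p j).2) < phi (a (p j).1) then (p j).1 else (p j).2.
pose lo j := if phi (a (p j).2) < phi (a (p j).1) then (p j).2 else (p j).1.
have hilo j : j \in nontrivial ->
    [/\ blk (hi j) = Some j, blk (lo j) = Some j & phi (a (lo j)) < phi (a (hi j))].
  move=> jn; have [h1 h2 _] := hp j jn; rewrite /hi /lo; case: ifP => // h.
  by split=> //; rewrite lt_neqAle leNgt h andbT -subr_eq0 -phiB; apply: hw.
pose nt := enum nontrivial.
pose sel (t : nat) : {ffun block -> I} := [ffun B =>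
  if B is Some j then
    if j \in nontrivial then (if (index j nt < t)%N then hi j else lo j) else rep B
  else rep B].
have phi_mono (t t' : nat) : (t < t')%N -> (t' <= #|nontrivial|)%N ->
    phi (pt (sel t)) < phi (pt (sel t')).
  move=> tt tn; have tsz : (t < size nt)%N by rewrite -cardE; apply: leq_trans tn.
  have [j0 _] : exists j : 'I_D, true by exists ord0.
  pose jt := nth j0 nt t.
  have jtn : jt \in nontrivial by rewrite -mem_enum mem_nth.
  have [b1 b2 lt] := hilo jt jtn.
  rewrite -subr_gt0 -phiB /pt -sumrB.
  under eq_bigr do rewrite -scalerBr.
  rewrite phi_sum (bigD1 (Some jt)) //= ltr_wpDr //.
    apply: sumr_ge0 => B _; apply: mulr_ge0; first exact: weight_ge0.
    rewrite phiB subr_ge0 !ffunE; case: B => [j|] //.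
    case: (boolP (j \in nontrivial)) => // jn.
    have [c1 c2 /ltW le] := hilo j jn.
    case: (ltnP (index j nt) t) => h1; first by rewrite (ltn_trans h1 tt).
    by case: ifP => _ //; rewrite /into c1 c2 !eqxx.
  rewrite mulr_gt0 ?weight_Some_gt0 // phiB subr_gt0 !ffunE jtn.
  rewrite index_uniq ?enum_uniq // ltnn tt.
  by rewrite /into b1 b2 !eqxx.
pose Z : set vec := ((fun t : 'I_#|nontrivial|.+1 => pt (sel t)) @` setT)%classic.
have fZ : finite_set Z by apply: finite_image; apply: finite_finset.
have lZ : (#|nontrivial|.+1 <= cnt Z)%N.
  rewrite /Z cnt_image; [|exact: finite_finset|].
    have -> : [set: 'I_#|nontrivial|.+1]%classic =
        [set x | exists2 t, predT t & [set t]%classic x]%classic.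
      by apply/seteqP; split=> // t _; exists t.
    rewrite cnt_big => [||t t' x _ _ -> -> //]; last by move=> t; exact: finite_set1.
    under eq_bigr do rewrite /cnt fset_set1 cardfs1.
    by rewrite sum1_card card_ord.
  move=> t t' _ _ e; apply/val_inj.
  case: (ltngtP t t') => // h.
    by have := phi_mono _ _ h (ltn_ord t'); rewrite e ltxx.
  by have := phi_mono _ _ h (ltn_ord t); rewrite e ltxx.
apply: leq_trans lZ _.
have := cb unit (fun=> tt) (fun=> 0) 1%N Z fZ; rewrite card_unit mul1n muln1.
apply.
- by move=> _ [t _ <-]; apply: lat_pt.
- by move=> _ _ [t _ <-] [t' _ <-] _; rewrite !ht_pt.
- by move=> _ [t _ <-]; rewrite subr0; apply: coefs.
Qed.

(** A basis contains at most one generator of such a block, so the mass is a single coordinate. If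
    there is one, [q] is positive there and [below] is strict: an integer in [0, 1). *)
Lemma box_trivial q z j : icone a q -> box_points a q d z ->
  j \notin J -> j \notin nontrivial -> mass (Some j) z = 0.
Proof.
move=> iq [lz hz [S [bS z0 zb]]] jJ jn.
have bm x : mass (Some j) x = \sum_(i | (blk i == Some j) && (i \in S)) coord a S x i.
  rewrite -{1}(comb_coord x bS) mass_comb (bigID (mem S)) /= [X in _ + X]big1 ?addr0 //.
  by move=> i /andP[_]; apply: coord_notin.
have uniq1 i i' : blk i = Some j -> blk i' = Some j -> i \in S -> i' \in S -> i = i'.
  move=> bi bi' iS iS'.
  have e : a i = a i'.
    apply/eqP; apply: contraNT jn => h; rewrite inE; apply/existsP; exists i.
    by apply/existsP; exists i'; rewrite bi bi' !eqxx.
  have := coord_gen bS iS i; rewrite e coord_gen // eqxx; case: eqP => // _ /eqP.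
  by rewrite eq_sym oner_eq0.
have [i /andP[/eqP bi iS]|h] := pickP (fun i => (blk i == Some j) && (i \in S)); last first.
  by rewrite bm big_pred0.
have one x : mass (Some j) x = coord a S x i.
  rewrite bm (big_pred1 i) // => i'; apply/andP/eqP => [[/eqP bi' iS']|->].
    exact: uniq1.
  by rewrite bi eqxx.
have qpos := mass_icone_gt0 iq bi; rewrite one in qpos.
have := zb i iS; rewrite /below qpos -one => lt1.
have := z0 i; rewrite -one; have [m hm] := intrP (mass_int (Some j) lz).
rewrite hm in lt1 *; rewrite ler0z => m0; move: lt1; rewrite ltrz1 => m1.
by have -> : m = 0 by lia.
Qed.

(** Changing one selection moves [pt] by the block weight times this difference; that weight is at
    least 1, and both points have coefficients at most 1. *)
Lemma gen_sub_rep r (g : 'I_r -> {ffun block -> I}) i :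
  (forall s, exists2 c : 'I_r -> R, (forall j, `|c j| <= 1) &
         pt s = \sum_j c j *: pt (g j)) ->
  exists2 c : 'I_r -> R, (forall j, `|c j| <= 2) &
     a i - a (rep (blk i)) = \sum_j c j *: pt (g j).
Proof.
move=> coefs; pose s1 : {ffun block -> I} := [ffun B => rep B].
pose s : {ffun block -> I} := [ffun B => if B == blk i then i else rep B].
have [c c1 ec] := coefs s; have [c' c1' ec'] := coefs s1.
have W1 := weight_ge1 i; set W := weight (blk i) in W1.
have W0 : 0 < W by lra.
have e : pt s - pt s1 = W *: (a i - a (rep (blk i))).
  rewrite /pt -sumrB (bigD1 (blk i)) //= [X in _ + X]big1 ?addr0.
    by rewrite -scalerBr !ffunE eqxx /into !eqxx blk_rep eqxx.
  by move=> B /negPf BB; rewrite !ffunE BB subrr.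
exists (fun j => W^-1 * (c j - c' j)) => [j|].
  rewrite normrM gtr0_norm ?invr_gt0 // mulrC ler_pdivrMr //.
  have := ler_normB (c j) (c' j); have := c1 j; have := c1' j; lra.
under eq_bigr do rewrite -scalerA scalerBl.
by rewrite -scaler_sumr sumrB -ec -ec' e scalerA mulVf ?scale1r // gt_eqF.
Qed.

Lemma coef_sum_bound (T : finType) r (y : 'I_r -> vec) (v : T -> vec) (l : T -> R) (b : R) :
  (forall t, 0 <= l t) ->
  (forall t, exists2 c : 'I_r -> R, (forall j, `|c j| <= b) & v t = \sum_j c j *: y j) ->
  exists2 c : 'I_r -> R, (forall j, `|c j| <= (\sum_t l t) * b) &
    \sum_t l t *: v t = \sum_j c j *: y j.
Proof.
move=> l0 h.
have /choice[c hc] : forall t, exists c : 'I_r -> R,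
   (forall j, `|c j| <= b) /\ v t = \sum_j c j *: y j.
  by move=> t; have [c c1 c2] := h t; exists c.
exists (fun j => \sum_t l t * c t j) => [j|].
  apply: le_trans (ler_norm_sum _ _ _) _; rewrite mulr_suml; apply: ler_sum => t _.
  by rewrite normrM ger0_norm // ler_wpM2l //; have [] := hc t.
under [RHS]eq_bigr do rewrite scaler_suml.
rewrite exchange_big; apply: eq_bigr => t _; have [_ ->] := hc t.
by rewrite scaler_sumr; apply: eq_bigr => j _; rewrite scalerA.
Qed.

(** A point is keyed by its height and its masses on nontrivial blocks. Subtracting the
    representative with the same masses leaves a combination of the differences of [gen_sub_rep]
    with total weight at most d, hence coefficients at most 2d. *)
Theorem box_points_bound q : icone a q -> (0 < d)%N -> exists r, (r <= #|J|.+1)%N /\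
  (cnt (box_points a q d) <=
   d.+1 * ((2 * invbeta).+1 ^ #|J|.+1 * k) ^ d * (4 * d * invbeta).+1 ^ r * k)%N.
Proof.
move=> iq d0; have [r [g [rJ coefs cb]]] := cell_bound; exists r; split=> //.
have [r' [r'J hnt]] := card_nontrivial.
pose T := {j : 'I_D | j \in nontrivial}.
have cT : #|{: option T}| = #|nontrivial|.+1.
  by rewrite card_option card_sig; congr _.+1; apply: eq_card => j; rewrite !inE.
have sum_sub (m0 : 'I_D -> R) : (forall j, 0 <= m0 j) ->
    \sum_(t : T) m0 (val t) <= \sum_j m0 j.
  move=> m0_ge0; rewrite -(big_sub [pred j | j \in nontrivial] m0).
  by rewrite [X in _ <= X](bigID (mem nontrivial)) /= lerDl sumr_ge0.
(* The masses on nontrivial blocks are naturals with sum at most the height, so d slots suffice. *)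
have hcode z : exists code : {ffun 'I_d -> option T}, box_points a q d z ->
    forall t, (\sum_(i < d) (code i == Some t))%N%:R = mass (Some (val t)) z.
  have [bz|nb] := pselect (box_points a q d z); last by exists [ffun=> None].
  have cz := box_points_cone bz; have [lz hz _] := bz.
  have /choice[m hm] : forall t : T, exists m : nat, mass (Some (val t)) z = m%:R.
    move=> t; have [m em] := intrP (mass_int (Some (val t)) lz).
    have := mass_ge0 (Some (val t)) cz; rewrite em ler0z => m0.
    by exists `|m|%N; rewrite -[RHS]/((`|m|%N%:Z)%:~R) gez0_abs.
  have [|code hc] := @exists_code T m d.
    rewrite -(ler_nat R) natr_sum; apply: le_trans hz.
    under eq_bigr do rewrite -hm.
    rewrite -sum_mass sum_option ler_wpDl ?mass_ge0 //.
    by apply: (sum_sub (fun j => mass (Some j) z)) => j; apply: mass_ge0.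
  by exists code => _ t; rewrite hc hm.
have [cd hcd] := choice hcode.
pose N (code : {ffun 'I_d -> option T}) (j : 'I_D) :=
  (\sum_(i < d) (omap val (code i) == Some j))%N.
have Nmass z j : box_points a q d z -> (N (cd z) j)%:R = mass (Some j) z.
  move=> bz; have [jn|jn] := boolP (j \in nontrivial).
    rewrite -(hcd z bz (exist _ j jn : T)) /N; congr _%:R; apply: eq_bigr => i _.
    by case: (cd z i) => [[j' jn']|] //=; rewrite !(inj_eq Some_inj).
  have -> : mass (Some j) z = 0.
    have [jJ|jJ] := boolP (j \in J); first by rewrite /= jJ.
    exact: box_trivial iq bz jJ jn.
  rewrite /N big1 // => i _; case: (cd z i) => [[j' jn']|] //=.
  by rewrite (inj_eq Some_inj); case: eqP => // jj; rewrite -jj jn' in jn.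
pose key z := (inord (Num.truncn (ht z)) : 'I_d.+1, cd z).
have ht_key z : box_points a q d z -> ((key z).1 : nat)%:R = ht z.
  move=> bz; have [lz hz _] := bz; have h0 := ht_ge0 ht_gen (box_points_cone bz).
  have hn : (Num.truncn (ht z))%:R = ht z.
    by apply/eqP; rewrite -natrEtruncn natrEint h0 andbT; apply: ht_int.
  by rewrite /= inordK // ltnS -(ler_nat R) hn.
pose off (F : 'I_d.+1 * {ffun 'I_d -> option T}) : vec :=
  \sum_j (N F.2 j)%:R *: a (rep (Some j))
  + ((F.1 : nat)%:R - \sum_j (N F.2 j)%:R) *: a (rep None).
have offE z : box_points a q d z -> off (key z) = \sum_B mass B z *: a (rep B).
  move=> bz; rewrite sum_option /off ht_key // addrC; congr (_ + _).
    by apply: eq_bigr => j _; rewrite Nmass.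
  congr (_ *: _); rewrite -sum_mass sum_option.
  under [X in _ - X]eq_bigr => j _ do rewrite Nmass //.
  by rewrite addrK.
have := cb _ key off (2 * d)%N (box_points a q d) (finite_box_points ht_gen q d).
rewrite mulnA => bound.
apply: leq_trans (bound _ _ _) _.
- by move=> z [].
- by move=> z z' bz bz' kk; rewrite -ht_key // -ht_key // kk.
- move=> z bz; have [_ hz _] := bz; have [l l0 zl] := box_points_cone bz.
  have [c cle ce] := coef_sum_bound (v := fun i => a i - a (rep (blk i))) l0
     (fun i => gen_sub_rep i coefs).
  exists c => [j|].
    apply: le_trans (cle j) _; rewrite -(ht_comb ht_gen) -zl mulrC natrM.
    by rewrite ler_pM2l.
  rewrite -ce offE // {1}zl /comb.
  under [RHS]eq_bigr do rewrite scalerBr.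
  rewrite sumrB; congr (_ - _).
  rewrite [RHS](partition_big blk predT) //=; apply: eq_bigr => B _.
  rewrite zl mass_comb scaler_suml; apply: eq_bigr => i /eqP -> //.
- rewrite card_prod card_ffun !card_ord cT !leq_mul2r; apply/orP; right.
  apply/orP; right; rewrite leq_mul2l; apply/orP; right.
  case: (d) d0 => // d' _; rewrite leq_exp2r //; apply: leq_trans hnt _.
  by rewrite leq_mul2r leq_pexp2l ?orbT.
Qed.

End Blocks.

(** * Volumes by cell counting *)

Section Volume.
Local Open Scope classical_set_scope.
Variable R : realType.
Local Notation mu := (@lebesgue_measure R).

(* No measurability is needed: both sides are suprema over simple functions. *)
Lemma integral_mono (F G : R -> \bar R) :
  (forall t, (0 <= F t)%E) -> (forall t, (F t <= G t)%E) ->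
  (\int[mu]_t F t <= \int[mu]_t G t)%E.
Proof.
move=> F0 FG; have G0 t : (0 <= G t)%E by apply: le_trans (FG t).
rewrite !ge0_integralTE //; apply: le_ereal_sup => _ [h hF <-].
exists h => // t.
exact: le_trans (hF t) (FG t).
Qed.

Lemma iter_integral_ge0 n (f : 'rV[R]_n -> \bar R) :
  (forall x, (0 <= f x)%E) -> (0 <= iter_integral f)%E.
Proof.
elim: n f => [|n IH] f f0 /=; first exact: f0.
by apply: integral_ge0 => t _; apply: IH.
Qed.

Definition in_cell n (m : nat) (x : 'rV[R]_n) (z : 'rV[int]_n) : bool :=
  [forall i, Num.floor (m%:R * x ord0 i) == z ord0 i].

Lemma floor_cell (m : nat) (z : int) : (0 < m)%N ->
  [set t : R | Num.floor (m%:R * t) = z] = `[z%:~R / m%:R, (z + 1)%:~R / m%:R[%classic.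
Proof.
move=> m0; have m0' : 0 < m%:R :> R by rewrite ltr0n.
apply/seteqP; split=> t /=; rewrite in_itv /= ler_pdivrMr // ltr_pdivlMr // ![t * _]mulrC.
  by move=> <-; apply: floor_itv.
by move=> h; apply: floor_def.
Qed.

Lemma integral_cells (m : nat) (s : seq int) (c : R) : (0 < m)%N -> 0 <= c ->
  (\int[mu]_t (c * (count (pred1 (Num.floor (m%:R * t))) s)%:R)%:E =
   ((size s)%:R * (c / m%:R))%:E)%E.
Proof.
move=> m0 c0; have m0' : 0 < m%:R :> R by rewrite ltr0n.
elim: s => [|z s IH].
  under eq_integral do rewrite /= mulr0.
  by rewrite integral0 mul0r.
pose X : set R := [set t : R | Num.floor (m%:R * t) = z].
have mX : measurable X by rewrite /X floor_cell //; apply: measurable_itv.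
have muX : mu X = (m%:R^-1)%:E.
  rewrite /X floor_cell // [LHS]lebesgue_measure_itv /= lte_fin.
  rewrite ltr_pM2r ?invr_gt0 // ltr_int ltzD1 lexx -EFinB -mulrBl; congr (_%:E).
  by rewrite rmorphD /= addrAC subrr add0r mul1r.
have intX : (\int[mu]_t (\1_X t)%:E = (m%:R^-1)%:E)%E.
  by rewrite integral_indic // setIT; exact: muX.
have meas (s' : seq int) :
    measurable_fun setT (fun t : R => (c * (count (pred1 (Num.floor (m%:R * t))) s')%:R)%:E).
  apply/measurable_EFinP; elim: s' => [|z' s' IH'].
    by under eq_fun do rewrite /= mulr0; apply: measurable_cst.
  pose X' : set R := [set t : R | Num.floor (m%:R * t) = z'].
  have mX' : measurable X' by rewrite /X' floor_cell //; apply: measurable_itv.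
  have -> : (fun t : R => c * (count (pred1 (Num.floor (m%:R * t))) (z' :: s'))%:R) =
     (fun t => c * \1_X' t + c * (count (pred1 (Num.floor (m%:R * t))) s')%:R).
    apply/funext => t; rewrite /= natrD mulrDr; congr (_ * _ + _).
    rewrite indicE; congr (nat_of_bool _)%:R.
    by apply/eqP/idP => [e|]; [rewrite mem_set|move/set_mem].
  apply: measurable_funD => //; apply: measurable_funM => //.
have split t : ((c * (count (pred1 (Num.floor (m%:R * t))) (z :: s))%:R)%:E =
   c%:E * (\1_X t)%:E + (c * (count (pred1 (Num.floor (m%:R * t))) s)%:R)%:E)%E.
  rewrite -EFinM -EFinD /= natrD mulrDr; congr (_ * _ + _)%:E.
  rewrite indicE; congr (nat_of_bool _)%:R.
  by apply/eqP/idP => [e|]; [rewrite mem_set|move/set_mem].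
under eq_integral do rewrite split.
rewrite ge0_integralD //=.
- rewrite IH ge0_integralZl //.
  + by rewrite intX -EFinM -EFinD /= -natr1; congr (_%:E); ring.
  + exact/measurable_EFinP/measurable_indic.
- by move=> t _; rewrite mule_ge0 // lee_fin.
- exact/measurable_funeM/measurable_EFinP/measurable_indic.
- by move=> t _; rewrite lee_fin mulr_ge0.
- exact: meas.
Qed.

(** Fubini on cells: for a fixed first coordinate t only the cells whose first index is the floor of
    m t remain, and the outer integral of their number is evaluated by [integral_cells]. *)
Lemma iter_integral_cells n (f : 'rV[R]_n -> \bar R) (m : nat) (s : seq 'rV[int]_n) :
  (0 < m)%N -> (forall x, (0 <= f x)%E) ->
  (forall x, (f x <= ((count (in_cell m x) s)%:R : R)%:E)%E) ->
  (iter_integral f <= ((size s)%:R / m%:R ^+ n)%:E)%E.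
Proof.
move=> m0; have m0' : 0 < m%:R :> R by rewrite ltr0n.
elim: n f s => [|n IH] f s f0 fs.
  rewrite /= expr0 divr1; apply: le_trans (fs 0) _.
  by rewrite lee_fin ler_nat count_size.
pose tl (z : 'rV[int]_(1 + n)) : 'rV[int]_n := rsubmx z.
pose hd (z : 'rV[int]_(1 + n)) : int := z ord0 ord0.
pose st (t : R) := [seq tl z | z <- s & hd z == Num.floor (m%:R * t)].
have inner t : (iter_integral (fun x : 'rV[R]_n => f (row_mx (const_mx t : 'rV[R]_1) x))
    <= ((size (st t))%:R / m%:R ^+ n)%:E)%E.
  apply: IH => [x|x]; first exact: f0.
  apply: le_trans (fs _) _; rewrite lee_fin ler_nat /st count_map count_filter.
  apply: sub_count => z /forallP h /=; apply/andP; split.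
    apply/forallP => i; have := h (rshift 1 i).
    by rewrite (row_mxEr (const_mx t : 'rV[R]_1)) /tl mxE.
  have := h (lshift n (ord0 : 'I_1)); rewrite (row_mxEl (const_mx t : 'rV[R]_1)) mxE eq_sym.
  by rewrite /hd (_ : ord0 = lshift n (ord0 : 'I_1) :> 'I_(1 + n)) //; apply/val_inj.
rewrite [iter_integral f]/=.
apply: (@le_trans _ _ (\int[mu]_t
   ((m%:R ^+ n)^-1 * (count (pred1 (Num.floor (m%:R * t))) [seq hd z | z <- s])%:R)%:E)%E).
  apply: integral_mono => t; first exact: iter_integral_ge0.
  apply: le_trans (inner t) _.
  rewrite /st size_map size_filter count_map mulrC lee_fin.
  by rewrite ler_wpM2l ?invr_ge0 ?exprn_ge0 // ler_nat; apply: sub_count.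
rewrite integral_cells ?invr_ge0 ?exprn_ge0 // size_map.
have mn0 : m%:R ^+ n != 0 :> R by rewrite expf_neq0 // gt_eqF.
suff -> : (m%:R ^+ n)^-1 / m%:R = (m%:R ^+ n.+1)^-1 :> R by rewrite lee_fin.
by rewrite exprS; field; rewrite mn0 gt_eqF.
Qed.

End Volume.

(** * The cone over a lattice polytope *)

Section Homogenization.
Local Open Scope classical_set_scope.
Variables (R : realType) (n : nat) (V : seq 'rV[R]_n).
Hypothesis (latV : forall v, v \in V -> lattice_point v) (fullV : full_dim V).
Local Notation I := 'I_(size V).
Local Notation vec := 'rV[R]_n.+1.

Definition lift_pt (c : R) (y : 'rV[R]_n) : vec := row_mx (const_mx c : 'rV_1) y.
Definition drop_pt (z : vec) : 'rV[R]_n := rsubmx (z : 'rV_(1 + n)).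
Definition gens (i : I) : vec := lift_pt 1 V`_i.

Lemma ord0_lshift : ord0 = lshift n (ord0 : 'I_1) :> 'I_(1 + n).
Proof. exact/val_inj. Qed.

Lemma ht_lift c y : ht (lift_pt c y) = c.
Proof.
transitivity ((row_mx (const_mx c : 'rV_1) y) ord0 (lshift n (ord0 : 'I_1))).
  by rewrite -ord0_lshift.
by rewrite row_mxEl mxE.
Qed.

Lemma lift_drop z : lift_pt (ht z) (drop_pt z) = z.
Proof.
have e : const_mx (ht z) = lsubmx (z : 'rV_(1 + n)).
  by apply/rowP => j; rewrite !mxE (ord1 j) /ht -ord0_lshift.
by rewrite /lift_pt /drop_pt e; apply: (hsubmxK (z : 'rV_(1 + n))).
Qed.

Lemma drop_lift c y : drop_pt (lift_pt c y) = y.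
Proof. exact: row_mxKr. Qed.

Lemma lift_inj c y y' : lift_pt c y = lift_pt c y' -> y = y'.
Proof. by move/(congr1 drop_pt); rewrite !drop_lift. Qed.

Lemma vecP x z : ht x = ht z -> drop_pt x = drop_pt z -> x = z.
Proof. by move=> e e'; rewrite -(lift_drop x) -(lift_drop z) e e'. Qed.

Lemma dropD x z : drop_pt (x + z) = drop_pt x + drop_pt z.
Proof. by apply/rowP => j; rewrite !mxE. Qed.

Lemma dropZ c z : drop_pt (c *: z) = c *: drop_pt z.
Proof. by apply/rowP => j; rewrite !mxE. Qed.

Lemma drop_sum (T : Type) (r : seq T) (P : pred T) (F : T -> vec) :
  drop_pt (\sum_(t <- r | P t) F t) = \sum_(t <- r | P t) drop_pt (F t).
Proof.
elim/big_rec2: _ => [|t u v _ <-]; last by rewrite dropD.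
by apply/rowP => j; rewrite !mxE.
Qed.

Lemma liftD c c' y y' : lift_pt c y + lift_pt c' y' = lift_pt (c + c') (y + y').
Proof. by apply: vecP; rewrite ?htD ?dropD ?ht_lift ?drop_lift. Qed.

Lemma liftZ e c y : e *: lift_pt c y = lift_pt (e * c) (e *: y).
Proof. by apply: vecP; rewrite ?htZ ?dropZ ?ht_lift ?drop_lift. Qed.

Lemma liftN c y : - lift_pt c y = lift_pt (- c) (- y).
Proof. by rewrite -scaleN1r liftZ mulN1r scaleN1r. Qed.

Lemma lift_sum (T : Type) (r : seq T) (P : pred T) (c : T -> R) (y : T -> 'rV[R]_n) :
  \sum_(t <- r | P t) lift_pt (c t) (y t) =
  lift_pt (\sum_(t <- r | P t) c t) (\sum_(t <- r | P t) y t).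
Proof.
apply: vecP; rewrite ?ht_sum ?drop_sum ?ht_lift ?drop_lift.
  by apply: eq_bigr => t _; rewrite ht_lift.
by apply: eq_bigr => t _; rewrite drop_lift.
Qed.

Lemma lat_lift c y : c \is a Num.int -> lattice_point y -> lattice_point (lift_pt c y).
Proof.
move=> hc hy j; have [k ->|k ->] := split_ordP (j : 'I_(1 + n)).
  have e : (const_mx c : 'rV_1) ord0 k = c by rewrite mxE.
  by rewrite -e -(row_mxEl (const_mx c : 'rV_1) y ord0 k) in hc.
by have e := row_mxEr (const_mx c : 'rV_1) y ord0 k; have := hy k; rewrite -e.
Qed.

Lemma lat_drop z : lattice_point z -> lattice_point (drop_pt z).
Proof. by move=> hz j; rewrite mxE. Qed.

Lemma ht_gens i : ht (gens i) = 1.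
Proof. exact: ht_lift. Qed.

Lemma lat_gens i : lattice_point (gens i).
Proof. by apply: lat_lift; [exact: rpred1|apply: latV; rewrite mem_nth]. Qed.

Lemma comb_gens (l : I -> R) :
  comb gens l = lift_pt (\sum_i l i) (\sum_i l i *: V`_i).
Proof.
rewrite /comb; under eq_bigr do rewrite /gens liftZ mulr1.
by rewrite lift_sum.
Qed.

Lemma spans_gens : spans gens.
Proof.
have [s0 rk] := fullV; move=> x; pose i0 : I := Ordinal s0.
set M := \matrix_(i < size V) (V`_i - V`_0) in rk.
have : (drop_pt x - ht x *: V`_0 <= M)%MS.
  by rewrite submx_full // /row_full rk.
case/submxP => c hc; pose l i := c 0 i + (i == i0)%:R * (ht x - \sum_j c 0 j).
have sd t : \sum_(i : I) (i == i0)%:R * t = t.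
  by rewrite (bigD1 i0) // eqxx /= mul1r big1 ?addr0 // => i /negPf ->; rewrite mul0r.
have sd' t : \sum_(i : I) ((i == i0)%:R * t) *: V`_i = t *: V`_0.
  rewrite (bigD1 i0) // eqxx /= mul1r big1 ?addr0 // => i /negPf ->.
  by rewrite mul0r scale0r.
exists l; rewrite comb_gens -[x in LHS]lift_drop; congr lift_pt.
  by rewrite big_split /= sd addrC subrK.
rewrite /l; under eq_bigr do rewrite scalerDl.
rewrite big_split /= sd' -[LHS](subrK (ht x *: V`_0)) hc mulmx_sum_row.
under [in LHS]eq_bigr do rewrite rowK scalerBr.
by rewrite sumrB -scaler_suml scalerBl [RHS]addrA addrAC.
Qed.

Lemma conv_cone (m : nat) y : dilate m (conv V) y <-> cone gens (lift_pt m%:R y).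
Proof.
split.
  case=> _ [lam [lam0 [lam1 ->]]] <-; exists (fun i => m%:R * lam i).
    by move=> i; rewrite mulr_ge0.
  rewrite comb_gens -mulr_sumr lam1 mulr1 scaler_sumr; congr lift_pt.
  by apply: eq_bigr => i _; rewrite scalerA.
case=> l l0 e; have hl : \sum_i l i = m%:R.
  by have := congr1 (@ht _ _) e; rewrite comb_gens !ht_lift.
have [s0 _] := fullV; pose i0 : I := Ordinal s0.
(* At m = 0 all coefficients vanish, and the dilate still contains 0 because [V] is nonempty. *)
case: m e hl => [|m] e hl.
  have lz i : l i = 0 by apply: (psumr_eq0P (fun i _ => l0 i) hl).
  have y0 : y = 0.
    move: e; rewrite comb_gens hl => /lift_inj ->.
    by rewrite big1 // => i _; rewrite lz scale0r.
  exists V`_0; last by rewrite y0 scale0r.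
  exists (fun i => (i == i0)%:R); split=> [i|]; first exact: ler0n.
  split; first by rewrite (bigD1 i0) // eqxx /= big1 ?addr0 // => i /negPf ->.
  rewrite (bigD1 i0) // eqxx /= scale1r big1 ?addr0 // => i /negPf ->.
  by rewrite scale0r.
have m0 : 0 < m.+1%:R :> R by rewrite ltr0n.
exists (m.+1%:R^-1 *: y); last by rewrite scalerA divff ?scale1r // gt_eqF.
exists (fun i => m.+1%:R^-1 * l i); split=> [i|].
  by rewrite mulr_ge0 // invr_ge0 ltW.
split; first by rewrite -mulr_sumr hl mulVf // gt_eqF.
move: e; rewrite comb_gens hl => /lift_inj ->; rewrite scaler_sumr.
by apply: eq_bigr => i _; rewrite scalerA.
Qed.

Lemma finite_dilate (m : nat) :
  finite_set (dilate m (conv V) `&` [set x | lattice_point x]).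
Proof.
apply: (@sub_finite_set _ _ (drop_pt @` slice gens m%:Z)); last first.
  by apply: finite_image; apply: finite_slice; exact: ht_gens.
move=> y [/conv_cone cy ly]; exists (lift_pt m%:R y).
  by split; [apply: lat_lift => //; exact: rpred_nat| |exact: ht_lift].
exact: drop_lift.
Qed.

Lemma ehrhart_cnt (m : nat) : ehrhart (conv V) m = cnt (slice gens m%:Z).
Proof.
have -> : slice gens m%:Z =
    lift_pt m%:R @` (dilate m (conv V) `&` [set x | lattice_point x]).
  apply/seteqP; split=> z.
    case=> lz cz hz; exists (drop_pt z); last by rewrite -{1}[m%:R]/((m%:Z)%:~R) -hz lift_drop.
    split; last exact: lat_drop.
    by apply/conv_cone; rewrite -[m%:R]/((m%:Z)%:~R) -hz lift_drop.
  case=> y [/conv_cone cy ly] <-; split=> //; last exact: ht_lift.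
  by apply: lat_lift => //; apply: rpred_nat.
rewrite cnt_image //; first exact: finite_dilate.
by move=> x y _ _; apply: lift_inj.
Qed.

(** Both sums are padded to a common length: the binomial kills the extra terms of one, negative
    heights those of the other. *)
Lemma hstar_dlt (i : nat) : hstar (conv V) i = dlt n.+1 (ehr gens) i%:Z.
Proof.
pose F (j : nat) : int := (-1) ^+ j * 'C(n.+1, j)%:Z * ehr gens (i%:Z - j%:Z).
have -> : dlt n.+1 (ehr gens) i%:Z = \sum_(j < i.+1 + n.+2) F j.
  rewrite addnC big_split_ord /= [X in _ + X]big1 ?addr0 // => j _.
  by rewrite /F bin_small ?mulr0 ?mul0r // leq_addr.
rewrite big_split_ord /= [X in _ + X]big1 ?addr0.
  apply: eq_bigr => j _; rewrite /F /ehr /= ehrhart_cnt.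
  by rewrite subzn // -ltnS.
move=> j _; rewrite /F ehr_neg ?mulr0 //; first exact: ht_gens.
rewrite /=; lia.
Qed.

(** The sum [q] of the generators is interior, so large multiples of it absorb each [- E j]. A unit
    cube thus fits into a dilate of the polytope, with a lattice point as its top corner. *)
Lemma exists_cube : exists (M : nat) (w : 'rV[R]_n), lattice_point w /\
  forall e : 'rV[R]_n, (forall j, 0 <= e ord0 j <= 1) -> cone gens (lift_pt M%:R (w - e)).
Proof.
pose q := \sum_i gens i; pose E j : vec := lift_pt 0 (delta_mx ord0 j).
have iq : icone gens q := icone_sum_gen gens.
have cq := icone_cone iq.
have hM j : exists M : nat, cone gens (M%:R *: q - E j).
  have [e e0 he] := icone_absorbs (- E j) spans_gens iq.
  exists (Num.bound e^-1).
  have b : e^-1 < (Num.bound e^-1)%:R by apply: archi_boundP; rewrite invr_ge0 ltW.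
  have ei : 0 <= e^-1 by rewrite invr_ge0 ltW.
  have := coneD (coneZ ei he) (coneZ (ltW (eq_ind_r is_true b (subr_gt0 _ _))) cq).
  congr cone; rewrite scalerDr scalerA mulVf ?gt_eqF // scale1r scalerBl.
  by rewrite addrAC addrCA subrr addr0.
have [M hM'] := choice hM; pose S := (\sum_j M j)%N.
have qE : q = lift_pt (size V)%:R (\sum_(i < size V) V`_i).
  by rewrite /q /gens lift_sum sumr_const card_ord.
exists (S * size V)%N, (S%:R *: \sum_(i < size V) V`_i); split.
  apply: latZ; first exact: rpred_nat.
  by apply: lat_sum => i _; apply: latV; rewrite mem_nth.
move=> e he.
have -> : lift_pt (S * size V)%:R (S%:R *: \sum_(i < size V) V`_i - e) =
    S%:R *: q - \sum_j e ord0 j *: E j.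
  have -> : \sum_j e ord0 j *: E j = lift_pt 0 e.
    under eq_bigr => j _ do rewrite /E liftZ mulr0.
    by rewrite lift_sum big1 // -row_sum_delta.
  by rewrite qE liftZ natrM liftN liftD oppr0 addr0.
have -> : S%:R *: q - \sum_j e ord0 j *: E j =
   \sum_j (e ord0 j *: ((M j)%:R *: q - E j) + ((1 - e ord0 j) * (M j)%:R) *: q).
  rewrite /S natr_sum scaler_suml -sumrB; apply: eq_bigr => j _.
  by apply/rowP => t; rewrite !mxE; ring.
apply: cone_sum => j _; have /andP[e0 e1] := he j.
apply: coneD; first exact: coneZ.
by apply: coneZ => //; rewrite mulr_ge0 // subr_ge0.
Qed.

(** The shifted floor of m x is m x plus a point of the cube [w - e], where [e] is the vector of
    fractional parts. *)
Lemma cover_cells (M : nat) (w : 'rV[R]_n) (m : nat) x :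
  (forall e : 'rV[R]_n, (forall j, 0 <= e ord0 j <= 1) ->
     cone gens (lift_pt M%:R (w - e))) -> lattice_point w -> conv V x ->
  (dilate (m + M) (conv V) `&` [set x | lattice_point x])
    (w + \row_j (Num.floor (m%:R * x ord0 j))%:~R).
Proof.
move=> hM lw cx; split; last first.
  by apply: latD => // j; rewrite mxE; apply: rpred_int.
apply/conv_cone; set e : 'rV[R]_n := \row_j (m%:R * x ord0 j - (Num.floor (m%:R * x ord0 j))%:~R).
have -> : lift_pt (m + M)%:R (w + \row_j (Num.floor (m%:R * x ord0 j))%:~R) =
    lift_pt m%:R (m%:R *: x) + lift_pt M%:R (w - e).
  rewrite liftD -natrD; congr lift_pt; apply/rowP => j; rewrite !mxE; ring.
apply: coneD; first by apply/conv_cone; exists x.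
apply: hM => j; rewrite mxE; have := floor_itv (m%:R * x ord0 j).
by rewrite rmorphD /=; lra.
Qed.

End Homogenization.

(** * From bounded differences to the volume *)

Section Growth.
Local Open Scope classical_set_scope.
Variables (F : int -> int) (D : nat) (H : int).
Hypothesis F_neg : forall m, m < 0 -> F m = 0.
Hypothesis H0 : forall m : nat, \sum_(i < m.+1) dlt D.+1 F i%:Z <= H.

Lemma dlt_neg k m : m < 0 -> dlt k F m = 0.
Proof. by move=> m0; apply: big1 => j _; rewrite F_neg ?mulr0 //; lia. Qed.

(** The partial sums in [H0] telescope to the D-th difference. Each further summation raises the
    binomial by the hockey-stick identity. *)
Lemma dlt_growth j (m : nat) : (j <= D)%N -> dlt (D - j) F m%:Z <= H * 'C(m + j, j)%:Z.
Proof.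
elim: j m => [|j IH] m jD.
  rewrite subn0 bin0 mulr1; apply: le_trans (H0 m).
  elim: m => [|m IHm].
    by rewrite big_ord1 dltS (@dlt_neg _ (0 - 1)) ?subr0.
  rewrite big_ord_recr /= dltS (_ : m.+1%:Z - 1 = m%:Z); last by lia.
  by rewrite addrCA lerDl subr_ge0.
have e : (D - j = (D - j.+1).+1)%N by lia.
elim: m => [|m IHm].
  have := IH 0%N (ltnW jD); rewrite e dltS (@dlt_neg _ (0 - 1)) ?subr0 //.
  by rewrite !add0n !binn.
have := IH m.+1 (ltnW jD); rewrite e dltS (_ : m.+1%:Z - 1 = m%:Z); last by lia.
rewrite addSnnS => h; rewrite addSn binS PoszD mulrDr.
by have := lerD IHm h; rewrite addrCA subrr addr0.
Qed.

Lemma growth (m : nat) : F m%:Z <= H * 'C(m + D, D)%:Z.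
Proof. by have := @dlt_growth D m (leqnn _); rewrite subnn dlt0. Qed.

End Growth.

Lemma ffact_le_exp (m k : nat) : (m ^_ k <= m ^ k)%N.
Proof.
by elim: k => // k IH; rewrite ffactnSr expnSr leq_mul ?leq_subr.
Qed.

(** Passage to the limit by a chord: for e in [0, 1], (1 + K e)^n is at most 1 + e ((1 + K)^n - 1),
    so the excess over H is O(1/m). *)
Lemma le_of_asymptotic (R : realType) (v H K : R) (n : nat) : 0 <= H -> 0 <= K ->
  (forall m : nat, (0 < m)%N -> v <= H * (1 + K / m%:R) ^+ n) -> v <= H.
Proof.
move=> H0 K0 hv.
have pw e : 0 <= e <= 1 -> (1 + K * e) ^+ n <= 1 + e * ((1 + K) ^+ n - 1).
  case/andP=> e0 e1; elim: n {hv} => [|t IH]; first by rewrite !expr0; lra.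
  have P1 : 1 <= (1 + K) ^+ t by rewrite exprn_ege1 // lerDl.
  rewrite !exprS; set P := (1 + K) ^+ t in P1 IH *.
  have Ke : 0 <= K * e by rewrite mulr_ge0.
  apply: (@le_trans _ _ ((1 + K * e) * (1 + e * (P - 1)))).
    by rewrite ler_wpM2l //; lra.
  have : 0 <= K * e * (1 - e) * (P - 1) by rewrite !mulr_ge0 // subr_ge0.
  lra.
rewrite leNgt; apply/negP => vH.
set C := (1 + K) ^+ n - 1 in pw.
have C0 : 0 <= C by rewrite subr_ge0 exprn_ege1 // lerDl.
pose m := (Num.bound (H * C / (v - H))).+1.
have d0 : 0 < v - H by lra.
have hm : H * C / (v - H) < m%:R.
  apply: (@lt_trans _ _ (Num.bound (H * C / (v - H)))%:R); last by rewrite ltr_nat.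
  by apply: archi_boundP; rewrite divr_ge0 ?mulr_ge0 // ltW.
have m0 : 0 < m%:R :> R by rewrite ltr0n.
have := hv m isT; rewrite ltr_pdivrMr // in hm.
have e01 : 0 <= (m%:R^-1 : R) <= 1 by rewrite invr_ge0 ltW //= invf_le1 // ler1n.
have := ler_wpM2l H0 (pw _ e01).
rewrite -[m%:R^-1 * C]mulrC mulrDr mulr1 mulrA => h1 h2.
have : H * C / m%:R < v - H by rewrite ltr_pdivrMr // [X in _ < X]mulrC.
lra.
Qed.

(** * The volume bound *)

Section VolumeBound.
Variables (R : realType) (n : nat) (V : seq 'rV[R]_n).
Hypothesis (latV : forall v, v \in V -> lattice_point v) (fullV : full_dim V).
Local Notation a := (@gens R n V).

Lemma euclid_vol_le_ehrhart : exists M : nat, forall m : nat, (0 < m)%N ->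
  (euclid_vol (conv V) <= ((ehrhart (conv V) (m + M))%:R / m%:R ^+ n)%:E)%E.
Proof.
have [M [w [lw hM]]] := exists_cube latV fullV.
exists M => m m0; rewrite /euclid_vol.
pose A := (dilate (m + M) (conv V) `&` [set x | lattice_point x])%classic.
pose cell (z : 'rV[R]_n) : 'rV[int]_n := \row_j Num.floor ((z - w) ord0 j).
pose s := [seq cell z | z <- fset_set A].
have -> : ehrhart (conv V) (m + M) = size s by rewrite size_map.
apply: iter_integral_cells => // x.
rewrite lee_fin indicE; case: (boolP (x \in conv V)) => [/set_mem cx|_]; last first.
  by rewrite ler0n.
rewrite ler_nat -has_count; apply/hasP.
pose z := w + \row_j (Num.floor (m%:R * x ord0 j))%:~R.
exists (cell z).
  apply: map_f; rewrite in_fset_set; last exact: finite_dilate.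
  exact/mem_set/cover_cells.
by apply/forallP => j; rewrite mxE /z !mxE addrAC subrr add0r intrKfloor.
Qed.

Lemma normalized_vol_le (H : int) : 0 <= H ->
  (forall m : nat, \sum_(i < m.+1) dlt n.+1 (ehr a) i%:Z <= H) ->
  (normalized_vol (conv V) <= (H%:~R : R)%:E)%E.
Proof.
move=> H0 sumH; have [M hM] := euclid_vol_le_ehrhart.
have vol0 : (0 <= euclid_vol (conv V))%E.
  by apply: iter_integral_ge0 => x; rewrite lee_fin indicE ler0n.
have finv : euclid_vol (conv V) \is a fin_num.
  by rewrite ge0_fin_numE //; apply: le_lt_trans (hM 1%N isT) _; apply: ltry.
move: vol0 hM; rewrite /normalized_vol -(fineK finv) lee_fin => vol0 hM.
set v := fine _ in vol0 hM *; rewrite -EFinM lee_fin.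
(* The shift M comes from covering the cells and n from the binomial: n! times C(m + M + n, n) is at
   most (m + M + n)^n. *)
apply: (@le_of_asymptotic _ _ _ (M + n)%:R n).
- by rewrite ler0z.
- exact: ler0n.
move=> m m0; have m0' : 0 < m%:R :> R by rewrite ltr0n.
have hv := hM m m0; rewrite lee_fin in hv.
apply: (@le_trans _ _ (n`!%:R * ((ehrhart (conv V) (m + M))%:R / m%:R ^+ n))).
  by rewrite ler_pM2l // ltr0n fact_gt0.
have -> : 1 + (M + n)%:R / m%:R = (m + M + n)%:R / m%:R :> R.
  by rewrite -addnA [in RHS]natrD mulrDl divff // gt_eqF.
rewrite expr_div_n !mulrA ler_pM2r ?invr_gt0 ?exprn_gt0 //.
have ge := growth (fun m => ehr_neg (@ht_gens R n V) (m := m)) sumH (m + M).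
have {}ge : (ehrhart (conv V) (m + M))%:R <= (H%:~R : R) * 'C(m + M + n, n)%:R.
  rewrite (ehrhart_cnt fullV).
  by move: ge; rewrite -(ler_int R) rmorphM.
apply: (@le_trans _ _ (n`!%:R * (H%:~R * 'C(m + M + n, n)%:R))).
  by rewrite ler_pM2l // ltr0n fact_gt0.
rewrite mulrCA ler_wpM2l ?ler0z // -natrM -natrX ler_nat mulnC bin_ffact.
exact: ffact_le_exp.
Qed.

End VolumeBound.

Lemma sum_le_of_support (F : nat -> int) (d : nat) :
  (forall i, 0 <= F i) -> (forall i, (d < i)%N -> F i = 0) ->
  forall m : nat, \sum_(i < m.+1) F i <= \sum_(i < d.+1) F i.
Proof.
move=> F0 Fd m; apply: (@le_trans _ _ (\sum_(i < m.+1 + d.+1) F i)).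
  by rewrite big_split_ord /= lerDl sumr_ge0.
rewrite addnC big_split_ord /= [X in _ + X]big1 ?addr0 // => i _.
by rewrite Fd //= addSn ltnS leq_addr.
Qed.

Lemma cnt_slice0 (R : realType) n (I : finType) (a : I -> 'rV[R]_n.+1) :
  (forall i, ht (a i) = 1) -> (cnt (slice a 0) <= 1)%N.
Proof.
move=> ha; apply: (@leq_trans (cnt [set (0 : 'rV[R]_n.+1)]%classic)); last first.
  by rewrite /cnt fset_set1 cardfs1.
apply: cnt_sub => [|z [_ [l l0 ->]]]; first exact: finite_set1.
rewrite (ht_comb ha) => hl; rewrite /= /comb big1 // => i _.
by rewrite (psumr_eq0P (fun i _ => l0 i) hl) // scale0r.
Qed.

(** * Comparison with the stated constants *)

Section Numerics.
Local Open Scope nat_scope.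
Variables d N : nat.
Hypothesis d0 : 0 < d.
Hypothesis hN : N = (d ^ 2 + 19 * d - 4)./2.

Lemma twice_N : d ^ 2 + 19 * d - 5 <= 2 * N.
Proof. by rewrite hN; have := odd_double_half (d ^ 2 + 19 * d - 4); lia. Qed.

Lemma N_ge : 8 * d <= N.
Proof. have := twice_N; move: d0; nia. Qed.

(** Compares exponents of 2 once the factor 2^(8d + 1) is split off; the 3 on the right is
    affordable because 2^3 is at most 14. *)
Lemma exponent_le : (d + 5) * (4 * d + 1) * (d + 1) * 2 <= 3 * N ^ 2.
Proof.
have h : d ^ 2 + 14 * d <= 2 * N by have := twice_N; move: d0; nia.
have : (d ^ 2 + 14 * d) ^ 2 <= (2 * N) ^ 2 by rewrite leq_exp2r.
move: d0; rewrite !expnS !expn0; nia.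
Qed.

(** With u = 2(j + 1) at most 8d + 2, the base 6u is at most 48d + 12, hence at most 2^(d + 5). The
    extra factor 5d is paid by doubling the exponent. *)
Lemma cells_le j r : j <= 4 * d -> r <= j.+1 ->
  (4 * d * (6 * (2 * j.+1)) ^ (2 ^ (2 * j.+1).-1)).+1 <= 2 ^ ((d + 5) * 2 ^ (8 * d + 2)).
Proof.
move=> jd rj; set u := 2 * j.+1.
have base : 48 * d + 12 <= 2 ^ (d + 5).
  have : 60 * d <= 2 ^ (d + 5).
    elim: (d) d0 => // -[//|e IH _]; rewrite addSn expnS.
    by have := IH isT; lia.
  by move: d0; lia.
have u1 : 6 * u <= 2 ^ (d + 5) by apply: leq_trans base; rewrite /u; lia.
have pw : (6 * u) ^ (2 ^ u.-1) <= 2 ^ ((d + 5) * 2 ^ (8 * d + 1)).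
  rewrite expnM; apply: (@leq_trans ((2 ^ (d + 5)) ^ (2 ^ u.-1))).
    by rewrite leq_exp2r ?expn_gt0.
  by rewrite leq_pexp2l ?expn_gt0 // leq_pexp2l // /u; lia.
have p0 : 0 < (6 * u) ^ (2 ^ u.-1) by rewrite expn_gt0 /u.
have d5 : 5 * d <= 2 ^ ((d + 5) * 2 ^ (8 * d + 1)).
  apply: leq_trans (leq_trans (_ : 5 * d <= 48 * d + 12) base) _; first by lia.
  by rewrite leq_pexp2l // leq_pmulr // expn_gt0.
apply: (@leq_trans (5 * d * (6 * u) ^ (2 ^ u.-1))); first by move: d0 p0; nia.
have -> : (d + 5) * 2 ^ (8 * d + 2) = (d + 5) * 2 ^ (8 * d + 1) + (d + 5) * 2 ^ (8 * d + 1).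
  by rewrite addn2 addn1 (expnS 2 (8 * d).+1); lia.
by rewrite expnD leq_mul.
Qed.

(** The factorial prefactor only has to absorb d + 1, and k^(d + 1) is at most k^N. The cell counts
    together give G^((4d + 1)(d + 1)), a power of 2 handled by [exponent_le] and [N_ge]. *)
Lemma bound_le j r k ib : j <= 4 * d -> r <= j.+1 -> 0 < k ->
  ib = (6 * (2 * j.+1)) ^ (2 ^ (2 * j.+1).-1) ->
  d.+1 * ((2 * ib).+1 ^ j.+1 * k) ^ d * (4 * d * ib).+1 ^ r * k <=
  N ^ N * N`! ^ (N + 1) * k ^ N * 14 ^ (N ^ 2 * 2 ^ (N + 1)).
Proof.
move=> jd rj k0 hib; set G := 2 ^ ((d + 5) * 2 ^ (8 * d + 2)).
have Gle : (4 * d * ib).+1 <= G by rewrite hib; apply: cells_le jd rj.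
have G1 : (2 * ib).+1 <= G.
  by apply: leq_trans Gle; rewrite ltnS leq_mul2r; apply/orP; right; lia.
have G0 : 0 < G by rewrite expn_gt0.
have j1 : j.+1 <= 4 * d + 1 by lia.
have e1 : (2 * ib).+1 ^ j.+1 <= G ^ (4 * d + 1).
  apply: (@leq_trans (G ^ j.+1)); first by rewrite leq_exp2r.
  by rewrite leq_pexp2l.
have e2 : (4 * d * ib).+1 ^ r <= G ^ (4 * d + 1).
  apply: (@leq_trans (G ^ r)); first by case: (r) => // r'; rewrite leq_exp2r.
  by rewrite leq_pexp2l //; apply: leq_trans rj j1.
apply: (@leq_trans (d.+1 * (G ^ (4 * d + 1) * k) ^ d * G ^ (4 * d + 1) * k)).
  by rewrite leq_mul2r !leq_mul ?orbT // leq_exp2r // leq_mul2r e1 orbT.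
have -> : d.+1 * (G ^ (4 * d + 1) * k) ^ d * G ^ (4 * d + 1) * k =
    d.+1 * k ^ d.+1 * G ^ ((4 * d + 1) * (d + 1)).
  rewrite expnMn (expnS k) mulnDr muln1 [in RHS]expnD [in RHS]expnM; ring.
have N8 := N_ge.
have f1 : d.+1 <= N ^ N * N`! ^ (N + 1).
  apply: (@leq_trans (N ^ N)); last by rewrite leq_pmulr // expn_gt0 fact_gt0.
  apply: (@leq_trans N); first by move: d0 N8; lia.
  by rewrite -[X in X <= _]expn1 leq_pexp2l; move: d0 N8; lia.
apply: leq_mul; first apply: leq_mul => //.
  by rewrite leq_pexp2l //; move: d0 N8; lia.
rewrite /G -expnM.
apply: (@leq_trans (2 ^ (3 * (N ^ 2 * 2 ^ (N + 1))))).
  rewrite leq_pexp2l //.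
  apply: (@leq_trans (3 * N ^ 2 * 2 ^ (8 * d + 1))).
    rewrite (_ : 8 * d + 2 = (8 * d + 1).+1); last by lia.
    rewrite expnS; have := exponent_le; set E := 2 ^ (8 * d + 1) => h.
    have := leq_mul h (leqnn E); set lhs := (_ * E)%N; set rhs := (_ * E)%N.
    by apply: leq_trans; rewrite /lhs; apply/eq_leq; ring.
  rewrite -mulnA !leq_mul2l leq_pexp2l ?orbT //; lia.
by rewrite expnM leq_exp2r // muln_gt0 !expn_gt0; move: d0 N8; lia.
Qed.

End Numerics.

Local Open Scope classical_set_scope.
Local Open Scope ring_scope.

Theorem theorem4p1 (R : realType) (n : nat) (V : seq 'rV[R]_n) (d : nat) (k : int) :
  (forall v, v \in V -> lattice_point v) ->
  full_dim V ->
  (forall i, (d < i)%N -> hstar (conv V) i = 0) ->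
  hstar (conv V) d = k -> k != 0 ->
  let N := ((d ^ 2 + 19 * d - 4)./2)%N in
  (normalized_vol (conv V) <=
   (((N ^ N * (factorial N) ^ (N + 1))%N)%:R * (k%:~R) ^+ N *
     Num.min ((7 * (k + 1))%:~R ^+ (N ^ 2 * 2 ^ (N + 1))%N)
             ((((8 * N) ^ (N ^ 2) * 15 ^ (N ^ 2 * 2 ^ (2 * N + 1)))%N)%:R)
     : R)%:E)%E.
Proof.
move=> latV fullV hd hk k0; cbv zeta; set N := ((d ^ 2 + 19 * d - 4)./2)%N.
have hg := @ht_gens R n V; have sp := spans_gens fullV; have lg := lat_gens latV.
have hd' (i : nat) : (d < i)%N -> dlt n.+1 (ehr (gens (V := V))) i%:Z = 0.
  by move=> di; rewrite -(hstar_dlt fullV) hd.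
have hk' : dlt n.+1 (ehr (gens (V := V))) d%:Z = k by rewrite -(hstar_dlt fullV).
have [hmin hint [x0 x0i] dge0 [q iq hbox]] := reciprocity hg sp lg hd' hk' k0.
have k1 : 0 < k by rewrite lt_def k0 -hk' dge0.
set H := \sum_(i < d.+1) _ in hbox.
have H0 : 0 <= H by apply: sumr_ge0.
apply: le_trans (normalized_vol_le latV fullV H0 _) _.
  exact: (sum_le_of_support (F := fun i : nat => dlt n.+1 (ehr (gens (V := V))) i)).
rewrite lee_fin.
(* For d = 0 the truncated subtraction makes N = 0, so the right-hand side is 1, and the sum of the
   [h*] coefficients is [h*] at 0, namely 1. *)
have [dz|d0] := posnP d.
  have -> : H = k by rewrite /H -hk' dz big_ord1.
  have -> : k = 1.
    apply/eqP; rewrite eq_le -[1 <= k]/(0 < k) k1 andbT -hk dz /hstar big_ord1.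
    by rewrite expr0 bin0 !mul1r lez_nat subnn (ehrhart_cnt fullV) cnt_slice0.
  have -> : N = 0%N by rewrite /N dz.
  by rewrite expn0 (exp0n (n := 2)) // !mul0n !expr0 !expn0 exp1n minxx !mul1r.
have [f uf fmax] := exists_max_volume sp.
have [J [Jd NJ neg]] := exists_small_core hg lg uf hmin.
have [kn kE] : exists kn : nat, k = kn%:Z by exists `|k|%N; rewrite gtz0_abs.
have hint' : (cnt (interior_points (gens (V := V)) (n.+1%:Z - d%:Z)) <= kn)%N.
  by rewrite -lez_nat -kE.
have [r [rJ hb]] := box_points_bound hg sp lg uf fmax NJ neg hint' x0i iq d0.
have kn0 : (0 < kn)%N by rewrite -ltz_nat -kE.
have := leq_trans hb (bound_le d0 (erefl N) Jd rJ kn0 (erefl _)).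
set Bd := (14 ^ _)%N => bnd.
apply: (@le_trans _ _ ((N ^ N * N`! ^ (N + 1) * kn ^ N * Bd)%N%:R)).
  rewrite -[X in _ <= X]/((_ %:Z)%:~R) ler_int; apply: le_trans hbox _.
  by rewrite lez_nat.
rewrite natrM (natrM _ _ (kn ^ N)%N) natrX kE -[(kn%:Z)%:~R]/(kn%:R).
rewrite ler_wpM2l ?mulr_ge0 ?ler0n ?exprn_ge0 // le_min; apply/andP; split.
  (* Positivity of k enters: 14 is at most 7(k + 1). *)
  rewrite /Bd natrX lerXn2r ?nnegrE ?ler0n ?ler0z //.
    by rewrite -[14%:R]/((14%:Z)%:~R) ler_int; move: kn0; lia.
rewrite ler_nat /Bd; have N0 : (0 < N)%N by have := N_ge d0 (erefl N); rewrite -/N; lia.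
apply: (@leq_trans (15 ^ (N ^ 2 * 2 ^ (2 * N + 1)))%N); last first.
  by rewrite leq_pmull // expn_gt0 muln_gt0 N0.
apply: (@leq_trans (15 ^ (N ^ 2 * 2 ^ (N + 1)))%N).
  by rewrite leq_exp2r // muln_gt0 !expn_gt0 N0.
by rewrite leq_pexp2l // leq_mul2l leq_pexp2l ?orbT //; lia.
Qed.
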